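(* Let $\alpha>0$, let $\varphi(z)=a+\lambda z$ with $a,\lambda\in\mathbb{C}$ and $0<|\lambda|<1$, put $\beta=1-|\lambda|^2$, and let $\psi$ be a non-vanishing entire function. Consider the weighted composition operator $W_{\psi,\varphi}f=\psi\cdot(f\circ\varphi)$ acting on $X$, where $X=\mathcal{F}^p_\alpha$ for some $1\le p\le\infty$, or $X=\mathcal{F}^\infty_{\alpha,0}$. (a) $W_{\psi,\varphi}$ is compact on $X$ if and only if $\psi$ has the form $\psi(z)=e^{a_0+a_1z+a_2z^2}$ with $a_0,a_1,a_2\in\mathbb{C}$ and $|a_2|<\frac{\alpha}{2}\beta$. (b) $W_{\psi,\varphi}$ is bounded but not compact on $X$ if and only if $\psi$ has the form $\psi(z)=e^{a_0+a_1z+a_2z^2}$ with $a_0,a_1,a_2\in\mathbb{C}$, $|a_2|=\frac{\alpha}{2}\beta$, and, writing $t:=a_1+\alpha\overline{a}\lambda$, either $t=0$, or else both $t\ne0$ and $a_2=-\frac{\alpha}{2}\beta\,\frac{t^2}{|t|^2}$.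
   Context: For $\alpha>0$ and $1\le p<\infty$, the Fock space $\mathcal{F}^p_\alpha$ is the Banach space of entire functions $f:\mathbb{C}\to\mathbb{C}$ with finite norm $\|f\|=\left(\frac{\alpha p}{2\pi}\int_{\mathbb{C}}|f(z)|^p e^{-\frac{\alpha p}{2}|z|^2}\,dm(z)\right)^{1/p}$, where $dm$ is area measure on $\mathbb{C}$. The space $\mathcal{F}^\infty_\alpha$ consists of the entire functions with finite norm $\|f\|=\sup_{z\in\mathbb{C}}|f(z)|e^{-\frac{\alpha}{2}|z|^2}$. The space $\mathcal{F}^\infty_{\alpha,0}$ is the closed subspace of $\mathcal{F}^\infty_\alpha$ of entire functions with $\lim_{z\to\infty}f(z)e^{-\frac{\alpha}{2}|z|^2}=0$. The operator $W_{\psi,\varphi}$ is said to be bounded (compact) on one of these spaces $X$ if it maps $X$ into $X$ and is a bounded (compact) linear operator there. *)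

(* Defs.v *)
From HB Require Import structures.
From mathcomp Require Export all_boot all_order all_algebra.
From mathcomp Require Export complex.
From mathcomp Require Export all_classical all_reals all_analysis.
Set Implicit Arguments.
Unset Strict Implicit.
Unset Printing Implicit Defensive.
Import Order.TTheory GRing.Theory Num.Theory.
Import numFieldNormedType.Exports.
Local Open Scope classical_set_scope.
Local Open Scope complex_scope.
Local Open Scope ring_scope.

(* The modulus of a complex number as an element of R: the norm `|z| of the
   library takes its values in R[i]. *)
Definition cmod (R : realType) (z : R[i]) : R := ComplexField.Normc.normc z.

Lemma cmodE (R : realType) (z : R[i]) : `|z| = (cmod z)%:C.
Proof. by []. Qed.

Definition cexp (R : realType) (z : R[i]) : R[i] :=
  (expR (complex.Re z))%:C * (cos (complex.Im z) +i* sin (complex.Im z)).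

(* The increment in [derivable] ranges over the scalar field, here R[i], so
   this is complex differentiability at every point. *)
Definition entire (R : realType) (f : R[i] -> R[i]) : Prop :=
  forall z : R[i], derivable (f : R[i]^o -> R[i]^o) z 1.

Definition area_integral (R : realType) (u : R[i] -> \bar R) : \bar R :=
  (\int[lebesgue_measure \x lebesgue_measure]_w u (w.1 +i* w.2))%E.

(* The exponent ranges over the extended reals, so that p = +oo gives the
   sup norm; the value at p = -oo is irrelevant. *)
Definition fock_norm (R : realType) (alpha : R) (p : \bar R)
    (f : R[i] -> R[i]) : \bar R :=
  match p with
  | q%:E => (((alpha * q / (2 * pi))%:E *
      area_integral (fun z =>
        (cmod (f z) `^ q * expR (- (alpha * q / 2) * cmod z ^+ 2))%:E))
      `^ (q^-1))%E
  | +oo%E => ereal_sup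
      [set (cmod (f z) * expR (- (alpha / 2) * cmod z ^+ 2))%:E | z in [set: R[i]]]
  | -oo%E => 0%E
  end.

Definition fock (R : realType) (alpha : R) (p : \bar R) : set (R[i] -> R[i]) :=
  [set f | entire f /\ (fock_norm alpha p f < +oo)%E].

Definition fock0 (R : realType) (alpha : R) : set (R[i] -> R[i]) :=
  [set f | fock alpha +oo%E f /\
    forall e : R, 0 < e -> exists M : R, forall z : R[i], M < cmod z ->
      cmod (f z * (expR (- (alpha / 2) * cmod z ^+ 2))%:C) < e].

Section Operators.
Variable R : realType.
Local Notation CC := (R[i] -> R[i]).

Definition wcomp (psi phi : CC) (f : CC) : CC := fun z => psi z * f (phi z).

(* A normed space of functions is given by its carrier X and by a function N
   restricting to the norm of X; the operator T may be defined on all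
   functions, whence the requirement that it map X into X. *)
Definition linear_on (X : set CC) (T : CC -> CC) : Prop :=
  (forall f, X f -> X (T f)) /\
  (forall (c d : R[i]) f g, X f -> X g ->
     T (fun z => c * f z + d * g z) = (fun z => c * T f z + d * T g z)).

Definition bounded_operator (X : set CC) (N : CC -> \bar R) (T : CC -> CC) :
    Prop :=
  linear_on X T /\
  exists C : R, 0 <= C /\ forall f, X f -> (N (T f) <= C%:E * N f)%E.

(* Every norm-bounded sequence has a subsequence whose image converges in
   norm to an element of X. *)
Definition compact_operator (X : set CC) (N : CC -> \bar R) (T : CC -> CC) :
    Prop :=
  linear_on X T /\
  forall u : nat -> CC, (forall n, X (u n)) ->
    (exists M : R, forall n, (N (u n) <= M%:E)%E) ->
    exists (h : nat -> nat) (g : CC),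
      [/\ forall m n, (m < n)%N -> (h m < h n)%N, X g &
          N (fun z => T (u (h n)) z - g z) @[n --> \oo] --> 0%E].

End Operators.

(* Main.v *)
(** Write [wmod f z = |f z| exp (- alpha |z|^2 / 2)] and
    [weight z = |psi z| exp (alpha (|phi z|^2 - |z|^2) / 2)], so that
    [wmod (W f) z = weight z * wmod f (phi z)].  The normalised reproducing kernels
    [k_w] satisfy [wmod k_w z = exp (- alpha |z - w|^2 / 2)]; tested on [k_w] with
    [w = phi z], boundedness of [W] makes the weight bounded, and compactness makes
    it vanish at infinity.

    If the weight is bounded then [psi = exp L] with [L] entire and [Re L] at most
    quadratic, so [L] is a polynomial of degree at most two (Borel-Caratheodory).
    Up to a constant factor the weight is then
    [exp (Re (a2 z^2 + t z) - alpha beta |z|^2 / 2)].  On the line where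
    [a2 z^2 = |a2| |z|^2], boundedness forces [|a2| <= alpha beta / 2], and in the
    case of equality that [t z] is imaginary there; the weight is then constant on
    that line, hence does not vanish at infinity.  If [|a2| < alpha beta / 2], the
    weight is dominated by a Gaussian, and Montel's theorem gives compactness. *)

(* The space [X] enters mainly through three facts: point evaluations are dominated by the norm
   ([point_eval]); an entire function dominated by a Gaussian lies in [X], with a norm bound that
   ignores the centre of the Gaussian ([X_gaussian]); affine substitutions are bounded
   ([composition_bound]). The remaining estimates are pointwise, on [wmod] and the weight, so that
   all exponents and the vanishing subspace share one argument. The complex analysis rests on one
   form of Cauchy's theorem, Goursat's theorem for rectangles: the exponential turns circles into
   vertical segments, and the logarithm of [psi] only uses integrals along segments issuing from the
   origin. Compactness merely provides some limit of the images of the kernels. The test is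
   conclusive because this limit is zero: the images tend to zero pointwise as the centres of the
   kernels escape to infinity. The quantity [t] adds to [a1] the cross term in the expansion of the
   squared modulus of [a + lambda * z]; the coefficient of [|z|^2] in the same expansion produces
   [beta]. *)
From HB Require Import structures.
From mathcomp Require Import ring lra measurable_realfun.
Require Import Defs.
Set Implicit Arguments.
Unset Strict Implicit.
Unset Printing Implicit Defensive.
Import Order.TTheory GRing.Theory Num.Theory.
Import numFieldNormedType.Exports.
Local Open Scope classical_set_scope.
Local Open Scope complex_scope.
Local Open Scope ring_scope.

(** * The modulus and complex differentiation *)

(* The library puts a topology on [R[i]^o] only; this transports it to [R[i]], so that
   [continuous] applies to functions into [R[i]] without casts. *)
HB.instance Definition _ (R : realType) := NormedModule.copy R[i] R[i]^o.

Section Modulus.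
Variable R : realType.
Implicit Types (z w : R[i]) (x : R).
Local Notation C := R[i].

Lemma cmod_ge0 z : 0 <= cmod z.
Proof. by case: z => a b; rewrite /cmod /= sqrtr_ge0. Qed.

Lemma cmod_sqr z : cmod z ^+ 2 = complex.Re z ^+ 2 + complex.Im z ^+ 2.
Proof. by case: z => a b; rewrite /cmod /= sqr_sqrtr // addr_ge0 // sqr_ge0. Qed.

Lemma cmodM z w : cmod (z * w) = cmod z * cmod w.
Proof. exact: ComplexField.Normc.normcM. Qed.

Lemma cmodV z : cmod z^-1 = (cmod z)^-1.
Proof. exact: ComplexField.Normc.normcV. Qed.

Lemma cmod_div z w : cmod (z / w) = cmod z / cmod w.
Proof. by rewrite cmodM cmodV. Qed.

Lemma cmod0 : cmod (0 : C) = 0.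
Proof. exact: ComplexField.Normc.normc0. Qed.

Lemma cmod1 : cmod (1 : C) = 1.
Proof. exact: ComplexField.Normc.normc1. Qed.

Lemma cmodX z n : cmod (z ^+ n) = cmod z ^+ n.
Proof. by elim: n => [|n IH]; rewrite ?expr0 ?cmod1// !exprS cmodM IH. Qed.

Lemma cmodD z w : cmod (z + w) <= cmod z + cmod w.
Proof. by rewrite -lecR rmorphD -!cmodE ler_normD. Qed.

Lemma cmodN z : cmod (- z) = cmod z.
Proof. by apply: complexI; rewrite -!cmodE normrN. Qed.

Lemma cmodB z w : cmod (z - w) <= cmod z + cmod w.
Proof. by rewrite -(cmodN w) cmodD. Qed.

Lemma cmodC z w : cmod (z - w) = cmod (w - z).
Proof. by rewrite -cmodN opprB. Qed.

Lemma cmod_eq0 z : (cmod z == 0) = (z == 0).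
Proof.
apply/eqP/eqP => [/ComplexField.Normc.eq0_normc//|->]; exact: cmod0.
Qed.

Lemma cmod_gt0 z : (0 < cmod z) = (z != 0).
Proof. by rewrite lt_def cmod_ge0 andbT cmod_eq0. Qed.

Lemma cmod_real x : cmod x%:C = `|x|.
Proof. by rewrite /cmod /= expr0n /= addr0 sqrtr_sqr. Qed.

Lemma cmodi : cmod ('i : C) = 1.
Proof. by rewrite /cmod /= expr0n /= add0r expr1n sqrtr1. Qed.

Lemma normRe_le_cmod z : `|complex.Re z| <= cmod z.
Proof.
rewrite -(@ler_pXn2r _ 2) ?nnegrE ?cmod_ge0 //.
by rewrite cmod_sqr real_normK ?num_real// lerDl sqr_ge0.
Qed.

Lemma normIm_le_cmod z : `|complex.Im z| <= cmod z.
Proof.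
rewrite -(@ler_pXn2r _ 2) ?nnegrE ?cmod_ge0 //.
by rewrite cmod_sqr real_normK ?num_real// lerDr sqr_ge0.
Qed.

Lemma cmod_le_ReIm z : cmod z <= `|complex.Re z| + `|complex.Im z|.
Proof.
rewrite -(@ler_pXn2r _ 2) ?nnegrE ?cmod_ge0 ?addr_ge0//.
rewrite cmod_sqr sqrrD !real_normK ?num_real// lerD2r lerDl.
by rewrite mulrn_wge0// mulr_ge0.
Qed.

Lemma cmod_distr z w : cmod z - cmod w <= cmod (z - w).
Proof. by have := cmodD (z - w) w; rewrite subrK lerBlDr. Qed.

Lemma Re_add z w : complex.Re (z + w) = complex.Re z + complex.Re w.
Proof. by case: z; case: w. Qed.

Lemma Im_add z w : complex.Im (z + w) = complex.Im z + complex.Im w.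
Proof. by case: z; case: w. Qed.

Lemma Re_opp z : complex.Re (- z) = - complex.Re z.
Proof. by case: z. Qed.

Lemma Im_opp z : complex.Im (- z) = - complex.Im z.
Proof. by case: z. Qed.

Lemma Re_mul z w : complex.Re (z * w) =
  complex.Re z * complex.Re w - complex.Im z * complex.Im w.
Proof. by case: z; case: w. Qed.

Lemma Im_mul z w : complex.Im (z * w) =
  complex.Re z * complex.Im w + complex.Im z * complex.Re w.
Proof. by case: z; case: w. Qed.

Lemma complex_eta z : complex.Re z +i* complex.Im z = z.
Proof. by case: z. Qed.

Lemma complex_ext z w : complex.Re z = complex.Re w ->
  complex.Im z = complex.Im w -> z = w.
Proof. by case: z => a b; case: w => c d /= -> ->. Qed.

Lemma ltc_cmod z e : (`|z| < e%:C) = (cmod z < e).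
Proof. by rewrite cmodE ltcR. Qed.

Lemma gt0_complexE (e : C) : 0 < e -> exists2 x : R, 0 < x & e = x%:C.
Proof.
case: e => a b; rewrite ltcE /= => /andP[/eqP -> a0].
by exists a.
Qed.

Lemma conjE (z : C) : z^* = complex.Re z -i* complex.Im z.
Proof. by case: z. Qed.

End Modulus.

(** * Continuity of complex-valued functions, by coordinates *)

Section Continuity.
Variable R : realType.
Local Notation C := R[i].

Lemma nbhs_complexP (z : C) (A : set C) :
  nbhs z A <-> exists2 e : R, 0 < e & forall w, cmod (w - z) < e -> A w.
Proof.
split=> [/nbhs_normP[e /= /gt0_complexE[x x0 ->]] h|[e e0 h]].
  by exists x => // w wz; apply: h; rewrite /= distrC ltc_cmod.
apply/nbhs_normP; exists e%:C; first by rewrite /= ltcR.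
by move=> w /=; rewrite distrC ltc_cmod => /h.
Qed.

Lemma continuous_Re : continuous (@complex.Re R : C -> R).
Proof.
move=> z; apply/(@cvgrPdist_lt _ _ _ (nbhs z) (nbhs_filter z)) => e e0.
apply/nbhs_complexP; exists e => // w wz.
apply: le_lt_trans wz; rewrite -Re_opp -Re_add -cmodN opprB.
exact: normRe_le_cmod.
Qed.

Lemma continuous_Im : continuous (@complex.Im R : C -> R).
Proof.
move=> z; apply/(@cvgrPdist_lt _ _ _ (nbhs z) (nbhs_filter z)) => e e0.
apply/nbhs_complexP; exists e => // w wz.
apply: le_lt_trans wz; rewrite -Im_opp -Im_add -cmodN opprB.
exact: normIm_le_cmod.
Qed.

Lemma continuous_cmod : continuous (@cmod R : C -> R).
Proof.
move=> z; apply/(@cvgrPdist_lt _ _ _ (nbhs z) (nbhs_filter z)) => e e0.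
apply/nbhs_complexP; exists e => // w wz.
apply: le_lt_trans wz; rewrite ler_distl; have := cmod_distr w z; have := cmod_distr z w.
by rewrite (cmodC z); lra.
Qed.

Lemma continuous_at_pair (T : topologicalType) (u v : T -> R) (t : T) :
  {for t, continuous u} -> {for t, continuous v} ->
  {for t, continuous (fun t => (u t +i* v t) : C)}.
Proof.
move=> cu cv A /nbhs_complexP[e e0 h].
have e20 : 0 < e / 2 by rewrite divr_gt0.
have /cvgrPdist_lt/(_ _ e20) hu := cu.
have /cvgrPdist_lt/(_ _ e20) hv := cv.
suff : \forall s \near t, A (u s +i* v s) by [].
near=> s; apply: h; rewrite (le_lt_trans (cmod_le_ReIm _))//= (splitr e).
by rewrite ltrD//= distrC; near: s.
Unshelve. all: by end_near. Qed.

Lemma continuous_pair_complex (T : topologicalType) (u v : T -> R) :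
  continuous u -> continuous v -> continuous (fun t => (u t +i* v t) : C).
Proof. by move=> cu cv t; apply: continuous_at_pair; [exact: cu|exact: cv]. Qed.

Section ContinuousOperations.
Variable T : topologicalType.
Implicit Types (g h : T -> C) (t : T).

Lemma continuous_atRe g t : {for t, continuous g} ->
  {for t, continuous (fun t => complex.Re (g t))}.
Proof. by move=> cg; apply: continuous_comp; [exact: cg|exact: continuous_Re]. Qed.

Lemma continuous_atIm g t : {for t, continuous g} ->
  {for t, continuous (fun t => complex.Im (g t))}.
Proof. by move=> cg; apply: continuous_comp; [exact: cg|exact: continuous_Im]. Qed.

Lemma continuous_at_complex g t :
  {for t, continuous (fun t => complex.Re (g t))} ->
  {for t, continuous (fun t => complex.Im (g t))} -> {for t, continuous g}.
Proof.
move=> cR cI; have -> : g = fun t => complex.Re (g t) +i* complex.Im (g t).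
  by apply/funext => s; rewrite complex_eta.
exact: continuous_at_pair.
Qed.

Lemma continuous_atD g h t : {for t, continuous g} -> {for t, continuous h} ->
  {for t, continuous (fun t => g t + h t)}.
Proof.
move=> cg ch; apply: continuous_at_complex.
  rewrite (_ : (fun _ => _) = fun s => complex.Re (g s) + complex.Re (h s)); last first.
    by apply/funext => s; rewrite Re_add.
  by apply: cvgD; exact: continuous_atRe.
rewrite (_ : (fun _ => _) = fun s => complex.Im (g s) + complex.Im (h s)); last first.
  by apply/funext => s; rewrite Im_add.
by apply: cvgD; exact: continuous_atIm.
Qed.

Lemma continuous_atN g t : {for t, continuous g} ->
  {for t, continuous (fun t => - g t)}.
Proof.
move=> cg; apply: continuous_at_complex.
  rewrite (_ : (fun _ => _) = fun s => - complex.Re (g s)); last first.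
    by apply/funext => s; rewrite Re_opp.
  by apply: cvgN; exact: continuous_atRe.
rewrite (_ : (fun _ => _) = fun s => - complex.Im (g s)); last first.
  by apply/funext => s; rewrite Im_opp.
by apply: cvgN; exact: continuous_atIm.
Qed.

Lemma continuous_atM g h t : {for t, continuous g} -> {for t, continuous h} ->
  {for t, continuous (fun t => g t * h t)}.
Proof.
move=> cg ch.
have [gR gI] := (continuous_atRe cg, continuous_atIm cg).
have [hR hI] := (continuous_atRe ch, continuous_atIm ch).
apply: continuous_at_complex.
  rewrite (_ : (fun _ => _) = fun s => complex.Re (g s) * complex.Re (h s) -
    complex.Im (g s) * complex.Im (h s)); last by apply/funext => s; rewrite Re_mul.
  by apply: cvgB; apply: cvgM.
rewrite (_ : (fun _ => _) = fun s => complex.Re (g s) * complex.Im (h s) +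
  complex.Im (g s) * complex.Re (h s)); last by apply/funext => s; rewrite Im_mul.
by apply: cvgD; apply: cvgM.
Qed.

Lemma continuous_atV g t : g t != 0 -> {for t, continuous g} ->
  {for t, continuous (fun t => (g t)^-1)}.
Proof.
move=> gt0 cg.
have [gR gI] := (continuous_atRe cg, continuous_atIm cg).
pose n s := (complex.Re (g s) * complex.Re (g s) + complex.Im (g s) * complex.Im (g s))^-1.
have cn : {for t, continuous n}.
  apply: cvgV; first by rewrite -!expr2 -cmod_sqr expf_neq0// cmod_eq0.
  by apply: cvgD; apply: cvgM.
have -> : (fun t => (g t)^-1) =
    fun s => (complex.Re (g s) * n s) +i* - (complex.Im (g s) * n s).
  apply/funext => s; rewrite /n; case: (g s) => a b.
  by rewrite /= -!expr2.
by apply: continuous_at_pair; [exact: cvgM|apply: cvgN; exact: cvgM].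
Qed.

Lemma continuous_at_cst (k : C) t : {for t, continuous (fun _ : T => k)}.
Proof. exact: cst_continuous. Qed.

Lemma continuous_atB g h t : {for t, continuous g} -> {for t, continuous h} ->
  {for t, continuous (fun t => g t - h t)}.
Proof. move=> cg ch; exact: (continuous_atD cg (continuous_atN ch)). Qed.

Lemma continuous_atX g t n : {for t, continuous g} ->
  {for t, continuous (fun t => g t ^+ n)}.
Proof.
move=> cg; elim: n => [|n IH]; first exact: continuous_at_cst.
rewrite (_ : (fun _ => _) = fun s => g s * g s ^+ n); last first.
  by apply/funext => s; rewrite exprS.
exact: (continuous_atM cg IH).
Qed.

Lemma continuousD_complex g h : continuous g -> continuous h ->
  continuous (fun t => g t + h t).
Proof. move=> cg ch t; exact: (continuous_atD (cg t) (ch t)). Qed.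

Lemma continuousN_complex g : continuous g -> continuous (fun t => - g t).
Proof. move=> cg t; exact: (continuous_atN (cg t)). Qed.

Lemma continuousB_complex g h : continuous g -> continuous h ->
  continuous (fun t => g t - h t).
Proof. move=> cg ch t; exact: (continuous_atB (cg t) (ch t)). Qed.

Lemma continuousM_complex g h : continuous g -> continuous h ->
  continuous (fun t => g t * h t).
Proof. move=> cg ch t; exact: (continuous_atM (cg t) (ch t)). Qed.

Lemma continuousV_complex g : (forall t, g t != 0) -> continuous g ->
  continuous (fun t => (g t)^-1).
Proof. move=> g0 cg t; exact: (continuous_atV (g0 t) (cg t)). Qed.

Lemma continuousX_complex g n : continuous g -> continuous (fun t => g t ^+ n).
Proof. move=> cg t; exact: (continuous_atX (n := n) (cg t)). Qed.

Lemma continuous_cst_complex (k : C) : continuous (fun _ : T => k).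
Proof. exact: cst_continuous. Qed.

End ContinuousOperations.

Lemma continuous_real_complex : continuous (fun x : R => x%:C : C).
Proof.
apply: continuous_pair_complex => x; [exact: cvg_id|exact: cvg_cst].
Qed.

End Continuity.

(** * Complex derivatives and entire functions *)

Section Derivative.

(** Clearing the denominator of the difference quotient makes [h = 0] harmless, so later estimates
    never have to exclude it. *)
Lemma is_derive_epsilonP (K : numFieldType) (f : K -> K) (z d : K) :
  is_derive (z : K^o) 1 (f : K^o -> K^o) d <->
  forall e : K, 0 < e -> exists2 r : K, 0 < r &
    forall h, `|h| < r -> `|f (z + h) - f z - d * h| <= e * `|h|.
Proof.
split=> [[/cvg_ex[l +] <-] e e0|H].
  move=> hl; have -> : 'D_1 (f : K^o -> K^o) z = l by exact: cvg_lim.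
  move/cvgrPdist_lt: hl => /(_ _ e0)/nbhs_normP[r /= r0 hr].
  exists r => // h hr'; have [->|h0] := eqVneq h 0.
    by rewrite addr0 subrr mulr0 subrr normr0 mulr0.
  have := hr h; rewrite /= sub0r normrN => /(_ hr' h0).
  move/ltW; rewrite -(ler_pM2r (_ : 0 < `|h|)) ?normr_gt0//.
  rewrite -normrM mulrBl distrC /GRing.scale /= mulr1 [h + z]addrC.
  by rewrite mulrAC mulVf// mul1r.
have hl : h^-1 *: ((f : K^o -> K^o) (h *: (1 : K^o) + z) - f z) @[h --> 0^'] --> d.
  apply/cvgrPdist_lt => e e0.
  have [|r r0 hr] := H (e / 2); first by rewrite divr_gt0.
  apply/nbhs_normP; exists r => //= h; rewrite /= sub0r normrN => /hr + h0.
  rewrite /GRing.scale /= mulr1 [h + z]addrC => hh.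
  rewrite -(ltr_pM2r (_ : 0 < `|h|)) ?normr_gt0// -normrM mulrBl.
  rewrite mulrAC mulVf// mul1r distrC (le_lt_trans hh)//.
  by rewrite ltr_pM2r ?normr_gt0// ltr_pdivrMr// ltr_pMr// ltr1n.
split; [by apply/cvg_ex; exists d|exact: cvg_lim].
Qed.

Lemma derivable_comp_num (K : numFieldType) (f g : K^o -> K^o) (z : K) :
  derivable g z 1 -> derivable f (g z) 1 -> derivable (f \o g) z 1.
Proof.
move=> /derivable1_diffP dg /derivable1_diffP df.
exact/derivable1_diffP/differentiable_comp.
Qed.

Variable R : realType.
Local Notation C := R[i].

Lemma is_derive_complexP (f : C -> C) (z d : C) :
  is_derive (z : C^o) 1 (f : C^o -> C^o) d <->
  forall e : R, 0 < e -> exists2 r : R, 0 < r &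
    forall h, cmod h < r -> cmod (f (z + h) - f z - d * h) <= e * cmod h.
Proof.
rewrite is_derive_epsilonP; split=> H e.
  move=> e0; have [|_ /gt0_complexE[r r0 ->] hr] := H e%:C; first by rewrite ltcR.
  exists r => // h; rewrite -ltc_cmod => /hr.
  by rewrite !cmodE -rmorphM lecR.
move=> /gt0_complexE[x x0 ->]; have [r r0 hr] := H x x0.
exists r%:C; first by rewrite ltcR.
by move=> h; rewrite ltc_cmod => /hr; rewrite !cmodE -rmorphM lecR.
Qed.

Lemma is_derive_realP (f : R -> R) (z d : R) :
  is_derive z 1 f d <->
  forall e : R, 0 < e -> exists2 r : R, 0 < r &
    forall h, `|h| < r -> `|f (z + h) - f z - d * h| <= e * `|h|.
Proof. exact: is_derive_epsilonP. Qed.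

(** The usual way to derivability below: Taylor expansions provide explicit quadratic remainders. *)
Lemma is_derive_quadratic (f : C -> C) (z d : C) (r K : R) : 0 < r ->
  (forall h, cmod h < r -> cmod (f (z + h) - f z - d * h) <= K * cmod h ^+ 2) ->
  is_derive (z : C^o) 1 (f : C^o -> C^o) d.
Proof.
move=> r0 H; apply/is_derive_complexP => e e0.
have K0 : 0 < `|K| + 1 by rewrite ltr_pwDr.
exists (Num.min r (e / (`|K| + 1))); first by rewrite lt_min r0 divr_gt0.
move=> h; rewrite lt_min => /andP[hr he]; apply: (le_trans (H _ hr)).
rewrite expr2 mulrA ler_wpM2r ?cmod_ge0//.
rewrite (@le_trans _ _ ((`|K| + 1) * cmod h))//.
  by rewrite ler_wpM2r ?cmod_ge0// (le_trans (ler_norm _))// lerDl.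
by rewrite mulrC -ler_pdivlMr// ltW.
Qed.

Lemma entire_continuous (f : C -> C) : entire f -> continuous f.
Proof.
move=> ef z; apply: differentiable_continuous.
exact/derivable1_diffP/ef.
Qed.

Lemma derivable_continuous_at (f : C -> C) z :
  derivable (f : C^o -> C^o) z 1 -> {for z, continuous f}.
Proof. by move=> /derivable1_diffP/differentiable_continuous. Qed.

Lemma derivable_comp (f g : C -> C) z :
  derivable (g : C^o -> C^o) z 1 -> derivable (f : C^o -> C^o) (g z) 1 ->
  derivable (f \o g : C^o -> C^o) z 1.
Proof. exact: derivable_comp_num. Qed.

Lemma is_derive_derivable (f : C -> C) z d :
  is_derive (z : C^o) 1 (f : C^o -> C^o) d -> derivable (f : C^o -> C^o) z 1.
Proof. by case. Qed.

Lemma entire_comp (f g : C -> C) : entire f -> entire g -> entire (f \o g).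
Proof. by move=> ef eg z; apply: derivable_comp. Qed.

Lemma entireM (f g : C -> C) : entire f -> entire g -> entire (fun z => f z * g z).
Proof. by move=> ef eg z; apply: derivableM. Qed.

Lemma entireD (f g : C -> C) : entire f -> entire g -> entire (fun z => f z + g z).
Proof. by move=> ef eg z; apply: derivableD. Qed.

Lemma entireB (f g : C -> C) : entire f -> entire g -> entire (fun z => f z - g z).
Proof. by move=> ef eg z; apply: derivableB. Qed.

Lemma entire_cst (c : C) : entire (fun=> c).
Proof. by move=> z; apply: derivable_cst. Qed.

Lemma entire_id : entire (fun z : C => z).
Proof. by move=> z; apply: derivable_id. Qed.

Lemma entire_affine (a l : C) : entire (fun z : C => a + l * z).
Proof.
by apply: entireD; [exact: entire_cst|apply: entireM; [exact: entire_cst|exact: entire_id]].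
Qed.

Lemma local_bound (f : C -> C) (r : R) : continuous f ->
  exists2 M : R, 0 <= M & forall z, cmod z <= r -> cmod (f z) <= M.
Proof.
move=> cf; pose F (w : R * R) := cmod (f (w.1 +i* w.2)).
have cF : continuous F.
  move=> w; apply: continuous_comp; last exact: continuous_cmod.
  apply: continuous_comp; last exact: cf.
  apply: continuous_pair_complex => v; [exact: cvg_fst|exact: cvg_snd].
have cpt : compact (`[-r, r] `*` `[-r, r] : set (R * R)).
  by apply: compact_setX; exact: segment_compact.
have := continuous_compact (continuous_subspaceT cF) cpt.
move/compact_bounded => -[M [_ /(_ (`|M| + 1)) hM]].
exists (`|M| + 1); first by rewrite addr_ge0.
move=> z zr; have Mlt : M < `|M| + 1 by rewrite (le_lt_trans (ler_norm _))// ltrDl.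
have := hM Mlt (cmod (f z)).
rewrite /= ger0_norm ?cmod_ge0//; apply.
exists (complex.Re z, complex.Im z); last by rewrite /F /= complex_eta.
split => /=; rewrite in_itv /= -ler_norml.
  exact: le_trans (normRe_le_cmod _) zr.
exact: le_trans (normIm_le_cmod _) zr.
Qed.

End Derivative.

(** * Complex integration and Cauchy's theorem *)

Section ComplexIntegral.
Variable R : realType.
Local Notation C := R[i].
Local Notation mu := (@lebesgue_measure R).
Implicit Types (a b c : R) (f : R -> R) (g h : R -> C).

(** This integral is not oriented: for [b < a] the interval is empty and the value is 0, whence the
    hypotheses [a <= b] further on. *)
Definition cint g a b : C :=
  (\int[mu]_(t in `[a, b]) complex.Re (g t)) +i*
  (\int[mu]_(t in `[a, b]) complex.Im (g t)).

Lemma integrable_itv f a b : continuous f -> mu.-integrable `[a, b] (EFin \o f).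
Proof.
move=> cf; apply: continuous_compact_integrable; first exact: segment_compact.
exact: continuous_subspaceT.
Qed.

Lemma continuousRe g : continuous g -> continuous (fun t => complex.Re (g t)).
Proof. by move=> cg t; apply: continuous_comp; [exact: cg|exact: continuous_Re]. Qed.

Lemma continuousIm g : continuous g -> continuous (fun t => complex.Im (g t)).
Proof. by move=> cg t; apply: continuous_comp; [exact: cg|exact: continuous_Im]. Qed.

Lemma continuous_norm g : continuous g -> continuous (fun t => cmod (g t)).
Proof. by move=> cg t; apply: continuous_comp; [exact: cg|exact: continuous_cmod]. Qed.

Lemma cint_eq g h a b : (forall t, a <= t <= b -> g t = h t) ->
  cint g a b = cint h a b.
Proof.
move=> gh; congr (_ +i* _); apply: eq_Rintegral => t;
  by rewrite inE /= in_itv /= => /gh ->.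
Qed.

Lemma cintD g h a b : continuous g -> continuous h ->
  cint (fun t => g t + h t) a b = cint g a b + cint h a b.
Proof.
move=> cg ch; apply: complex_ext => /=.
  under eq_Rintegral do rewrite Re_add.
  by rewrite RintegralD//; apply: integrable_itv; exact: continuousRe.
under eq_Rintegral do rewrite Im_add.
by rewrite RintegralD//; apply: integrable_itv; exact: continuousIm.
Qed.

Lemma cintZ (k : C) g a b : continuous g ->
  cint (fun t => k * g t) a b = k * cint g a b.
Proof.
move=> cg; have iRe := integrable_itv a b (continuousRe cg).
have iIm := integrable_itv a b (continuousIm cg).
have iRes x : mu.-integrable `[a, b] (EFin \o (fun t => x * complex.Re (g t))).
  apply: integrable_itv => t; apply: cvgM; first exact: cvg_cst.
  exact: continuousRe.
have iIms x : mu.-integrable `[a, b] (EFin \o (fun t => x * complex.Im (g t))).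
  apply: integrable_itv => t; apply: cvgM; first exact: cvg_cst.
  exact: continuousIm.
apply: complex_ext; rewrite ?Re_mul ?Im_mul /=.
  under eq_Rintegral do rewrite Re_mul.
  by rewrite RintegralB// !RintegralZl.
under eq_Rintegral do rewrite Im_mul.
by rewrite RintegralD// !RintegralZl.
Qed.

Lemma continuousMcst (T : topologicalType) (k : C) (u : T -> C) :
  continuous u -> continuous (fun t => k * u t).
Proof. move=> cu; exact: (continuousM_complex (@continuous_cst_complex _ _ k) cu). Qed.

Lemma cintN g a b : continuous g -> cint (fun t => - g t) a b = - cint g a b.
Proof.
move=> cg; rewrite -mulN1r -cintZ//.
by apply: cint_eq => t _; rewrite mulN1r.
Qed.

Lemma cintB g h a b : continuous g -> continuous h ->
  cint (fun t => g t - h t) a b = cint g a b - cint h a b.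
Proof.
by move=> cg ch; rewrite (cintD _ _ cg (continuousN_complex ch)) (cintN _ _ ch).
Qed.

Lemma cint_sum n (F : nat -> R -> C) a b : (forall k, continuous (F k)) ->
  cint (fun t => \sum_(k < n) F k t) a b = \sum_(k < n) cint (F k) a b.
Proof.
move=> cF; have cS m : continuous (fun t => \sum_(k < m) F k t).
  elim: m => [|m IH].
    under eq_fun do rewrite big_ord0; exact: cst_continuous.
  under eq_fun do rewrite big_ord_recr /=.
  exact: (continuousD_complex IH (cF m)).
elim: n => [|n IH].
  rewrite big_ord0 -[RHS](mul0r (cint (fun=> 0) a b)) -cintZ; last exact: cst_continuous.
  by apply: cint_eq => t _; rewrite big_ord0 mulr0.
rewrite big_ord_recr /= -IH -cintD//.
by apply: cint_eq => t _; rewrite big_ord_recr.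
Qed.

Lemma cint_cat g a c b : continuous g -> a <= c -> c <= b ->
  cint g a b = cint g a c + cint g c b.
Proof.
move=> cg ac cb.
have E f : continuous f -> \int[mu]_(t in `[a, b]) f t =
    \int[mu]_(t in `[a, c]) f t + \int[mu]_(t in `[c, b]) f t.
  move=> cf; have := @Rintegral_itvB _ f (BLeft a) (BRight b) c.
  move=> /(_ (integrable_itv _ _ cf)); rewrite !bnd_simp => /(_ ac cb).
  rewrite Rintegral_itv_obnd_cbnd.
    by move=> <-; rewrite addrC subrK.
  by apply: (integrableS _ _ _ (integrable_itv c b cf)) => //; exact: subset_itv_oc_cc.
by apply: complex_ext => /=; apply: E; [exact: continuousRe|exact: continuousIm].
Qed.

Lemma Rintegral_itv_cst (x : R) a b : a <= b ->
  \int[mu]_(t in `[a, b]) x = x * (b - a).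
Proof.
move=> ab; rewrite Rintegral_cst//; congr (_ * _).
rewrite [X in fine X](_ : _ = (b - a)%:E)//.
have := lebesgue_measure_itv `[a, b]; rewrite /= lte_fin => ->.
case: ltP => //= h; have -> : a = b by apply/eqP; rewrite eq_le ab h.
by rewrite subrr.
Qed.

Lemma cint_cst (k : C) a b : a <= b -> cint (fun=> k) a b = k * (b - a)%:C.
Proof.
move=> ab.
by apply: complex_ext; rewrite ?Re_mul ?Im_mul /= !Rintegral_itv_cst// ?mulr0 ?add0r ?subr0.
Qed.

(** Rotation trick: a unimodular [u] makes [u * I] equal to the modulus of [I], which is then the
    integral of a real part, and a real part is at most the modulus. *)
Lemma cint_norm g a b : continuous g ->
  cmod (cint g a b) <= \int[mu]_(t in `[a, b]) cmod (g t).
Proof.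
move=> cg; set I := cint g a b.
have [->|I0] := eqVneq I 0.
  by rewrite cmod0; apply: Rintegral_ge0 => t _; exact: cmod_ge0.
have mI0 : cmod I != 0 by rewrite cmod_eq0.
pose u : C := (complex.Re I -i* complex.Im I) * (cmod I)^-1%:C.
have uI : u * I = (cmod I)%:C.
  have -> : u * I = (cmod I ^+ 2)%:C * (cmod I)^-1%:C.
    rewrite /u mulrAC; congr (_ * _); rewrite cmod_sqr.
    apply: complex_ext; rewrite ?Re_mul ?Im_mul /= -?expr2; ring.
  by rewrite -rmorphM /= expr2 -mulrA divff// mulr1.
have u1 : cmod u = 1.
  have := congr1 (@cmod R) uI; rewrite cmodM cmod_real ger0_norm ?cmod_ge0//.
  by move=> /(canRL (mulfK mI0)) ->; rewrite divff.
have -> : cmod I = complex.Re (cint (fun t => u * g t) a b).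
  by rewrite cintZ// -/I uI.
rewrite /=; apply: le_Rintegral => //.
- by apply: integrable_itv; apply: continuousRe; exact: continuousMcst.
- by apply: integrable_itv; exact: continuous_norm.
move=> t _; rewrite (le_trans (ler_norm _))// (le_trans (normRe_le_cmod _))//.
by rewrite cmodM u1 mul1r.
Qed.

Lemma cint_bound g a b (M : R) : a <= b -> continuous g ->
  (forall t, a <= t <= b -> cmod (g t) <= M) ->
  cmod (cint g a b) <= M * (b - a).
Proof.
move=> ab cg gM; apply: (le_trans (cint_norm _ _ cg)).
have cM : continuous (fun _ : R => M) by exact: cst_continuous.
apply: (@le_trans _ _ (\int[mu]_(t in `[a, b]) M)).
  apply: le_Rintegral => //; first exact: integrable_itv (continuous_norm cg).
  exact: integrable_itv cM.
by rewrite Rintegral_itv_cst.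
Qed.

Lemma Rintegral_FTC f (F : R -> R) a b : a <= b -> continuous f ->
  (forall t : R, is_derive t 1 F (f t)) -> \int[mu]_(t in `[a, b]) f t = F b - F a.
Proof.
move=> ab cf dF; have cF : continuous F.
  move=> t; apply: differentiable_continuous.
  by apply/derivable1_diffP; have [] := dF t.
move: ab; rewrite le_eqVlt => /predU1P[->|ab].
  by rewrite set_itv1 Rintegral_set1 subrr.
rewrite /Rintegral (@continuous_FTC2 _ f F)//.
- exact: continuous_subspaceT.
- split; first by move=> t _; have [] := dF t.
    exact/cvg_at_right_filter/cF.
  exact/cvg_at_left_filter/cF.
- by move=> t _; rewrite derive1E; have [_ ->] := dF t.
Qed.

Lemma is_derive_line (P : C -> C) (z v d : C) (t : R) :
  is_derive ((z + t%:C * v) : C^o) 1 (P : C^o -> C^o) d ->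
  is_derive t 1 (fun s : R => complex.Re (P (z + s%:C * v))) (complex.Re (d * v)) /\
  is_derive t 1 (fun s : R => complex.Im (P (z + s%:C * v))) (complex.Im (d * v)).
Proof.
move=> /is_derive_complexP H.
have {}H e : 0 < e -> exists2 r : R, 0 < r & forall h : R, `|h| < r ->
    cmod (P (z + (t + h)%:C * v) - P (z + t%:C * v) - (d * v) * h%:C) <= e * `|h|.
  (* The shift by 1 allows division even when [v = 0]. *)
  move=> e0; have v0 : 0 < cmod v + 1 by rewrite ltr_wpDl ?cmod_ge0.
  have [|r r0 hr] := H (e / (cmod v + 1)); first by rewrite divr_gt0.
  exists (r / (cmod v + 1)); first by rewrite divr_gt0.
  move=> h hh; have := hr (h%:C * v); rewrite cmodM cmod_real.
  have -> : z + t%:C * v + h%:C * v = z + (t + h)%:C * v.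
    by rewrite rmorphD mulrDl addrA.
  have -> : d * (h%:C * v) = d * v * h%:C by ring.
  have hv : `|h| * cmod v <= `|h| * (cmod v + 1) by rewrite ler_wpM2l// lerDl.
  have hr1 : `|h| * (cmod v + 1) < r by rewrite -ltr_pdivlMr.
  move=> /(_ (le_lt_trans hv hr1)) /le_trans; apply.
  rewrite mulrAC ler_pdivrMr// -[leRHS]mulrA.
  by rewrite ler_wpM2l// ltW.
split; apply/is_derive_realP => e /H[r r0 hr]; exists r => // h /hr;
  apply: le_trans.
  have -> : complex.Re (P (z + (t + h)%:C * v)) - complex.Re (P (z + t%:C * v))
     - complex.Re (d * v) * h =
    complex.Re (P (z + (t + h)%:C * v) - P (z + t%:C * v) - (d * v) * h%:C).
    by rewrite !Re_add !Re_opp [in RHS]Re_mul /= mulr0 subr0.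
  exact: normRe_le_cmod.
have -> : complex.Im (P (z + (t + h)%:C * v)) - complex.Im (P (z + t%:C * v))
   - complex.Im (d * v) * h =
  complex.Im (P (z + (t + h)%:C * v) - P (z + t%:C * v) - (d * v) * h%:C).
  by rewrite !Im_add !Im_opp [in RHS]Im_mul /= mulr0 add0r.
exact: normIm_le_cmod.
Qed.

Lemma continuous_line (z v : C) : continuous (fun t : R => z + t%:C * v).
Proof.
have cv := continuousM_complex (@continuous_real_complex R) (@continuous_cst_complex _ _ v).
exact: (continuousD_complex (@continuous_cst_complex _ _ z) cv).
Qed.

Lemma cint_line (P p : C -> C) (z v : C) a b : a <= b ->
  continuous p ->
  (forall w, is_derive (w : C^o) 1 (P : C^o -> C^o) (p w)) ->
  cint (fun t => p (z + t%:C * v) * v) a b = P (z + b%:C * v) - P (z + a%:C * v).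
Proof.
move=> ab cp dP.
have cg : continuous (fun t : R => p (z + t%:C * v) * v).
  under eq_fun do rewrite mulrC; apply: continuousMcst => t.
  by apply: continuous_comp; [exact: continuous_line|exact: cp].
apply: complex_ext; rewrite ?Re_add ?Im_add ?Re_opp ?Im_opp /=.
  apply: (@Rintegral_FTC _ (fun s : R => complex.Re (P (z + s%:C * v)))) => //.
    exact: continuousRe cg.
  by move=> t; have [] := is_derive_line (dP (z + t%:C * v)).
apply: (@Rintegral_FTC _ (fun s : R => complex.Im (P (z + s%:C * v)))) => //.
  exact: continuousIm cg.
by move=> t; have [] := is_derive_line (dP (z + t%:C * v)).
Qed.

End ComplexIntegral.

Arguments cmod : simpl never.
Arguments cint : simpl never.

Section Goursat.
Variable R : realType.
Local Notation C := R[i].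
Implicit Types (f g : C -> C) (x y : R).

Lemma continuous_hor f y : continuous f -> continuous (fun x : R => f (x +i* y)).
Proof.
move=> cf x; apply: (@continuous_comp _ _ _ (fun x : R => x +i* y) f); last exact: cf.
by apply: continuous_pair_complex => t; [exact: cvg_id|exact: cvg_cst].
Qed.

Lemma continuous_ver f x : continuous f -> continuous (fun y : R => f (x +i* y)).
Proof.
move=> cf y; apply: (@continuous_comp _ _ _ (fun y : R => x +i* y) f); last exact: cf.
by apply: continuous_pair_complex => t; [exact: cvg_cst|exact: cvg_id].
Qed.

Definition hline f y x0 x1 : C := cint (fun x => f (x +i* y)) x0 x1.
Definition vline f x y0 y1 : C := cint (fun y => f (x +i* y)) y0 y1.
(** The counterclockwise boundary integral of [f dz]; the factor ['i] comes from [dz = i dy] on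
    vertical sides. *)
Definition rectint f x0 x1 y0 y1 : C :=
  hline f y0 x0 x1 + 'i * vline f x1 y0 y1 - hline f y1 x0 x1 - 'i * vline f x0 y0 y1.

Lemma rectint_bound f x0 x1 y0 y1 (M : R) : continuous f -> x0 <= x1 -> y0 <= y1 ->
  (forall x y, x0 <= x <= x1 -> y0 <= y <= y1 -> cmod (f (x +i* y)) <= M) ->
  cmod (rectint f x0 x1 y0 y1) <= 2 * M * (x1 - x0 + (y1 - y0)).
Proof.
move=> cf x01 y01 fM.
have H y : y0 <= y <= y1 -> cmod (hline f y x0 x1) <= M * (x1 - x0).
  move=> yy; apply: cint_bound => //; first exact: continuous_hor.
  by move=> t tt; exact: fM.
have V x : x0 <= x <= x1 -> cmod (vline f x y0 y1) <= M * (y1 - y0).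
  move=> xx; apply: cint_bound => //; first exact: continuous_ver.
  by move=> t tt; exact: fM.
have iV x : cmod ('i * vline f x y0 y1) = cmod (vline f x y0 y1) by rewrite cmodM cmodi mul1r.
rewrite /rectint (le_trans (cmodB _ _))// iV.
have := H y0; have := H y1; have := V x0; have := V x1; rewrite !lexx x01 y01 /=.
move=> /(_ isT) V1 /(_ isT) V0 /(_ isT) H1 /(_ isT) H0.
have := cmodB (hline f y0 x0 x1 + 'i * vline f x1 y0 y1) (hline f y1 x0 x1).
have := cmodD (hline f y0 x0 x1) ('i * vline f x1 y0 y1); rewrite iV.
lra.
Qed.

Lemma rectintB f g x0 x1 y0 y1 : continuous f -> continuous g ->
  rectint (fun z => f z - g z) x0 x1 y0 y1 = rectint f x0 x1 y0 y1 - rectint g x0 x1 y0 y1.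
Proof.
move=> cf cg; rewrite /rectint.
have H y : hline (fun z => f z - g z) y x0 x1 = hline f y x0 x1 - hline g y x0 x1.
  by rewrite -(cintB _ _ (continuous_hor cf) (continuous_hor cg)).
have V x : vline (fun z => f z - g z) x y0 y1 = vline f x y0 y1 - vline g x y0 y1.
  by rewrite -(cintB _ _ (continuous_ver cf) (continuous_ver cg)).
by rewrite !H !V; ring.
Qed.

Lemma rectint_primitive (P p : C -> C) x0 x1 y0 y1 : x0 <= x1 -> y0 <= y1 ->
  continuous p -> (forall w, is_derive (w : C^o) 1 (P : C^o -> C^o) (p w)) ->
  rectint p x0 x1 y0 y1 = 0.
Proof.
move=> x01 y01 cp dP.
have H y : hline p y x0 x1 = P (x1 +i* y) - P (x0 +i* y).
  have E x : 0 +i* y + x%:C * 1 = x +i* y by rewrite mulr1; apply: complex_ext => /=; lra.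
  have := cint_line (0 +i* y) 1 x01 cp dP; rewrite !E => <-.
  by apply: cint_eq => t _; rewrite mulr1 E.
have V x : 'i * vline p x y0 y1 = P (x +i* y1) - P (x +i* y0).
  have E y : x%:C + y%:C * 'i = x +i* y by apply: complex_ext => /=; lra.
  have := cint_line (x%:C) 'i y01 cp dP; rewrite !E => <-.
  rewrite /vline -cintZ; last exact: continuous_ver.
  by apply: cint_eq => t _; rewrite E mulrC.
by rewrite /rectint !H !V; ring.
Qed.

Lemma rectint_affine (c d z0 : C) x0 x1 y0 y1 : x0 <= x1 -> y0 <= y1 ->
  rectint (fun z => c + d * (z - z0)) x0 x1 y0 y1 = 0.
Proof.
move=> x01 y01.
apply: (@rectint_primitive (fun z => c * z + d / 2 * (z - z0) ^+ 2) _ _ _ _ _ x01 y01).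
  by apply: entire_continuous; apply: entireD; [exact: entire_cst|];
     apply: entireM; [exact: entire_cst|]; apply: entireB; [exact: entire_id|exact: entire_cst].
move=> w; apply: (@is_derive_quadratic _ _ _ _ 1 (cmod (d / 2))) => // h _.
rewrite -cmodX -cmodM le_eqVlt; apply/orP; left; apply/eqP; congr cmod.
by field.
Qed.

Lemma rectint_catx f x0 xm x1 y0 y1 : continuous f -> x0 <= xm -> xm <= x1 ->
  rectint f x0 x1 y0 y1 = rectint f x0 xm y0 y1 + rectint f xm x1 y0 y1.
Proof.
move=> cf x0m xm1; rewrite /rectint /hline.
rewrite (cint_cat (continuous_hor cf) x0m xm1).
by rewrite (cint_cat (continuous_hor cf) x0m xm1); ring.
Qed.

Lemma rectint_caty f x0 x1 y0 ym y1 : continuous f -> y0 <= ym -> ym <= y1 ->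
  rectint f x0 x1 y0 y1 = rectint f x0 x1 y0 ym + rectint f x0 x1 ym y1.
Proof.
move=> cf y0m ym1; rewrite /rectint /vline.
rewrite (cint_cat (continuous_ver cf) y0m ym1).
by rewrite (cint_cat (continuous_ver cf) y0m ym1); ring.
Qed.

Lemma nested_intervals (l u : nat -> R) : (forall n, l n <= l n.+1) ->
  (forall n, u n.+1 <= u n) -> (forall n, l n <= u n) ->
  exists c, forall n, l n <= c <= u n.
Proof.
move=> lS uS lu.
have lm m n : (m <= n)%N -> l m <= l n.
  by move=> /subnKC <-; elim: (n - m)%N => [|k IH]; rewrite ?addn0// addnS (le_trans IH).
have um m n : (m <= n)%N -> u n <= u m.
  by move=> /subnKC <-; elim: (n - m)%N => [|k IH]; rewrite ?addn0// addnS (le_trans _ IH).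
have lu' m n : l m <= u n.
  have [mn|/ltnW nm] := leqP m n; first exact: le_trans (lm _ _ mn) (lu _).
  exact: le_trans (lu _) (um _ _ nm).
exists (sup (range l)) => n; apply/andP; split.
  by apply: ub_le_sup; [exists (u 0%N) => _ [m _ <-]|exists n].
by apply: ge_sup; [exists (l 0%N), 0%N|move=> _ [m _ <-]].
Qed.

(** The integral is the sum over the four quarters, so one of them carries at least a fourth of its
    modulus. The bounds on the corner [p] keep successive quarters nested. *)
Lemma rectint_quarter f x y w h (A : R) : continuous f -> 0 <= w -> 0 <= h ->
  A <= cmod (rectint f x (x + w) y (y + h)) ->
  exists p : R * R, [/\ x <= p.1 <= x + w / 2, y <= p.2 <= y + h / 2 &
    A / 4 <= cmod (rectint f p.1 (p.1 + w / 2) p.2 (p.2 + h / 2))].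
Proof.
move=> cf w0 h0 AT.
have w2 : w / 2 + w / 2 = w by rewrite -splitr.
have h2 : h / 2 + h / 2 = h by rewrite -splitr.
have w20 : 0 <= w / 2 by rewrite divr_ge0.
have h20 : 0 <= h / 2 by rewrite divr_ge0.
apply: contrapT => /forallNP H.
have {}H p1 p2 : x <= p1 <= x + w / 2 -> y <= p2 <= y + h / 2 ->
    cmod (rectint f p1 (p1 + w / 2) p2 (p2 + h / 2)) < A / 4.
  by move=> h1 h2'; rewrite ltNge; apply/negP => h3; apply: (H (p1, p2)).
have := H x y; have := H (x + w / 2) y; have := H x (y + h / 2).
have := H (x + w / 2) (y + h / 2).
rewrite !lexx !lerDl w20 h20 -!addrA w2 h2 => /(_ isT isT) H1 /(_ isT isT) H2 /(_ isT isT) H3 /(_ isT isT) H4.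
have : rectint f x (x + w) y (y + h) = rectint f x (x + w / 2) y (y + h / 2) +
   rectint f x (x + w / 2) (y + h / 2) (y + h) +
   (rectint f (x + w / 2) (x + w) y (y + h / 2) +
    rectint f (x + w / 2) (x + w) (y + h / 2) (y + h)).
  rewrite -(rectint_caty _ _ cf) ?lerDl//; last by rewrite lerD2l; lra.
  rewrite -(rectint_caty _ _ cf) ?lerDl//; last by rewrite lerD2l; lra.
  by rewrite -(rectint_catx _ _ cf) ?lerDl//; rewrite lerD2l; lra.
move=> TE; move: AT; rewrite TE leNgt => /negP; apply.
apply: (le_lt_trans (cmodD _ _)).
have := cmodD (rectint f x (x + w / 2) y (y + h / 2)) (rectint f x (x + w / 2) (y + h / 2) (y + h)).
have := cmodD (rectint f (x + w / 2) (x + w) y (y + h / 2)) (rectint f (x + w / 2) (x + w) (y + h / 2) (y + h)).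
lra.
Qed.

(** Repeated quartering keeps a fraction [4^-n] of the integral on nested rectangles shrinking to a
    point [c]. Near [c] the function differs from an affine one, whose boundary integral vanishes,
    by at most [e] times the diameter; the perimeter is of order [2^-n] too, so the powers of 4
    cancel and the integral is at most a constant times [e]. *)
Lemma goursat f x0 x1 y0 y1 : x0 <= x1 -> y0 <= y1 -> continuous f ->
  (forall x y, x0 <= x <= x1 -> y0 <= y <= y1 ->
     derivable (f : C^o -> C^o) (x +i* y) 1) ->
  rectint f x0 x1 y0 y1 = 0.
Proof.
move=> x01 y01 cf df.
pose w n := (x1 - x0) / 2 ^+ n; pose h n := (y1 - y0) / 2 ^+ n.
pose A n := cmod (rectint f x0 x1 y0 y1) / 4 ^+ n.
have wS n : w n.+1 = w n / 2 by rewrite /w exprS invfM [_^-1 * _]mulrC mulrA.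
have hS n : h n.+1 = h n / 2 by rewrite /h exprS invfM [_^-1 * _]mulrC mulrA.
have AS n : A n.+1 = A n / 4 by rewrite /A exprS invfM [_^-1 * _]mulrC mulrA.
have w0 n : 0 <= w n by rewrite divr_ge0 ?subr_ge0// exprn_ge0.
have h0 n : 0 <= h n by rewrite divr_ge0 ?subr_ge0// exprn_ge0.
(* The lower bound is a premise under the existential, so that choice yields a total function that
   can be iterated. *)
have step n (p : R * R) : exists q : R * R,
    A n <= cmod (rectint f p.1 (p.1 + w n) p.2 (p.2 + h n)) ->
    [/\ p.1 <= q.1 <= p.1 + w n.+1, p.2 <= q.2 <= p.2 + h n.+1 &
      A n.+1 <= cmod (rectint f q.1 (q.1 + w n.+1) q.2 (q.2 + h n.+1))].
  have [H|H] := pselect (A n <= cmod (rectint f p.1 (p.1 + w n) p.2 (p.2 + h n))).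
    have [q [q1 q2 q3]] := rectint_quarter cf (w0 n) (h0 n) H.
    by exists q => _; rewrite wS hS AS.
  by exists p => /H.
pose nx n p := projT1 (cid (step n p)).
pose p := fix p n := if n is m.+1 then nx m (p m) else (x0, y0).
have pA n : A n <= cmod (rectint f (p n).1 ((p n).1 + w n) (p n).2 ((p n).2 + h n)).
  elim: n => [|n IH] /=.
    by rewrite /A /w /h !expr0 !divr1 !subrKC.
  by rewrite /nx; case: cid => q /= /(_ IH)[].
have pS n : (p n).1 <= (p n.+1).1 <= (p n).1 + w n.+1 /\
            (p n).2 <= (p n.+1).2 <= (p n).2 + h n.+1.
  by rewrite /= /nx; case: cid => q /= /(_ (pA n))[].
have [c1 hc1] : exists c, forall n, (p n).1 <= c <= (p n).1 + w n.
  apply: nested_intervals => n; last by rewrite lerDl.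
    by have [/andP[]] := pS n.
  by have [/andP[_ +] _] := pS n; rewrite wS; lra.
have [c2 hc2] : exists c, forall n, (p n).2 <= c <= (p n).2 + h n.
  apply: nested_intervals => n; last by rewrite lerDl.
    by have [_ /andP[]] := pS n.
  by have [_ /andP[_ +]] := pS n; rewrite hS; lra.
have := hc1 0%N; have := hc2 0%N; rewrite /= /w /h !expr0 !divr1 !subrKC.
move=> c2y c1x.
have /derivableP := df _ _ c1x c2y.
set d := derive _ _ _ => /is_derive_complexP dfc.
set T := rectint f x0 x1 y0 y1; set D := (x1 - x0) + (y1 - y0).
have D0 : 0 <= D by rewrite addr_ge0// subr_ge0.
have key e : 0 < e -> cmod T <= 2 * e * D ^+ 2.
  move=> e0; have [r r0 hr] := dfc e e0.
  have [n hn] : exists n, D / 2 ^+ n < r.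
    exists (Num.bound (D / r)).
    rewrite ltr_pdivrMr ?exprn_gt0// mulrC -ltr_pdivrMr//.
    apply: (lt_le_trans (archi_boundP _)); first by rewrite divr_ge0// ltW.
    by rewrite -natrX ler_nat ltnW// ltn_expl.
  have DE : D / 2 ^+ n = w n + h n by rewrite /D mulrDl.
  set a := fun z : C => f (c1 +i* c2) + d * (z - (c1 +i* c2)).
  have ca : continuous a.
    apply: entire_continuous; apply: entireD; first exact: entire_cst.
    apply: entireM; first exact: entire_cst.
    by apply: entireB; [exact: entire_id|exact: entire_cst].
  have TE : rectint f (p n).1 ((p n).1 + w n) (p n).2 ((p n).2 + h n) =
     rectint (fun z => f z - a z) (p n).1 ((p n).1 + w n) (p n).2 ((p n).2 + h n).
    by rewrite rectintB// rectint_affine ?lerDl// subr0.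
  have /andP[c1l c1u] := hc1 n; have /andP[c2l c2u] := hc2 n.
  have := pA n; rewrite TE /A -/T.
  have E : cmod (rectint (fun z => f z - a z) (p n).1 ((p n).1 + w n) (p n).2 ((p n).2 + h n))
      <= 2 * (e * (D / 2 ^+ n)) * (D / 2 ^+ n).
    have bnd : forall x y, (p n).1 <= x <= (p n).1 + w n -> (p n).2 <= y <= (p n).2 + h n ->
       cmod (f (x +i* y) - a (x +i* y)) <= e * (D / 2 ^+ n).
      move=> x y /andP[xl xu] /andP[yl yu].
      have zc : cmod (x +i* y - (c1 +i* c2)) <= D / 2 ^+ n.
        rewrite (le_trans (cmod_le_ReIm _))// DE /= lerD// ler_norml; lra.
      have := hr _ (le_lt_trans zc hn).
      rewrite subrKC /a opprD addrA => /le_trans; apply.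
      by rewrite ler_wpM2l// ltW.
    have cfa := continuousB_complex cf ca.
    have := rectint_bound cfa _ _ bnd; rewrite !lerDl => /(_ (w0 n) (h0 n)).
    by rewrite !(addrC _ (_ n)) !addrK DE.
  move=> /le_trans /(_ E); rewrite ler_pdivrMr ?exprn_gt0// => /le_trans; apply.
  have -> : (4 : R) ^+ n = 2 ^+ n * 2 ^+ n by rewrite -exprMn; congr (_ ^+ _); ring.
  have n0 : (2 : R) ^+ n != 0 by rewrite expf_neq0.
  by rewrite le_eqVlt; apply/orP; left; apply/eqP; field.
apply/eqP; rewrite -cmod_eq0 eq_le cmod_ge0 andbT; apply/ler_addgt0Pl => e e0.
(* Adding 1 to [D ^+ 2] covers the rectangle reduced to a point, where [D = 0]. *)
rewrite addr0 (le_trans (key (e / (2 * (D ^+ 2 + 1))) _))//.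
  by rewrite divr_gt0// mulr_gt0// ltr_wpDl// sqr_ge0.
have D1 : 0 < D ^+ 2 + 1 by rewrite ltr_wpDl// sqr_ge0.
have -> : 2 * (e / (2 * (D ^+ 2 + 1))) * D ^+ 2 = e * (D ^+ 2 / (D ^+ 2 + 1)).
  by field; rewrite gt_eqF.
by rewrite ler_piMr ?ltW// ltr_pdivrMr// mul1r ltrDl.
Qed.

End Goursat.

(** * The complex exponential *)

Section Exponential.
Variable R : realType.
Local Notation C := R[i].

Definition eit (t : R) : C := cos t +i* sin t.

Lemma cmod_eit t : cmod (eit t) = 1.
Proof.
apply/eqP; rewrite -(@eqrXn2 _ 2%N) ?cmod_ge0//.
by rewrite cmod_sqr /= cos2Dsin2 expr1n.
Qed.

Lemma continuous_eit : continuous eit.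
Proof. by apply: continuous_pair_complex; [exact: continuous_cos|exact: continuous_sin]. Qed.

Lemma cexpE (u t : R) : cexp (u +i* t) = (expR u)%:C * eit t.
Proof. by []. Qed.

Lemma cexpD (z w : C) : cexp (z + w) = cexp z * cexp w.
Proof.
rewrite /cexp Re_add Im_add expRD cosD sinD; apply: complex_ext; rewrite /=; ring.
Qed.

Lemma cexp0 : cexp (0 : C) = 1.
Proof. by rewrite /cexp /= expR0 cos0 sin0 mul1r. Qed.

Lemma cmod_cexp (z : C) : cmod (cexp z) = expR (complex.Re z).
Proof.
by rewrite /cexp cmodM cmod_real ger0_norm ?expR_ge0// cmod_eit mulr1.
Qed.

Lemma cexp_neq0 (z : C) : cexp z != 0.
Proof. by rewrite -cmod_gt0 cmod_cexp expR_gt0. Qed.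

Lemma cexp_little (e : R) : 0 < e -> exists2 r : R, 0 < r &
  forall h : C, cmod h < r -> cmod (cexp h - 1 - h) <= e * cmod h.
Proof.
(* The errors of the real and imaginary parts add up to at most [e1 * |x| + 7 * e1 * |y|], hence the
   8; [e1 <= 1] absorbs the products of small terms. *)
move=> e0; set e1 := Num.min 1 (e / 8).
have e10 : 0 < e1 by rewrite lt_min ltr01 divr_gt0.
have e11 : e1 <= 1 by rewrite ge_min lexx.
have e18 : e1 <= e / 8 by rewrite ge_min lexx orbT.
clearbody e1.
have /is_derive_realP/(_ _ e10)[r1 r10 h1] := @is_derive_expR R 0.
have /is_derive_realP/(_ _ e10)[r2 r20 h2] := @is_derive_cos R 0.
have /is_derive_realP/(_ _ e10)[r3 r30 h3] := @is_derive_sin R 0.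
exists (Num.min e1 (Num.min r1 (Num.min r2 r3))); first by rewrite !lt_min e10 r10 r20.
case=> x y; rewrite !lt_min => /and4P[he hr1 hr2 hr3].
have xh := normRe_le_cmod (x +i* y); have yh := normIm_le_cmod (x +i* y).
rewrite /= in xh yh.
have := h1 x (le_lt_trans xh hr1); rewrite add0r expR0 mul1r => A1.
have := h2 y (le_lt_trans yh hr2); rewrite add0r cos0 sin0 oppr0 mul0r subr0 => A2.
have := h3 y (le_lt_trans yh hr3); rewrite add0r cos0 sin0 subr0 mul1r => A3.
set A := expR x in A1 *; set c := cos y in A2 *; set s := sin y in A3 *.
rewrite (le_trans (cmod_le_ReIm _))// /cexp /= -/A -/c -/s.
have -> : A * c - 0 * s - 1 - x = (A - 1 - x) * c + (1 + x) * (c - 1) by ring.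
have -> : A * s + 0 * c - 0 - y = (A - 1) * s + (s - y) by ring.
have x1 : `|x| <= e1 by rewrite (le_trans xh)// ltW.
have c1 : `|c| <= 1 by exact: cos_max.
have B1 : `|(A - 1 - x) * c + (1 + x) * (c - 1)| <= e1 * `|x| + 2 * (e1 * `|y|).
  rewrite (le_trans (ler_normD _ _))// !normrM lerD//.
    by rewrite -[leRHS]mulr1 ler_pM.
  by rewrite ler_pM// (le_trans (ler_normD _ _))// normr1 lerD// (le_trans x1).
have s1 : `|s| <= 2 * `|y|.
  have -> : s = (s - y) + y by rewrite subrK.
  rewrite (le_trans (ler_normD _ _))// mulrDl mul1r lerD2r (le_trans A3)//.
  by rewrite ler_piMl.
have A1' : `|A - 1| <= 2 * e1.
  have -> : A - 1 = (A - 1 - x) + x by rewrite subrK.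
  rewrite (le_trans (ler_normD _ _))// mulrDl mul1r lerD// (le_trans A1)//.
  by rewrite ler_piMr ?(le_trans x1)// ltW.
have B2 : `|(A - 1) * s + (s - y)| <= (2 * e1) * (2 * `|y|) + e1 * `|y|.
  by rewrite (le_trans (ler_normD _ _))// normrM lerD// ler_pM.
apply: (le_trans (lerD B1 B2)).
apply: (@le_trans _ _ (8 * e1 * cmod (x +i* y))).
  have := ler_wpM2l (ltW e10) xh; have := ler_wpM2l (ltW e10) yh.
  lra.
by rewrite ler_wpM2r ?cmod_ge0//; lra.
Qed.

Lemma is_derive_cexp (z : C) : is_derive (z : C^o) 1 (@cexp R : C^o -> C^o) (cexp z).
Proof.
apply/is_derive_complexP => e e0; have c0 : 0 < cmod (cexp z) by rewrite cmod_gt0 cexp_neq0.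
have [|r r0 hr] := @cexp_little (e / cmod (cexp z)); first by rewrite divr_gt0.
exists r => // h /hr; rewrite cexpD.
have -> : cexp z * cexp h - cexp z - cexp z * h = cexp z * (cexp h - 1 - h) by ring.
rewrite cmodM => H; apply: (le_trans (ler_wpM2l (ltW c0) H)).
by rewrite mulrA mulrCA divff ?gt_eqF// mulr1.
Qed.

Lemma entire_cexp : entire (@cexp R).
Proof. by move=> z; apply: is_derive_derivable (is_derive_cexp z). Qed.

End Exponential.

(** * Integrals over circles centred at the origin *)

Section Circles.
Variable R : realType.
Local Notation C := R[i].
Implicit Types (f g F : C -> C).

Lemma eq_by_epsilon (z w : C) (K : R) :
  (forall e, 0 < e -> cmod (z - w) <= e * K) -> z = w.
Proof.
move=> H; apply/eqP; rewrite -subr_eq0 -cmod_eq0 eq_le cmod_ge0 andbT.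
apply/ler_addgt0Pl => e e0; rewrite addr0.
have K1 : 0 < `|K| + 1 by rewrite ltr_wpDl.
rewrite (le_trans (H (e / (`|K| + 1)) _)) ?divr_gt0// mulrAC ler_pdivrMr//.
by rewrite ler_wpM2l ?(ltW e0)// (le_trans (ler_norm _))// lerDl.
Qed.

(** A tube lemma: compactness of the segment makes the continuity in the abscissa uniform in [y]. *)
Lemma strip_continuity g (u a b e : R) : continuous g -> 0 < e ->
  exists2 d, 0 < d & forall v, `|v - u| < d -> forall y, a <= y <= b ->
    cmod (g (v +i* y) - g (u +i* y)) <= e.
Proof.
move=> cg e0; pose k (w : R * R) := cmod (g (w.1 +i* w.2) - g (u +i* w.2)).
have ck : continuous k.
  move=> w; apply: (@continuous_comp _ _ _ (fun w : R * R => g (w.1 +i* w.2) - g (u +i* w.2)));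
    last exact: continuous_cmod.
  have c1 : continuous (fun w : R * R => g (w.1 +i* w.2)).
    move=> v; apply: (@continuous_comp _ _ _ (fun w : R * R => w.1 +i* w.2) g); last exact: cg.
    by apply: continuous_pair_complex => t; [exact: cvg_fst|exact: cvg_snd].
  have c2 : continuous (fun w : R * R => g (u +i* w.2)).
    move=> v; apply: (@continuous_comp _ _ _ (fun w : R * R => u +i* w.2) g); last exact: cg.
    by apply: continuous_pair_complex => t; [exact: cvg_cst|exact: cvg_snd].
  exact: (continuous_atB (c1 w) (c2 w)).
have cpt := @segment_compact R a b.
have /compact_near_coveringP cov := cpt.
have [|d d0 hd] := (nbhs_ballP u _).1 (cov R (nbhs u) (fun v y => k (v, y) <= e) _ _).
  move=> y _; have ky : k (u, y) = 0 by rewrite /k /= subrr cmod0.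
  have /cvgrPdist_lt/(_ _ e0) := ck (u, y); rewrite ky => H.
  have [[A B] /= [nA nB] AB] := H.
  exists (B, A) => //= -[v w] /= [Bv Aw]; have := AB (w, v) (conj Aw Bv).
  by rewrite /= sub0r normrN => /ltW; apply: le_trans; exact: ler_norm.
exists d => // v vu y ay; apply: (hd v) => /=; last by rewrite in_itv.
by rewrite /ball /= distrC.
Qed.

Lemma periodic_vline_const g (us : R) : continuous g ->
  (forall x, g (x +i* (2 * pi)) = g (x +i* 0)) ->
  (forall x y, x != us -> derivable (g : C^o -> C^o) (x +i* y) 1) ->
  forall u v, vline g u 0 (2 * pi) = vline g v 0 (2 * pi).
Proof.
move=> cg per dg; set J := fun u => vline g u 0 (2 * pi).
have pi20 : 0 <= 2 * pi :> R by rewrite mulr_ge0// pi_ge0.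
have A u v : u <= v -> ~~ (u <= us <= v) -> J u = J v.
  move=> uv nus; have := @goursat R g u v 0 (2 * pi) uv pi20 cg.
  rewrite /rectint /hline.
  have -> : cint (fun x => g (x +i* (2 * pi))) u v = cint (fun x => g (x +i* 0)) u v.
    by apply: cint_eq => t _; rewrite per.
  rewrite -/(J u) -/(J v) => H.
  have {}H : cint (fun x => g (x +i* 0)) u v + 'i * J v -
     cint (fun x => g (x +i* 0)) u v - 'i * J u = 0.
    by apply: H => x y xuv _; apply: dg; apply: contraNneq nus => <-.
  have i0 : ('i : C) != 0 by rewrite -cmod_gt0 cmodi.
  apply: (mulfI i0); apply/eqP; rewrite -subr_eq0 -[0]oppr0 -H; apply/eqP; ring.
have B u : u != us -> J u = J us.
  move=> uus; apply: (@eq_by_epsilon _ _ (2 * pi)) => e e0.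
  have [d d0 hd] := @strip_continuity g us 0 (2 * pi) e cg e0.
  (* The line [w] stays strictly on the same side of [us] as [u], at distance at most [d / 2] from
     [us]. *)
  have [w [wus Jw]] : exists w, `|w - us| < d /\ J u = J w.
    have [lt|gt|eq] := ltgtP u us; last by rewrite eq eqxx in uus.
      exists (Num.max u (us - d / 2)); split.
        rewrite distrC ger0_norm; first by rewrite ltrBlDr -ltrBlDl lt_max; apply/orP; right; lra.
        by rewrite subr_ge0 ge_max (ltW lt) /=; lra.
      apply: A; first by rewrite le_max lexx.
      by rewrite negb_and -!ltNge gt_max lt /=; apply/orP; right; lra.
    exists (Num.min u (us + d / 2)); split.
      rewrite ger0_norm; first by rewrite ltrBlDr gt_min; apply/orP; right; lra.
      by rewrite subr_ge0 le_min (ltW gt) /=; lra.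
    apply/esym/A; first by rewrite ge_min lexx.
    by rewrite negb_and -!ltNge lt_min gt /=; apply/orP; left; lra.
  rewrite Jw /J /vline -cintB; [|exact: continuous_ver|exact: continuous_ver].
  rewrite -[leRHS](_ : e * (2 * pi - 0) = _); last by rewrite subr0.
  apply: cint_bound => //; last exact: hd.
  by apply: continuousB_complex; exact: continuous_ver.
move=> u v; have [->|/B E1] := eqVneq u us; have [->|/B E2] := eqVneq v us => //.
by rewrite -/(J u) -/(J v) E1 E2.
Qed.

(** Integration is against [dt = dw / (i w)] instead of [dw]: the substitution by [cexp] then has no
    Jacobian, and the Cauchy kernel takes the form [w / (w - h)]. *)
Definition circint F (r : R) : C := cint (fun t => F (r%:C * eit t)) 0 (2 * pi).

Lemma circle_neq0 (r t : R) : 0 < r -> r%:C * eit t != 0.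
Proof.
by move=> r0; rewrite -cmod_gt0 cmodM cmod_real cmod_eit mulr1 normr_gt0 gt_eqF.
Qed.

Lemma cmod_circle (r t : R) : 0 < r -> cmod (r%:C * eit t) = r.
Proof. by move=> r0; rewrite cmodM cmod_real cmod_eit mulr1 gtr0_norm. Qed.

Lemma continuous_circle (r : R) : continuous (fun t : R => r%:C * eit t).
Proof. by apply: continuousMcst; exact: continuous_eit. Qed.

Lemma continuous_circint F (r : R) : 0 < r ->
  (forall z, cmod z = r -> {for z, continuous F}) ->
  continuous (fun t : R => F (r%:C * eit t)).
Proof.
move=> r0 cF t; apply: (@continuous_comp _ _ _ (fun t : R => r%:C * eit t) F).
  exact: continuous_circle.
by apply: cF; rewrite cmod_circle.
Qed.

(* Pulled back by [cexp], circles become vertical segments, and Goursat's theorem applies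
   to the rectangle between two of them since the horizontal sides cancel by
   periodicity.  The circle of radius [rho], where [F] need not be differentiable,
   becomes a vertical line, which is reached by continuity. *)
Lemma circint_const F (rho : R) : (forall z, z != 0 -> {for z, continuous F}) ->
  (forall z, z != 0 -> cmod z != rho -> derivable (F : C^o -> C^o) z 1) ->
  forall r s, 0 < r -> 0 < s -> circint F r = circint F s.
Proof.
move=> cF dF r s r0 s0; pose g := F \o @cexp R.
have cg : continuous g.
  move=> z; apply: continuous_comp; last exact/cF/cexp_neq0.
  exact: (entire_continuous (@entire_cexp R)).
have per x : g (x +i* (2 * pi)) = g (x +i* 0).
  by rewrite /g /= !cexpE /eit mulr_natl cos2pi sin2pi cos0 sin0.
have dg x y : x != ln rho -> derivable (g : C^o -> C^o) (x +i* y) 1.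
  move=> xr; apply: derivable_comp; first exact: entire_cexp.
  apply: dF; first exact: cexp_neq0.
  by rewrite cmod_cexp /=; apply: contra xr => /eqP <-; rewrite expRK.
have := periodic_vline_const cg per dg (ln r) (ln s).
have E q : 0 < q -> vline g (ln q) 0 (2 * pi) = circint F q.
  move=> q0; apply: cint_eq => t _.
  by rewrite /g /= cexpE lnK// posrE.
by rewrite !E.
Qed.

(** The integral does not depend on the radius, and continuity at 0 identifies its limit as the
    circle shrinks. *)
Lemma circint_center g (rho r : R) : 0 < r -> continuous g ->
  (forall z, z != 0 -> cmod z != rho -> derivable (g : C^o -> C^o) z 1) ->
  circint g r = (2 * pi)%:C * g 0.
Proof.
move=> r0 cg dg; apply: (@eq_by_epsilon _ _ (2 * pi)) => e e0.
have pi20 : 0 <= 2 * pi :> R by rewrite mulr_ge0// pi_ge0.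
have [d d0 hd] : exists2 d : R, 0 < d & forall z, cmod z < d -> cmod (g z - g 0) < e.
  have /nbhs_complexP[d d0 hd] : nbhs (0 : C) (fun z => cmod (g z - g 0) < e).
    have := cg (0 : C) (fun w => cmod (w - g 0) < e); apply.
    by apply/nbhs_complexP; exists e.
  by exists d => // z zd; apply: hd; rewrite subr0.
have d20 : 0 < d / 2 by rewrite divr_gt0.
rewrite (circint_const (fun z _ => cg z) dg r0 d20).
have -> : (2 * pi)%:C * g 0 = cint (fun=> g 0) 0 (2 * pi).
  by rewrite cint_cst// subr0 mulrC.
have cc : continuous (fun t : R => g ((d / 2)%:C * eit t)).
  by apply: continuous_circint => // z _; exact: cg.
rewrite /circint -(cintB _ _ cc (@continuous_cst_complex R R (g 0))).
rewrite -[leRHS](_ : e * (2 * pi - 0) = _); last by rewrite subr0.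
apply: cint_bound; [exact: pi20| |].
  exact: (continuousB_complex cc (@continuous_cst_complex R R (g 0))).
by move=> t _; apply/ltW/hd; rewrite cmod_circle// ltr_pdivrMr// ltr_pMr// ltr1n.
Qed.

End Circles.
Arguments circint : simpl never.
Arguments cexp : simpl never.

(** * Taylor expansions *)

Section Taylor.
Variable R : realType.
Local Notation C := R[i].
Implicit Types (f g F : C -> C).

Lemma cint_conj (g : R -> C) (a b : R) : continuous g ->
  cint (fun t => (g t)^*) a b = (cint g a b)^*.
Proof.
move=> cg; apply: complex_ext; rewrite conjE /=.
  by apply: eq_Rintegral => t _; rewrite conjE.
rewrite -mulN1r -RintegralZl//; last exact: integrable_itv (continuousIm cg).
by apply: eq_Rintegral => t _; rewrite conjE /= mulN1r.
Qed.

Lemma geometric_small (q e : R) : 0 <= q < 1 -> 0 < e -> exists n, q ^+ n <= e.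
Proof.
move=> /andP[q0 q1] e0; have : q ^+ n @[n --> \oo] --> 0.
  by apply: cvg_expr; rewrite ger0_norm.
move=> /cvgrPdist_lt/(_ _ e0)[n _ /(_ n (leqnn n))].
by rewrite sub0r normrN => /ltW H; exists n; apply: le_trans H; exact: ler_norm.
Qed.

Lemma geometric_eq (z w : C) (B q : R) : 0 <= q < 1 ->
  (forall n, cmod (z - w) <= B * q ^+ n.+1) -> z = w.
Proof.
move=> /andP[q0 q1] H; apply: (@eq_by_epsilon _ _ _ `|B|) => e e0.
have [n hn] := @geometric_small q e (introT andP (conj q0 q1)) e0.
apply: (le_trans (H n)); apply: (@le_trans _ _ (`|B| * q ^+ n.+1)).
  by rewrite ler_wpM2r ?exprn_ge0// ler_norm.
by rewrite mulrC ler_wpM2r// (le_trans _ hn)// exprS ler_piMl ?exprn_ge0// ltW.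
Qed.

(** Cauchy's integral for the Taylor coefficient of order [k] at [z]. The power is [k] rather than
    [k + 1] because the measure is [dw / (i w)], and radius 1 stands for any radius by
    [circint_tcoef]. *)
Definition tcoef f (z : C) k : C :=
  (2 * pi)^-1%:C * circint (fun w => f (z + w) / w ^+ k) 1.

Lemma entire_shift f (z : C) : entire f -> entire (fun w => f (z + w)).
Proof.
move=> ef; apply: (entire_comp ef); apply: entireD; [exact: entire_cst|exact: entire_id].
Qed.

Lemma entireX n : entire (fun w : C => w ^+ n).
Proof.
elim: n => [|n IH]; first exact: entire_cst.
rewrite (_ : (fun w : C => w ^+ n.+1) = fun w => w * w ^+ n).
  by apply: entireM; [exact: entire_id|exact: IH].
by apply/funext => w; rewrite exprS.
Qed.

Lemma two_pi_neq0 : (2 * pi)%:C != 0 :> C.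
Proof. by rewrite -cmod_gt0 cmod_real normr_gt0 mulf_neq0// gt_eqF// pi_gt0. Qed.

Lemma two_pi_gt0 : 0 < 2 * pi :> R.
Proof. by rewrite mulr_gt0// pi_gt0. Qed.

Lemma circint_tcoef f z k r : entire f -> 0 < r ->
  circint (fun w => f (z + w) / w ^+ k) r = (2 * pi)%:C * tcoef f z k.
Proof.
move=> ef r0; rewrite /tcoef mulrA -rmorphM /= mulfV ?gt_eqF ?two_pi_gt0// mul1r.
have eg := entire_shift (z := z) ef.
have dF w : w != 0 -> derivable ((fun w => f (z + w) / w ^+ k) : C^o -> C^o) w 1.
  move=> w0; apply: derivableM; first exact: eg.
  by apply: derivableV; [rewrite expf_neq0|exact: entireX].
(* Radius 0 means that no circle is exceptional, since [w != 0] already. *)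
apply: (@circint_const _ _ 0); [| |exact: r0|exact: ltr01].
  by move=> w w0; apply: derivable_continuous_at; exact: dF.
by move=> w w0 _; exact: dF.
Qed.

Lemma circint_entire g (r : R) : entire g -> 0 < r -> circint g r = (2 * pi)%:C * g 0.
Proof.
move=> eg r0; apply: (circint_center (rho := 0) r0 (entire_continuous eg)).
by move=> z _ _; exact: eg.
Qed.

Lemma tcoef0 f z : entire f -> tcoef f z 0 = f z.
Proof.
move=> ef; apply: (mulfI two_pi_neq0); rewrite -(circint_tcoef z 0 ef ltr01).
have := circint_entire (entire_shift (z := z) ef) ltr01; rewrite addr0 => <-.
by apply: cint_eq => t _; rewrite expr0 divr1.
Qed.

Lemma circint_exprS f z k (r : R) : entire f -> 0 < r ->
  circint (fun w => f (z + w) * w ^+ k.+1) r = 0.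
Proof.
move=> ef r0.
have eg : entire (fun w => f (z + w) * w ^+ k.+1).
  by apply: entireM; [exact: entire_shift|exact: entireX].
by rewrite (circint_entire eg r0) expr0n /= !mulr0.
Qed.

Lemma conj_circle (r t : R) : 0 < r ->
  (r%:C * eit t)^-1 = (r ^- 2)%:C * (r%:C * eit t)^*.
Proof.
move=> r0; rewrite invC_norm cmodE cmod_circle//.
by congr (_ * _); rewrite rmorphV ?rmorphXn// unitfE expf_neq0// gt_eqF.
Qed.

Lemma continuous_conj (T : topologicalType) (g : T -> C) : continuous g ->
  continuous (fun t => (g t)^*).
Proof.
move=> cg; rewrite (_ : (fun _ => _) = fun t => complex.Re (g t) +i* - complex.Im (g t)).
  apply: continuous_pair_complex => t; first exact: (continuous_atRe (cg t)).
  by apply: cvgN; exact: (continuous_atIm (cg t)).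
by apply/funext => t; rewrite conjE.
Qed.

(** On the circle, [1 / w] is [r ^- 2] times the conjugate of [w], so the integral of a negative
    power is a multiple of the conjugate of that of a positive power, which is zero. *)
Lemma circint_exprVS k (r : R) : 0 < r -> circint (fun w => (w ^+ k.+1)^-1) r = 0.
Proof.
move=> r0; have cX : continuous (fun t : R => (r%:C * eit t) ^+ k.+1).
  by apply: continuousX_complex; exact: continuous_circle.
have := @circint_exprS (fun=> 1) 0 k r (@entire_cst R 1) r0.
rewrite /circint => H.
have -> : cint (fun t => ((r%:C * eit t) ^+ k.+1)^-1) 0 (2 * pi) =
   cint (fun t => ((r ^- 2)%:C) ^+ k.+1 * ((r%:C * eit t) ^+ k.+1)^*) 0 (2 * pi).
  by apply: cint_eq => t _; rewrite -exprVn conj_circle// exprMn rmorphXn.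
rewrite (cintZ _ _ _ (continuous_conj cX)) (cint_conj _ _ cX).
have -> : cint (fun t => (r%:C * eit t) ^+ k.+1) 0 (2 * pi) = 0.
  by rewrite -H; apply: cint_eq => t _; rewrite mul1r.
by rewrite conjC0 mulr0.
Qed.

Definition slope f (p d : C) : C -> C :=
  fun w => if w == p then d else (f w - f p) / (w - p).

Lemma derivable_slope f p d w : entire f -> w != p ->
  derivable (slope f p d : C^o -> C^o) w 1.
Proof.
move=> ef wp; apply: (@near_eq_derivable _ _ _ (fun w => (f w - f p) / (w - p))).
  near=> v; rewrite /slope ifF//; apply/negbTE; near: v.
  apply/nbhs_complexP; exists (cmod (w - p)); first by rewrite cmod_gt0 subr_eq0.
  by move=> v; apply: contraTneq => ->; rewrite cmodC ltxx.
apply: derivableM; first exact: (entireB ef (@entire_cst R (f p))).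
apply: derivableV; first by rewrite subr_eq0.
by apply: entireB; [exact: entire_id|exact: entire_cst].
Unshelve. all: by end_near. Qed.

Lemma continuous_slope f p d : entire f ->
  is_derive (p : C^o) 1 (f : C^o -> C^o) d -> continuous (slope f p d).
Proof.
move=> ef /is_derive_complexP df w.
have [->|wp] := eqVneq w p; last first.
  by apply: derivable_continuous_at; exact: derivable_slope.
move=> A /nbhs_complexP[e e0 hA].
have [|r r0 hr] := df (e / 2); first by rewrite divr_gt0.
apply/nbhs_complexP; exists r => // v vr; apply: hA.
rewrite /slope eqxx; have [_|vp] := eqVneq v p; first by rewrite subrr cmod0.
have vp0 : v - p != 0 by rewrite subr_eq0.
have := hr _ vr; rewrite subrKC.
have -> : (f v - f p) / (v - p) - d = (f v - f p - d * (v - p)) / (v - p) by field.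
rewrite cmod_div ltr_pdivrMr ?cmod_gt0// => /le_lt_trans; apply.
by rewrite ltr_pM2r ?cmod_gt0// ltr_pdivrMr// ltr_pMr// ltr1n.
Qed.

(** The kernel [z / (z - h)] is a geometric series in [h / z] whose tail after [n] terms is exactly
    [(h / z)^n] times the kernel. The function [phi] is kept general: the constant 1 gives the
    integral of the kernel, and an entire function gives its Taylor expansion. *)
Lemma geometric_kernel (h : C) (r : R) (phi : R -> C) n : cmod h < r ->
  continuous phi ->
  let z t := r%:C * eit t in let e t := z t / (z t - h) in
  forall M, (forall t, cmod (phi t) <= M) ->
  cmod (cint (fun t => e t * phi t) 0 (2 * pi) -
    \sum_(k < n) h ^+ k * cint (fun t => phi t / z t ^+ k) 0 (2 * pi))
  <= 2 * pi * (M * (cmod h / r) ^+ n * (r / (r - cmod h))).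
Proof.
move=> hr cphi z e M phiM.
have r0 : 0 < r by exact: le_lt_trans (cmod_ge0 h) hr.
have z0 t : z t != 0 by exact: circle_neq0.
have zh t : z t - h != 0.
  rewrite subr_eq0; apply: contraTneq hr => <-.
  by rewrite cmod_circle// ltxx.
have cz : continuous z by exact: continuous_circle.
have cZV k : continuous (fun t => (z t ^+ k)^-1).
  by apply: continuousV_complex; [move=> t; rewrite expf_neq0|exact: continuousX_complex].
have ce : continuous e.
  apply: (continuousM_complex cz); apply: (continuousV_complex zh).
  exact: (continuousB_complex cz (@continuous_cst_complex R R h)).
have E t : e t = \sum_(k < n) (h / z t) ^+ k + (h / z t) ^+ n * e t.
  elim: n => [|n {1}->]; first by rewrite big_ord0 add0r expr0 mul1r.
  rewrite big_ord_recr /= -addrA; congr (_ + _).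
  rewrite exprSr -mulrA -[X in X + _]mulr1 -mulrDr; congr (_ * _).
  by rewrite /e; field; rewrite z0 zh.
have cP k : continuous (fun t => phi t / z t ^+ k) by exact: (continuousM_complex cphi (cZV k)).
have cS : continuous (fun t => h ^+ n * (e t * (phi t / z t ^+ n))).
  exact: (continuousMcst (k := h ^+ n) (continuousM_complex ce (cP n))).
have -> : cint (fun t => e t * phi t) 0 (2 * pi) =
   cint (fun t => \sum_(k < n) h ^+ k * (phi t / z t ^+ k) +
      h ^+ n * (e t * (phi t / z t ^+ n))) 0 (2 * pi).
  apply: cint_eq => t _; rewrite {1}E mulrDl mulr_suml; congr (_ + _).
    by apply: eq_bigr => k _; rewrite expr_div_n; ring.
  by rewrite expr_div_n; ring.
have cT k : continuous (fun t => h ^+ k * (phi t / z t ^+ k)) by exact: (continuousMcst (k := h ^+ k) (cP k)).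
have cSum : continuous (fun t => \sum_(k < n) h ^+ k * (phi t / z t ^+ k)).
  elim: n {E cS} => [|n IH].
    by rewrite (_ : (fun _ => _) = fun=> 0); [exact: cst_continuous|apply/funext => t; rewrite big_ord0].
  rewrite (_ : (fun _ => _) = fun t => \sum_(k < n) h ^+ k * (phi t / z t ^+ k) +
      h ^+ n * (phi t / z t ^+ n)); last by apply/funext => t; rewrite big_ord_recr.
  exact: (continuousD_complex IH (cT n)).
rewrite (cintD _ _ cSum cS) (@cint_sum _ n (fun k t => h ^+ k * (phi t / z t ^+ k)) _ _ cT).
have -> : \sum_(k < n) cint (fun t => h ^+ k * (phi t / z t ^+ k)) 0 (2 * pi) =
  \sum_(k < n) h ^+ k * cint (fun t => phi t / z t ^+ k) 0 (2 * pi).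
  by apply: eq_bigr => k _; rewrite (cintZ _ _ _ (cP k)).
rewrite [X in cmod (X - _)]addrC addrK [leRHS]mulrC -[X in _ <= _ * X]subr0.
apply: cint_bound; [exact: ltW two_pi_gt0|exact: cS|].
move=> t _; rewrite !(cmodM, cmodV, cmodX) cmod_real cmod_eit mulr1 gtr0_norm//.
have M0 : 0 <= M by exact: le_trans (cmod_ge0 _) (phiM 0).
have rh : 0 < r - cmod h by rewrite subr_gt0.
have -> : M * (cmod h / r) ^+ n * (r / (r - cmod h)) =
  cmod h ^+ n * (r / (r - cmod h) * (M / r ^+ n)).
  by rewrite expr_div_n; ring.
rewrite ler_wpM2l ?exprn_ge0 ?cmod_ge0// ler_pM//.
- by rewrite mulr_ge0 ?invr_ge0 ?cmod_ge0// ltW.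
- by rewrite mulr_ge0 ?cmod_ge0// invr_ge0 exprn_ge0// ltW.
- rewrite ler_wpM2l ?(ltW r0)// lef_pV2 ?posrE// ?cmod_gt0//.
  by rewrite (le_trans _ (cmod_distr _ _))// cmod_circle.
- by rewrite ler_wpM2r// invr_ge0 exprn_ge0// ltW.
Qed.

(** Only the term of order 0 of the geometric series has a nonzero integral, and the remainder tends
    to 0. *)
Lemma cint_geometric_kernel (h : C) (r : R) : cmod h < r ->
  cint (fun t => (r%:C * eit t) / (r%:C * eit t - h)) 0 (2 * pi) = (2 * pi)%:C.
Proof.
move=> hr; have r0 : 0 < r by exact: le_lt_trans (cmod_ge0 h) hr.
apply: (@geometric_eq _ _ (2 * pi * (r / (r - cmod h))) (cmod h / r)).
  by rewrite divr_ge0 ?cmod_ge0 ?(ltW r0)//= ltr_pdivrMr// mul1r.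
move=> n; have := @geometric_kernel h r (fun=> 1) n.+1 hr (@continuous_cst_complex R R 1) 1.
rewrite big_ord_recl big1 ?addr0 => [|k _]; last first.
  rewrite (_ : cint _ _ _ = 0) ?mulr0//.
  rewrite -[RHS](circint_exprVS k r0); apply: cint_eq => t _.
  by rewrite div1r.
have -> : cint (fun t => (1 : C) / (r%:C * eit t) ^+ @ord0 n) 0 (2 * pi) = (2 * pi)%:C.
  rewrite (@cint_eq _ _ (fun=> 1)); last by move=> t _; rewrite expr0 divr1.
  by rewrite cint_cst ?(ltW two_pi_gt0)// mul1r subr0.
have -> : cint (fun t => r%:C * eit t / (r%:C * eit t - h) * 1) 0 (2 * pi) =
   cint (fun t => r%:C * eit t / (r%:C * eit t - h)) 0 (2 * pi).
  by apply: cint_eq => t _; rewrite mulr1.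
rewrite expr0 mul1r => /(_ _)/le_trans; apply.
  by move=> _; rewrite cmod1.
by rewrite mul1r -(mulrA _ (r / _)) [r / _ * _]mulrC.
Qed.

(* [w (f (z + w) - f (z + h)) / (w - h)] is continuous, vanishes at [w = 0] and is
   differentiable off the circle of radius [|h|], so its circle integrals vanish. *)
Lemma cauchy_formula f (z h : C) (r : R) : entire f -> cmod h < r ->
  cint (fun t => (r%:C * eit t) / (r%:C * eit t - h) * f (z + r%:C * eit t)) 0 (2 * pi)
  = (2 * pi)%:C * f (z + h).
Proof.
move=> ef hr; have r0 : 0 < r by exact: le_lt_trans (cmod_ge0 h) hr.
have [d dfd] : exists d, is_derive ((z + h) : C^o) 1 (f : C^o -> C^o) d.
  by exists ('D_1 (f : C^o -> C^o) (z + h)); apply: derivableP; exact: ef.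
pose g w := w * slope f (z + h) d (z + w).
have cs : continuous (fun w => slope f (z + h) d (z + w)).
  move=> w; apply: (@continuous_comp _ _ _ (fun w : C => z + w)); last exact: continuous_slope.
  apply: entire_continuous; apply: entireD; [exact: entire_cst|exact: entire_id].
have cg : continuous g.
  exact: (continuousM_complex (entire_continuous (@entire_id R)) cs).
have dg w : w != 0 -> cmod w != cmod h -> derivable (g : C^o -> C^o) w 1.
  move=> w0 wh; apply: derivableM; first exact: entire_id.
  apply: (@derivable_comp _ (slope f (z + h) d) (fun w => z + w)).
    by apply: entireD; [exact: entire_cst|exact: entire_id].
  apply: derivable_slope; [exact: ef|]; apply: contra wh => /eqP/addrI ->.
  by rewrite eqxx.
have := circint_center r0 cg dg; rewrite {2}/g mul0r mulr0 => H.
have zh t : r%:C * eit t - h != 0.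
  rewrite subr_eq0; apply: contraTneq hr => <-.
  by rewrite cmod_circle// ltxx.
have ce : continuous (fun t => r%:C * eit t / (r%:C * eit t - h)).
  apply: (continuousM_complex (@continuous_circle R r)); apply: (continuousV_complex zh).
  exact: (continuousB_complex (@continuous_circle R r) (@continuous_cst_complex R R h)).
have cf : continuous (fun t => f (z + r%:C * eit t)).
  apply: (@continuous_circint _ (fun w => f (z + w)) r r0) => w _.
  exact: (entire_continuous (entire_shift (z := z) ef)).
have -> : (2 * pi)%:C * f (z + h) =
    cint (fun t => f (z + h) * (r%:C * eit t / (r%:C * eit t - h))) 0 (2 * pi).
  by rewrite (cintZ _ _ _ ce) cint_geometric_kernel// mulrC.
apply/eqP; rewrite -subr_eq0; apply/eqP.
rewrite -cintB; [|exact: (continuousM_complex ce cf)|exact: (continuousMcst (k := f (z + h)) ce)].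
rewrite -[RHS]H; apply: cint_eq => t _; rewrite /g /slope ifF; last first.
  by apply/negbTE; have := zh t; apply: contra => /eqP/addrI ->; rewrite subrr.
have -> : z + r%:C * eit t - (z + h) = r%:C * eit t - h by ring.
by have := zh t => zht; field.
Qed.

Lemma taylor_remainder f (z h : C) (r M : R) n : entire f -> cmod h < r ->
  (forall w, cmod w = r -> cmod (f (z + w)) <= M) ->
  cmod (f (z + h) - \sum_(k < n) tcoef f z k * h ^+ k) <=
  M * (cmod h / r) ^+ n * (r / (r - cmod h)).
Proof.
move=> ef hr fM; have r0 : 0 < r by exact: le_lt_trans (cmod_ge0 h) hr.
have cf : continuous (fun t => f (z + r%:C * eit t)).
  apply: (@continuous_circint _ (fun w => f (z + w)) r r0) => w _.
  exact: (entire_continuous (entire_shift (z := z) ef)).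
have := @geometric_kernel h r _ n hr cf M.
rewrite /= cauchy_formula// => H.
have {}H : cmod ((2 * pi)%:C * (f (z + h) - \sum_(k < n) tcoef f z k * h ^+ k)) <=
    2 * pi * (M * (cmod h / r) ^+ n * (r / (r - cmod h))).
  rewrite mulrBr mulr_sumr.
  rewrite (eq_bigr (fun k : 'I_n => h ^+ k *
    cint (fun t => f (z + r%:C * eit t) / (r%:C * eit t) ^+ k) 0 (2 * pi))).
    by apply: H => t; apply: fM; rewrite cmod_circle.
  by move=> k _; rewrite mulrA -(circint_tcoef z k ef r0) mulrC.
by move: H; rewrite cmodM cmod_real gtr0_norm ?two_pi_gt0// ler_pM2l// two_pi_gt0.
Qed.

(** Cauchy's estimates. *)
Lemma tcoef_bound f (z : C) (r M : R) k : entire f -> 0 < r ->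
  (forall w, cmod w = r -> cmod (f (z + w)) <= M) -> cmod (tcoef f z k) <= M / r ^+ k.
Proof.
move=> ef r0 fM.
have cF : continuous (fun t => f (z + r%:C * eit t) / (r%:C * eit t) ^+ k).
  apply: (@continuous_circint _ (fun w => f (z + w) / w ^+ k) r r0) => w wr.
  have w0 : w != 0 by rewrite -cmod_gt0 wr.
  apply: continuous_atM; first exact: (entire_continuous (entire_shift (z := z) ef)).
  apply: continuous_atV; first by rewrite expf_neq0.
  exact: (entire_continuous (@entireX k)).
have := @cint_bound _ _ 0 (2 * pi) (M / r ^+ k) (ltW two_pi_gt0) cF.
rewrite -/(circint (fun w => f (z + w) / w ^+ k) r) circint_tcoef// => H.
have {}H : cmod ((2 * pi)%:C * tcoef f z k) <= M / r ^+ k * (2 * pi - 0).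
  apply: H => t _; rewrite cmod_div cmodX cmod_circle//.
  by rewrite ler_wpM2r ?invr_ge0 ?exprn_ge0 ?(ltW r0)// fM// cmod_circle.
move: H; rewrite cmodM cmod_real gtr0_norm ?two_pi_gt0// subr0 mulrC.
by rewrite ler_pM2r// two_pi_gt0.
Qed.

End Taylor.

(** * Logarithms and Liouville's theorem *)

Section EntireFunctions.
Variable R : realType.
Local Notation C := R[i].
Implicit Types (f g q : C -> C).

Lemma cmod_nat n : cmod (n%:R : C) = n%:R.
Proof. by rewrite -(rmorph_nat (real_complex R)) cmod_real normr_nat. Qed.

(** With radius 2 and [|h| <= 1] the tail factor [2 / (2 - |h|)] is at most 2, and the power
    [2^-(n+1)] absorbs it; this leaves the constant [M] alone. *)
Lemma taylor_local f (z : C) (M : R) n (h : C) : entire f ->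
  (forall w, cmod w = 2 -> cmod (f (z + w)) <= M) -> cmod h <= 1 ->
  cmod (f (z + h) - \sum_(k < n.+1) tcoef f z k * h ^+ k) <= M * cmod h ^+ n.+1.
Proof.
move=> ef fM h1; have M0 : 0 <= M.
  by apply: le_trans (cmod_ge0 _) (fM 2 _); rewrite cmod_nat.
have h2 : cmod h < 2 by rewrite (le_lt_trans h1)// ltr1n.
apply: (le_trans (taylor_remainder n.+1 ef h2 fM)); rewrite -mulrA ler_wpM2l//.
rewrite expr_div_n -mulrA ler_piMr ?exprn_ge0 ?cmod_ge0//.
rewrite exprS invfM mulrAC mulrA -[X in X * _ * _]invrK -mulrA.
have d1 : 2 / (2 - cmod h) <= 2.
  by rewrite ler_pdivrMr ?subr_gt0//; lra.
rewrite invrK; apply: (@le_trans _ _ (2^-1 * 2)); last by rewrite mulVf.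
have d0 : 0 <= 2 / (2 - cmod h) by rewrite divr_ge0// subr_ge0 ltW.
have p1 : (2 ^+ n)^-1 <= 1 :> R by rewrite invf_le1 ?exprn_gt0// exprn_ege1// ler1n.
have p0 : 0 <= (2 ^+ n)^-1 :> R by rewrite invr_ge0 exprn_ge0.
rewrite [leLHS](_ : _ = 2^-1 * ((2 / (2 - cmod h)) * (2 ^+ n)^-1)); last by ring.
by rewrite ler_wpM2l ?invr_ge0// (le_trans _ d1)// ler_piMr.
Qed.

Lemma ball_bound f (z : C) (r : R) : entire f ->
  exists2 M : R, 0 <= M & forall w, cmod w <= r -> cmod (f (z + w)) <= M.
Proof.
by move=> ef; apply: local_bound; apply: entire_continuous; exact: entire_shift.
Qed.

Lemma taylor1 f (z : C) (M : R) (h : C) : entire f ->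
  (forall w, cmod w = 2 -> cmod (f (z + w)) <= M) -> cmod h <= 1 ->
  cmod (f (z + h) - f z - tcoef f z 1 * h) <= M * cmod h ^+ 2.
Proof.
move=> ef fM h1; have := taylor_local 1 ef fM h1.
rewrite big_ord_recr big_ord_recr big_ord0 /= add0r expr0 expr1 mulr1 tcoef0//.
by rewrite opprD addrA.
Qed.

Lemma taylor2 f (z : C) (M : R) (h : C) : entire f ->
  (forall w, cmod w = 2 -> cmod (f (z + w)) <= M) -> cmod h <= 1 ->
  cmod (f (z + h) - f z - tcoef f z 1 * h - tcoef f z 2 * h ^+ 2) <= M * cmod h ^+ 3.
Proof.
move=> ef fM h1; have := taylor_local 2 ef fM h1.
rewrite !big_ord_recr big_ord0 /= add0r expr0 expr1 mulr1 tcoef0//.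
by rewrite !opprD !addrA.
Qed.

Lemma is_derive_tcoef1 f (z : C) : entire f ->
  is_derive (z : C^o) 1 (f : C^o -> C^o) (tcoef f z 1).
Proof.
move=> ef; have [M _ fM] := ball_bound z 2 ef.
apply: (@is_derive_quadratic _ _ _ _ 1 M) => // h /ltW h1.
by apply: taylor1 => // w w2; apply: fM; rewrite w2.
Qed.

(** The derivative is again differentiable, by second differences. The expansions at [z] with
    increment [2 h] and at [z + h] with increments [h] and [- h] combine so that all values of [f]
    and both occurrences of [d2] cancel. The errors add up to [(8 + 1 + 1) M |h|^3], and division by
    [2 |h|] gives the constant 5. *)
Lemma entire_tcoef1 f : entire f -> entire (fun z => tcoef f z 1).
Proof.
move=> ef z; have [M M0 fM] := ball_bound z 3 ef.
suff : is_derive (z : C^o) 1 ((fun z => tcoef f z 1) : C^o -> C^o) (2 * tcoef f z 2) by case.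
apply: (@is_derive_quadratic _ _ _ _ (1/2) (5 * M)); first by rewrite divr_gt0.
move=> h h2; have [->|h0] := eqVneq h 0.
  by rewrite addr0 subrr mulr0 subr0 cmod0 expr0n /= mulr0.
have h1 : cmod h <= 1 by lra.
have fMz w : cmod w = 2 -> cmod (f (z + w)) <= M by move=> w2; apply: fM; rewrite w2 ler_nat.
have fMh w : cmod w = 2 -> cmod (f (z + h + w)) <= M.
  by move=> w2; rewrite -addrA fM// (le_trans (cmodD _ _))// w2; lra.
have c2h : cmod (2 * h) = 2 * cmod h by rewrite cmodM cmod_nat.
have := @taylor2 f z M (2 * h) ef fMz; rewrite c2h => /(_ ltac:(lra)) H1.
have H2 := @taylor2 f (z + h) M h ef fMh h1.
have := @taylor2 f (z + h) M (- h) ef fMh; rewrite cmodN => /(_ h1) H3.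
have ch : 0 < 2 * cmod h by rewrite mulr_gt0// cmod_gt0.
rewrite -(ler_pM2l ch) -{1}c2h -cmodM.
set c1 := tcoef f z 1 in H1 *; set c2 := tcoef f z 2 in H1 *.
set d1 := tcoef f (z + h) 1 in H2 H3 *; set d2 := tcoef f (z + h) 2 in H2 H3.
have -> : 2 * h * (d1 - c1 - 2 * c2 * h) =
  (f (z + 2 * h) - f z - c1 * (2 * h) - c2 * (2 * h) ^+ 2) -
  (f (z + h + h) - f (z + h) - d1 * h - d2 * h ^+ 2) +
  (f (z + h + - h) - f (z + h) - d1 * - h - d2 * (- h) ^+ 2).
  have -> : z + 2 * h = z + h + h by ring.
  by rewrite addrK; ring.
apply: (le_trans (cmodD _ _)); apply: (le_trans (lerD (cmodB _ _) (lexx _))).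
have -> : 2 * cmod h * (5 * M * cmod h ^+ 2) = 10 * (M * cmod h ^+ 3) by ring.
move: H1; have -> : M * (2 * cmod h) ^+ 3 = 8 * (M * cmod h ^+ 3) by ring.
lra.
Qed.

Lemma zero_derivative_constant g : (forall w, is_derive (w : C^o) 1 (g : C^o -> C^o) 0) ->
  forall z, g z = g 0.
Proof.
move=> dg z; have := @cint_line R g (fun=> 0) 0 z 0 1 ler01 (@continuous_cst_complex _ _ 0) dg.
rewrite mul0r addr0 mul1r add0r => H; apply/eqP; rewrite -subr_eq0 -H.
by rewrite (@cint_eq _ _ (fun=> 0)) ?cint_cst ?ler01 ?mul0r//= => t _; rewrite mul0r.
Qed.

Definition primitive q (z : C) : C := z * cint (fun t => q (0 + t%:C * z)) 0 1.

(** Since [p] is the derivative of [w * q w], its mean over the segment from 0 to [z] is [q z]. The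
    error of the first-order expansion thus becomes a single integral over [[0, 1]], with integrand
    quadratic in [h] by [taylor1]; no path other than these segments occurs. *)
Lemma is_derive_primitive q (z : C) : entire q ->
  is_derive (z : C^o) 1 (primitive q : C^o -> C^o) (q z).
Proof.
move=> eq; pose d w := tcoef q w 1.
have ed : entire d by exact: entire_tcoef1.
have cq : continuous q by exact: entire_continuous.
have cd : continuous d by exact: entire_continuous.
have cl (f : C -> C) (v : C) : continuous f -> continuous (fun t : R => f (0 + t%:C * v)).
  move=> cf t; apply: (@continuous_comp _ _ _ (fun t : R => 0 + t%:C * v) f); last exact: cf.
  exact: continuous_line.
have ct : continuous (fun t : R => t%:C : C) by exact: continuous_real_complex.
pose p w := q w + w * d w.
have cp : continuous p.
  exact: (continuousD_complex cq (continuousM_complex (entire_continuous (@entire_id R)) cd)).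
have pE : cint (fun t => p (0 + t%:C * z)) 0 1 = q z.
  have [->|z0] := eqVneq z 0.
    rewrite (@cint_eq _ _ (fun=> q 0)); last first.
      by move=> t _; rewrite mulr0 addr0 /p mul0r addr0.
    by rewrite cint_cst ?ler01// subr0 mulr1.
  have dP w : is_derive (w : C^o) 1 ((fun w => w * q w) : C^o -> C^o) (p w).
    have dq : is_derive (w : C^o) 1 (q : C^o -> C^o) (d w) by exact: is_derive_tcoef1.
    have := @is_deriveM _ _ _ _ w 1 _ _ (is_derive_id (w : C^o) 1) dq.
    move=> HH; apply: (is_derive_eq HH); rewrite /p /GRing.scale /= mulr1 addrC.
    by congr (_ + _); rewrite mulrC.
  have := cint_line 0 z ler01 cp dP; rewrite mul0r addr0 mul0r subr0 mul1r add0r.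
  rewrite (@cint_eq _ _ (fun t => z * p (0 + t%:C * z))); last by move=> t _; rewrite mulrC.
  by rewrite (cintZ _ _ _ (cl _ _ cp)) => /(mulfI z0).
have [M M0 qM] := @local_bound R q (cmod z + 2) cq.
have [M' M'0 dM] := @local_bound R d (cmod z) cd.
apply: (@is_derive_quadratic _ _ _ _ 1 ((cmod z + 1) * M + M')) => // h /ltW h1.
have -> : primitive q (z + h) - primitive q z - q z * h =
  cint (fun t => (z + h) * q (0 + t%:C * (z + h)) - z * q (0 + t%:C * z) -
    h * p (0 + t%:C * z)) 0 1.
  have c1 := continuousMcst (k := z + h) (cl _ (z + h) cq).
  have c2 := continuousMcst (k := z) (cl _ z cq).
  have c3 := continuousMcst (k := h) (cl _ z cp).
  rewrite (cintB _ _ (continuousB_complex c1 c2) c3) (cintB _ _ c1 c2).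
  rewrite (cintZ _ _ _ (cl _ (z + h) cq)) (cintZ _ _ _ (cl _ z cq)) (cintZ _ _ _ (cl _ z cp)).
  by rewrite pE [h * _]mulrC.
rewrite -[leRHS]mulr1 -[X in _ <= _ * X](subr0 1); apply: cint_bound; first exact: ler01.
  have c1 := continuousMcst (k := z + h) (cl _ (z + h) cq).
  have c2 := continuousMcst (k := z) (cl _ z cq).
  have c3 := continuousMcst (k := h) (cl _ z cp).
  exact: (continuousB_complex (continuousB_complex c1 c2) c3).
move=> t /andP[t0 t1]; rewrite !add0r /p.
have tc : cmod t%:C = t by rewrite cmod_real ger0_norm.
have tz : cmod (t%:C * z) <= cmod z by rewrite cmodM tc ler_piMl ?cmod_ge0.
have th : cmod (t%:C * h) <= cmod h by rewrite cmodM tc ler_piMl ?cmod_ge0.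
have H : cmod (q (t%:C * z + t%:C * h) - q (t%:C * z) - d (t%:C * z) * (t%:C * h))
    <= M * cmod (t%:C * h) ^+ 2.
  apply: taylor1; [exact: eq| |exact: le_trans h1].
  by move=> w w2; apply: qM; rewrite (le_trans (cmodD _ _))// w2 lerD2r.
have -> : (z + h) * q (t%:C * (z + h)) - z * q (t%:C * z) -
    h * (q (t%:C * z) + t%:C * z * d (t%:C * z)) =
  (z + h) * (q (t%:C * z + t%:C * h) - q (t%:C * z) - d (t%:C * z) * (t%:C * h)) +
  h * (t%:C * h) * d (t%:C * z).
  by rewrite -mulrDr; ring.
rewrite [leRHS]mulrDl (le_trans (cmodD _ _))// lerD//.
  rewrite (cmodM (z + h)) -mulrA ler_pM ?cmod_ge0//.
    by rewrite (le_trans (cmodD _ _))// lerD2l.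
  rewrite (le_trans H)// ler_wpM2l// ler_pXn2r ?nnegrE ?cmod_ge0//.
rewrite (cmodM (h * _)) mulrC ler_pM ?cmod_ge0//; first exact: dM.
by rewrite cmodM expr2 ler_wpM2l ?cmod_ge0.
Qed.

Lemma is_derive_comp_complex f g (z d e : C) :
  is_derive (z : C^o) 1 (g : C^o -> C^o) d ->
  is_derive (g z : C^o) 1 (f : C^o -> C^o) e ->
  is_derive (z : C^o) 1 ((fun w => f (g w)) : C^o -> C^o) (e * d).
Proof.
move=> /is_derive_complexP dg /is_derive_complexP df.
apply/is_derive_complexP => eps eps0.
pose K := cmod d + 1; have K0 : 0 < K by rewrite ltr_wpDl ?cmod_ge0.
have [|r r0 hr] := df (eps / 2 / K); first by rewrite !divr_gt0.
have e1 : 0 < cmod e + 1 by rewrite ltr_wpDl ?cmod_ge0.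
have [|s s0 hs] := dg (Num.min 1 (eps / 2 / (cmod e + 1))).
  by rewrite lt_min ltr01 !divr_gt0.
exists (Num.min s (r / K)); first by rewrite lt_min s0 divr_gt0.
move=> h; rewrite lt_min => /andP[/hs hh hK].
set k := g (z + h) - g z in hh *.
have h1 : cmod (k - d * h) <= cmod h.
  by apply: (le_trans hh); rewrite ler_piMl ?cmod_ge0// ge_min lexx.
have h2 : cmod (k - d * h) <= eps / 2 / (cmod e + 1) * cmod h.
  by apply: (le_trans hh); rewrite ler_wpM2r ?cmod_ge0// ge_min lexx orbT.
have kK : cmod k <= K * cmod h.
  have -> : k = (k - d * h) + d * h by rewrite subrK.
  by rewrite (le_trans (cmodD _ _))// cmodM /K mulrDl mul1r addrC lerD2l.
have kr : cmod k < r by rewrite (le_lt_trans kK)// mulrC -ltr_pdivlMr.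
have := hr _ kr; rewrite /k subrKC -/k => H.
have -> : f (g (z + h)) - f (g z) - e * d * h =
  (f (g (z + h)) - f (g z) - e * k) + e * (k - d * h) by ring.
rewrite (le_trans (cmodD _ _))// [leRHS](_ : _ = eps / 2 * cmod h + eps / 2 * cmod h); last by field.
rewrite lerD//.
  rewrite (le_trans H)// -[leLHS]mulrA ler_wpM2l ?divr_ge0// ?(ltW eps0)//.
  by rewrite mulrC ler_pdivrMr// mulrC.
rewrite cmodM (le_trans (ler_wpM2l (cmod_ge0 _) h2))//.
rewrite mulrA ler_wpM2r ?cmod_ge0//.
rewrite [leLHS](_ : _ = eps / 2 * (cmod e / (cmod e + 1))); last by ring.
rewrite ler_piMr ?divr_ge0// ?(ltW eps0)//.
by rewrite ler_pdivrMr// mul1r lerDl.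
Qed.

Lemma cexp_surj (w : C) : w != 0 -> exists c, w = cexp c.
Proof.
move=> w0; have r0 : 0 < cmod w by rewrite cmod_gt0.
set r := cmod w in r0; pose x := complex.Re w / r; pose y := complex.Im w / r.
have xy : x ^+ 2 + y ^+ 2 = 1.
  rewrite /x /y !expr_div_n -mulrDl -cmod_sqr -/r divff// expf_neq0//.
  by rewrite gt_eqF.
have x1 : -1 <= x <= 1.
  rewrite -ler_norml -(@ler_pXn2r _ 2) ?nnegrE// expr1n real_normK ?num_real//.
  by rewrite -xy lerDl sqr_ge0.
have sE : `|y| = sin (acos x).
  rewrite sin_acos//; apply/eqP; rewrite -(@eqrXn2 _ 2%N) ?sqrtr_ge0//.
  by rewrite sqr_sqrtr ?subr_ge0 -?xy ?lerDl ?sqr_ge0// real_normK ?num_real// addrAC subrr add0r.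
have cE : cos (acos x) = x by rewrite acosK// in_itv.
(* The values of [acos] lie in [[0, pi]], where the sine is nonnegative; the sign of [y] selects the
   angle or its opposite. *)
have [t [ct st]] : exists t, cos t = x /\ sin t = y.
  have [y0|y0] := leP 0 y; first by exists (acos x); rewrite cE -sE ger0_norm.
  by exists (- acos x); rewrite cosN sinN cE -sE ltr0_norm// opprK.
exists (ln r +i* t); rewrite cexpE lnK ?posrE// /eit ct st.
by apply: complex_ext; rewrite ?Re_mul ?Im_mul /= mul0r ?subr0 ?addr0 mulrC divfK// gt_eqF.
Qed.

(** With [P] a primitive of the logarithmic derivative, [psi * exp (- P)] has derivative zero; its
    constant value is nonzero, hence an exponential. *)
Lemma entire_log (psi : C -> C) : entire psi -> (forall z, psi z != 0) ->
  exists2 L, entire L & forall z, psi z = cexp (L z).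
Proof.
move=> epsi psi0; pose d z := tcoef psi z 1; pose q z := d z / psi z.
have ed : entire d by exact: entire_tcoef1.
have eq : entire q.
  move=> z; apply: derivableM; first exact: ed.
  by apply: derivableV; [exact: psi0|exact: epsi].
pose P := primitive q; have dP w : is_derive (w : C^o) 1 (P : C^o -> C^o) (q w).
  exact: is_derive_primitive.
have eP : entire P by move=> w; exact: is_derive_derivable (dP w).
pose g w := psi w * cexp (- P w).
have dg w : is_derive (w : C^o) 1 (g : C^o -> C^o) 0.
  have d1 : is_derive (w : C^o) 1 ((fun w => - P w) : C^o -> C^o) (- q w).
    exact: is_deriveN.
  have d2 := is_derive_comp_complex d1 (is_derive_cexp (- P w)).
  have d3 : is_derive (w : C^o) 1 (psi : C^o -> C^o) (d w) by exact: is_derive_tcoef1.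
  have := @is_deriveM _ _ _ _ w 1 _ _ d3 d2; rewrite /GRing.scale /=.
  have -> : psi w * (cexp (- P w) * - q w) + cexp (- P w) * d w = 0.
    by rewrite /q; field; exact: psi0.
  by [].
have gE := zero_derivative_constant dg.
have g0 : g 0 != 0 by rewrite mulf_neq0 ?psi0 ?cexp_neq0.
have [c cE] := cexp_surj g0.
exists (fun z => c + P z); first by apply: entireD; [exact: entire_cst|exact: eP].
move=> z; rewrite cexpD -cE -(gE z) /g -mulrA -cexpD addNr cexp0 mulr1.
by [].
Qed.

Lemma conjM (z w : C) : (z * w)^* = z^* * w^*.
Proof. exact: rmorphM. Qed.

Lemma conjX (z : C) n : (z ^+ n)^* = z^* ^+ n.
Proof. exact: rmorphXn. Qed.

Lemma conjD_Re (z : C) : z + z^* = (2 * complex.Re z)%:C.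
Proof. by rewrite conjE; case: z => x y; apply: complex_ext => /=; ring. Qed.

(* Borel-Caratheodory: since the negative Fourier coefficients of [L] vanish on
   circles, the positive ones are those of [2 Re L - 2 A], which has a sign. *)
Lemma tcoef_Re_bound f k (r A : R) : entire f -> 0 < r ->
  (forall z, cmod z = r -> complex.Re (f z) <= A) ->
  cmod (tcoef f 0 k.+1) <= 2 * (A - complex.Re (f 0)) / r ^+ k.+1.
Proof.
move=> ef r0 fA; pose z t : C := r%:C * eit t.
have z0 t : z t != 0 by exact: circle_neq0.
have cz : continuous z by exact: continuous_circle.
have cf : continuous (fun t => f (z t)).
  by apply: (@continuous_circint _ f r r0) => w _; exact: entire_continuous.
have cV : continuous (fun t => (z t ^+ k.+1)^-1).
  apply: continuousV_complex; first by move=> t; rewrite expf_neq0.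
  exact: (continuousX_complex cz).
have cfc := continuous_conj cf.
have I1 : cint (fun t => f (z t) * (z t ^+ k.+1)^-1) 0 (2 * pi) =
    (2 * pi)%:C * tcoef f 0 k.+1.
  rewrite -(circint_tcoef 0 k.+1 ef r0); apply: cint_eq => t _.
  by rewrite add0r.
(* Up to a power of [r ^- 2] the integrand is the conjugate of [f w * w^(k+1)], whose mean is its
   value 0 at the origin. *)
have I2 : cint (fun t => (f (z t))^* * (z t ^+ k.+1)^-1) 0 (2 * pi) = 0.
  have cfz : continuous (fun t => f (z t) * z t ^+ k.+1).
    exact: (continuousM_complex cf (continuousX_complex cz)).
  have E t : (f (z t))^* * (z t ^+ k.+1)^-1 =
     ((r ^- 2)%:C) ^+ k.+1 * (f (z t) * z t ^+ k.+1)^*.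
    by rewrite -exprVn conj_circle// exprMn (conjM (f (z t))) conjX; ring.
  rewrite (@cint_eq _ _ (fun t => ((r ^- 2)%:C) ^+ k.+1 * (f (z t) * z t ^+ k.+1)^*)) //.
  rewrite (cintZ _ _ _ (continuous_conj cfz)) (cint_conj _ _ cfz).
  rewrite (_ : cint _ _ _ = 0) ?conjC0 ?mulr0//.
  rewrite -[RHS](circint_exprS 0 k ef r0).
  by apply: cint_eq => t _; rewrite add0r.
have I3 : cint (fun t => (z t ^+ k.+1)^-1) 0 (2 * pi) = 0 by exact: circint_exprVS.
have I0 : cint (fun t => f (z t)) 0 (2 * pi) = (2 * pi)%:C * f 0 by exact: circint_entire.
pose u t := 2 * (A - complex.Re (f (z t))).
have u0 t : 0 <= u t.
  by rewrite mulr_ge0// subr_ge0 fA// cmod_circle.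
have cu : continuous (fun t => (u t)%:C).
  apply: continuous_pair_complex => t; last exact: cvg_cst.
  apply: cvgM; first exact: cvg_cst.
  by apply: cvgB; [exact: cvg_cst|exact: (continuousRe cf)].
have IE : (2 * pi)%:C * tcoef f 0 k.+1 = - cint (fun t => (u t)%:C * (z t ^+ k.+1)^-1) 0 (2 * pi).
  have -> : cint (fun t => (u t)%:C * (z t ^+ k.+1)^-1) 0 (2 * pi) =
    cint (fun t => (2 * A)%:C * (z t ^+ k.+1)^-1 -
      (f (z t) * (z t ^+ k.+1)^-1 + (f (z t))^* * (z t ^+ k.+1)^-1)) 0 (2 * pi).
    apply: cint_eq => t _; rewrite -mulrDl conjD_Re -mulrBl -rmorphB.
    by congr (_%:C * _); rewrite /u; ring.
  have c1 := continuousM_complex cf cV; have c2 := continuousM_complex cfc cV.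
  rewrite (cintB _ _ (continuousMcst (k := (2 * A)%:C) cV) (continuousD_complex c1 c2)).
  by rewrite (cintZ _ _ _ cV) I3 mulr0 sub0r (cintD _ _ c1 c2) I1 I2 addr0 opprK.
have cuV := continuousM_complex cu cV.
have H := cint_norm 0 (2 * pi) cuV.
have : cmod ((2 * pi)%:C * tcoef f 0 k.+1) <=
   \int[lebesgue_measure]_(t in `[0, 2 * pi]) cmod ((u t)%:C * (z t ^+ k.+1)^-1).
  by rewrite IE cmodN.
(* As [u >= 0], taking moduli loses nothing: what remains is the mean of [u], known from [f 0]. *)
have -> : \int[lebesgue_measure]_(t in `[0, 2 * pi]) cmod ((u t)%:C * (z t ^+ k.+1)^-1)
  = (r ^+ k.+1)^-1 * complex.Re (cint (fun t => (u t)%:C) 0 (2 * pi)).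
  rewrite -RintegralZl//; last first.
    by apply: integrable_itv; exact: (continuousRe cu).
  apply: eq_Rintegral => t _; rewrite cmodM cmodV cmodX cmod_circle// cmod_real.
  by rewrite ger0_norm// mulrC.
have -> : cint (fun t => (u t)%:C) 0 (2 * pi) =
    (2 * pi * (2 * A))%:C - ((2 * pi)%:C * f 0 + ((2 * pi)%:C * f 0)^*).
  have -> : cint (fun t => (u t)%:C) 0 (2 * pi) =
      cint (fun t => (2 * A)%:C - (f (z t) + (f (z t))^*)) 0 (2 * pi).
    by apply: cint_eq => t _; rewrite conjD_Re -rmorphB; congr (_%:C); rewrite /u; ring.
  rewrite (cintB _ _ (@continuous_cst_complex R R (2 * A)%:C) (continuousD_complex cf cfc)).
  rewrite (cintD _ _ cf cfc) (cint_conj _ _ cf) I0 cint_cst ?(ltW (two_pi_gt0 R))//.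
  by rewrite subr0 -rmorphM mulrC.
rewrite conjD_Re -rmorphB /= Re_mul /= mul0r subr0 cmodM cmod_real gtr0_norm ?two_pi_gt0// => K.
rewrite -(ler_pM2l (two_pi_gt0 R)) (le_trans K)// le_eqVlt; apply/orP; left; apply/eqP.
by field; rewrite expf_neq0// gt_eqF.
Qed.

(** A coefficient of order at least 3 is bounded by a multiple of [r^2 / r^3] for every [r >= 1],
    hence vanishes; the Taylor remainder then shows that the polynomial left is [f] itself. *)
Lemma quadratic_of_Re_bound f (A B : R) : entire f ->
  (forall z, complex.Re (f z) <= A + B * cmod z ^+ 2) ->
  forall z, f z = tcoef f 0 0 + tcoef f 0 1 * z + tcoef f 0 2 * z ^+ 2.
Proof.
move=> ef fAB.
have c0 k : tcoef f 0 k.+3 = 0.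
  apply: (@eq_by_epsilon _ _ _ (2 * (`|A| + `|B| + `|complex.Re (f 0)|))) => e e0.
  rewrite subr0; set K := _ + _ + _.
  (* [r >= 1] lets [r^2] dominate the constants, and [e * r >= 1] turns the spare power of [r] into
     the factor [e]. *)
  pose r := Num.max 1 e^-1.
  have r1 : 1 <= r by rewrite le_max lexx.
  have re : e^-1 <= r by rewrite le_max lexx orbT.
  have r0 : 0 < r by rewrite (lt_le_trans ltr01).
  have := @tcoef_Re_bound f k.+2 r (A + B * r ^+ 2) ef r0.
  move=> /(_ _)/le_trans; apply; first by move=> z zr; rewrite -zr.
  rewrite ler_pdivrMr ?exprn_gt0//.
  apply: (@le_trans _ _ (2 * K * r ^+ 2)).
    rewrite -mulrA ler_wpM2l// /K.
    have q1 : 1 <= r ^+ 2 by rewrite exprn_ege1.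
    have a1 : A <= `|A| * r ^+ 2 by rewrite (le_trans (ler_norm _))// ler_peMr.
    have a2 : - complex.Re (f 0) <= `|complex.Re (f 0)| * r ^+ 2.
      by rewrite (le_trans (ler_norm _))// normrN ler_peMr.
    have a3 : B * r ^+ 2 <= `|B| * r ^+ 2 by rewrite ler_wpM2r ?ler_norm// sqr_ge0.
    by rewrite !mulrDl; lra.
  have er : 1 <= e * r by rewrite mulrC -ler_pdivrMr// mul1r.
  have K0 : 0 <= 2 * K * r ^+ 2 by rewrite mulr_ge0 ?sqr_ge0// mulr_ge0// !addr_ge0.
  have -> : e * (2 * K) * r ^+ k.+3 = (2 * K * r ^+ 2) * ((e * r) * r ^+ k).
    by rewrite !exprS; ring.
  by rewrite ler_peMr// mulr_ege1// exprn_ege1.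
(* On this radius the ratio of the remainder is at most [1/2] and its tail factor at most 2, for
   every [z]. *)
move=> z; have [M M0 fM] := @ball_bound f 0 (2 * (cmod z + 1)) ef.
have z1 : 0 < cmod z + 1 by rewrite ltr_wpDl ?cmod_ge0.
have zr : cmod z < 2 * (cmod z + 1) by have := cmod_ge0 z; lra.
apply: (@geometric_eq _ _ _ (2 * M) 2^-1); first by rewrite invr_ge0 ler0n /= invf_lt1// ltr1n.
move=> n; have := @taylor_remainder _ f 0 z (2 * (cmod z + 1)) M n.+3 ef zr.
rewrite !add0r 3!big_ord_recl big1 ?addr0; last by move=> i _; rewrite /= /bump /= !add1n c0 mul0r.
rewrite expr0 mulr1 /= /bump /= !add1n expr1 [tcoef f 0 0 + (_ + _)]addrA.
move=> /(_ _)/le_trans; apply; first by move=> w wr; apply: fM; rewrite wr.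
have q2 : cmod z / (2 * (cmod z + 1)) <= 2^-1.
  by rewrite ler_pdivrMr ?mulr_gt0// mulrA mulVf// mul1r lerDl.
have q0 : 0 <= cmod z / (2 * (cmod z + 1)).
  by rewrite divr_ge0 ?cmod_ge0// mulr_ge0// ltW.
have q3 : 2 * (cmod z + 1) / (2 * (cmod z + 1) - cmod z) <= 2.
  by rewrite ler_pdivrMr ?subr_gt0//; have := cmod_ge0 z; lra.
have q4 : (cmod z / (2 * (cmod z + 1))) ^+ n.+3 <= 2^-1 ^+ n.+1.
  rewrite (@le_trans _ _ (2^-1 ^+ n.+3))//; first by rewrite ler_pXn2r ?nnegrE ?invr_ge0.
  have nn : (n.+1 <= n.+3)%N by rewrite ltnS (leq_trans (leqnSn n)).
  by apply: ler_wiXn2l nn; rewrite ?invr_ge0 ?invf_le1 ?ler1n.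
rewrite [leRHS](_ : _ = M * 2^-1 ^+ n.+1 * 2); last by ring.
have P0 := exprn_ge0 n.+3 q0.
apply: ler_pM; [exact: mulr_ge0| |exact: ler_wpM2l|exact: q3].
by rewrite divr_ge0 ?subr_ge0 ?(ltW zr)// mulr_ge0 ?(ltW z1).
Qed.

End EntireFunctions.

(** * Integration over the plane *)

Section Plane.
Variable R : realType.
Local Notation C := R[i].
Local Notation mu := (@lebesgue_measure R).
Local Notation RR := (measurableTypeR R * measurableTypeR R)%type.
Local Open Scope ereal_scope.

(** An open subset of the plane is the union of the boxes with rational centre and radius
    [1 / (n + 1)] that it contains. There are countably many of them, so it belongs to the product
    sigma-algebra. *)
Lemma measurable_continuous2 (K : R * R -> R) : continuous K ->
  measurable_fun [set: RR] (K : RR -> R).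
Proof.
move=> cK; apply: (measurability _ (RGenOpens.measurableE R)) => _ [_ [a [b ->] <-]].
rewrite setTI; set O := K @^-1` _.
have oO : open O by apply: open_comp => [w _|]; [exact: cK|exact: interval_open].
pose box (i : rat * rat * nat) : set (R * R) :=
  ball (ratr i.1.1 : R) (i.2.+1%:R^-1)%R `*` ball (ratr i.1.2 : R) (i.2.+1%:R^-1)%R.
have -> : O = \bigcup_i (if `[< box i `<=` O >] then box i else set0).
  apply/seteqP; split=> [[x y] Oxy|w [i _]]; last first.
    by case: asboolP => // h /h.
  have /nbhs_ballP[e /= e0 he] := open_nbhs_nbhs (conj oO Oxy).
  (* Two radii must fit into [e]: one from the point to the rational centre, one across the box. *)
  pose n := Num.bound (2 / e)%R.
  have n2 : (2 * n.+1%:R^-1 <= e)%R.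
    rewrite ler_pdivrMr// -ler_pdivrMl// mulrC ltW// (lt_le_trans (archi_boundP _))//.
      by rewrite divr_ge0// ltW.
    by rewrite ler_nat.
  have n0 : (0 < n.+1%:R^-1 :> R)%R by rewrite invr_gt0.
  have [r1 hr1] : exists r : rat, (ball x n.+1%:R^-1 (ratr r))%R.
    have [r] := @rat_in_itvoo R (x - n.+1%:R^-1)%R (x + n.+1%:R^-1)%R ltac:(rewrite ltrBlDr -addrA ltrDl addr_gt0//).
    rewrite in_itv /= => /andP[h1 h2]; exists r.
    by rewrite /ball /= ltr_distlC h1 h2.
  have [r2 hr2] : exists r : rat, (ball y n.+1%:R^-1 (ratr r))%R.
    have [r] := @rat_in_itvoo R (y - n.+1%:R^-1)%R (y + n.+1%:R^-1)%R ltac:(rewrite ltrBlDr -addrA ltrDl addr_gt0//).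
    rewrite in_itv /= => /andP[h1 h2]; exists r.
    by rewrite /ball /= ltr_distlC h1 h2.
  exists (r1, r2, n) => //; case: asboolP => [_|[]].
    by split; apply: ball_sym.
  move=> [x' y'] [/= b1 b2]; apply: he; split => /=.
    by apply: (le_ball n2); rewrite mulrDl mul1r; exact: ball_triangle hr1 b1.
  by apply: (le_ball n2); rewrite mulrDl mul1r; exact: ball_triangle hr2 b2.
apply: countable_bigcupT_measurable; first exact: countableP.
move=> i; case: asboolP => // _; apply: measurableX; exact: measurable_ball.
Qed.

Lemma measurable_plane (G : C -> R) : continuous G ->
  measurable_fun [set: RR] (fun w : RR => G (w.1 +i* w.2)%C).
Proof.
move=> cG; apply: measurable_continuous2 => w.
apply: (@continuous_comp _ _ _ (fun w : R * R => (w.1 +i* w.2)%C) G); last exact: cG.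
by apply: continuous_pair_complex => v; [exact: cvg_fst|exact: cvg_snd].
Qed.

Lemma measurable_affine (c d : R) :
  measurable_fun [set: measurableTypeR R] (fun x : measurableTypeR R => (c * x + d)%R : measurableTypeR R).
Proof.
apply: measurable_funD; last exact: measurable_cst.
by apply: measurable_funM; [exact: measurable_cst|exact: measurable_id].
Qed.

(** Lebesgue measure equals [|c|] times its image under the affine map: by uniqueness it suffices to
    compare them on half-open intervals. A negative [c] moves the open end to the other side without
    changing the length. *)
Lemma integral_affine (c d : R) (h : R -> \bar R) : (c != 0)%R ->
  measurable_fun [set: measurableTypeR R] (h : measurableTypeR R -> \bar R) ->
  (forall x, 0 <= h x) ->
  \int[mu]_x h (c * x + d)%R = (`|c|^-1)%:E * \int[mu]_x h x.
Proof.
move=> c0 mh h0; pose phi := fun x : measurableTypeR R => (c * x + d)%R : measurableTypeR R.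
have mphi : measurable_fun setT phi by exact: measurable_affine.
have ci0 : (0 <= `|c|)%R by [].
pose m0 : {measure set (measurableTypeR R) -> \bar R} :=
  mscale (NngNum ci0) (pushforward mu phi).
pose m1 := m0 mphi.
have m1E A : measurable A -> mu A = m1 A.
  apply: lebesgue_measure_unique => _ [[a b] _ <-] /=.
  rewrite /m1 /m0 /mscale /=.
  have -> : pushforward mu phi `]a, b]%classic = mu (phi @^-1` `]a, b]%classic) by [].
  have [c1|c1] := ltP 0%R c.
    have -> : phi @^-1` `]a, b]%classic = `](a - d) / c, (b - d) / c]%classic%R.
      apply/seteqP; split => x /=; rewrite !in_itv /= ltr_pdivrMr// ler_pdivlMr//;
        by rewrite ltrBlDr lerBrDr mulrC.
    rewrite (lebesgue_measure_itv `]a, b]) (lebesgue_measure_itv `](a - d) / c, (b - d) / c]%R) /=.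
    rewrite !lte_fin ltr_pM2r ?invr_gt0// ltrD2r; case: ifP => _; last by rewrite mule0.
    by rewrite -!EFinB -EFinM gtr0_norm//; congr _%:E; field.
  have {}c1 : (c < 0)%R by rewrite lt_neqAle c0.
  have -> : phi @^-1` `]a, b]%classic = `[(b - d) / c, (a - d) / c[%classic%R.
    apply/seteqP; split => x /=; rewrite !in_itv /= ltr_ndivlMr// ler_ndivrMr// andbC;
      by rewrite ltrBlDr lerBrDr mulrC.
  rewrite (lebesgue_measure_itv `]a, b]) (lebesgue_measure_itv `[(b - d) / c, (a - d) / c[%R) /=.
  rewrite !lte_fin ltr_nM2r ?invr_lt0// ltrD2r; case: ifP => _; last by rewrite mule0.
  by rewrite -!EFinB -EFinM ltr0_norm//; congr _%:E; field.
have E : \int[mu]_x h x = `|c|%:E * \int[mu]_x h (c * x + d)%R.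
  transitivity (\int[m1]_x h x).
    by apply: eq_measure_integral => A mA _; exact: m1E.
  by rewrite /m1 /m0 ge0_integral_mscale//= ge0_integral_pushforward.
rewrite E muleA -EFinM mulVf ?mul1e// normr_eq0//.
Qed.

(* Multiplication by [p + iq] as a composition of two one-dimensional affine
   substitutions, the order depending on whether [p] vanishes. *)
Lemma integral_plane_affine (p q a b : R) (H : RR -> \bar R) : (p ^+ 2 + q ^+ 2 != 0)%R ->
  measurable_fun setT H -> (forall w, 0 <= H w) ->
  \int[mu \x mu]_w H (a + (p * w.1 - q * w.2), b + (p * w.2 + q * w.1))%R =
  ((p ^+ 2 + q ^+ 2)^-1)%:E * \int[mu \x mu]_w H w.
Proof.
move=> pq0 mH H0.
have mpair (T : measurableType _) (f g : T -> measurableTypeR R) : measurable_fun setT f ->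
  measurable_fun setT g -> measurable_fun setT (fun t => H (f t, g t)).
  by move=> mf mg; apply: (measurableT_comp mH); exact: measurable_fun_pair.
have msl1 x : measurable_fun setT (fun y : measurableTypeR R => H (x, y)).
  by apply: mpair; [exact: measurable_cst|exact: measurable_id].
have msl2 y : measurable_fun setT (fun x : measurableTypeR R => H (x, y)).
  by apply: mpair; [exact: measurable_id|exact: measurable_cst].
have mlin (T : measurableType _) (k : R) (f : T -> measurableTypeR R) : measurable_fun setT f ->
  measurable_fun setT (fun t => (k * f t)%R : measurableTypeR R).
  by move=> mf; apply: measurable_funM => //; exact: measurable_cst.
have madd (T : measurableType _) (f g : T -> measurableTypeR R) : measurable_fun setT f ->
  measurable_fun setT g -> measurable_fun setT (fun t => (f t + g t)%R : measurableTypeR R).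
  by move=> mf mg; exact: measurable_funD.
pose K (w : RR) := H (a + (p * w.1 - q * w.2), b + (p * w.2 + q * w.1))%R.
have mK : measurable_fun setT K.
  apply: (mpair).
    apply: (madd); first exact: measurable_cst.
    by apply: measurable_funB; apply: (mlin); [exact: measurable_fst|exact: measurable_snd].
  apply: (madd); first exact: measurable_cst.
  by apply: (madd); apply: (mlin); [exact: measurable_snd|exact: measurable_fst].
have K0 w : 0 <= K w by exact: H0.
have G0 y : 0 <= fubini_G mu H y by apply: integral_ge0 => x _; exact: H0.
have F0 y : 0 <= fubini_F mu H y by apply: integral_ge0 => x _; exact: H0.
have [p0|p0] := eqVneq p 0%R.
  have q0 : (q != 0)%R by move: pq0; rewrite p0 expr0n add0r sqrf_eq0.
  have mG : measurable_fun setT (fubini_G mu H) by exact: measurable_fun_fubini_tonelli_G.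
  rewrite (fubini_tonelli1 K mK K0) (fubini_tonelli2 H mH H0).
  transitivity (\int[mu]_x (`|q|^-1%:E * fubini_G mu H (q * x + b)%R)).
    apply: eq_integral => x _; rewrite /fubini_F.
    have := @integral_affine (- q) a (fun u => H (u, (q * x + b)%R)).
    rewrite oppr_eq0 normrN => <- //.
    by apply: eq_integral => y _; rewrite /K /= p0; congr (H (_, _)); ring.
  have mGa := measurableT_comp mG (measurable_affine q b).
  rewrite (ge0_integralZl mu measurableT mGa); last 2 first.
  - by move=> x _; exact: G0.
  - by rewrite lee_fin invr_ge0.
  rewrite (@integral_affine q b (fubini_G mu H))// muleA -EFinM -invfM -normrM.
  by rewrite p0 expr0n add0r -expr2 ger0_norm// sqr_ge0.
have mF : measurable_fun setT (fubini_F mu H) by exact: measurable_fun_fubini_tonelli_F.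
pose n := (p ^+ 2 + q ^+ 2)%R.
(* [L] is the integrand after substituting [u = a + p x - q y] for [x]: the second coordinate
   becomes affine in [y] with slope [n / p]. The Jacobians [1 / |p|] and [|p| / n] multiply to
   [1 / n]. *)
pose L (w : RR) := H (w.1, n / p * w.2 + (b + q / p * (w.1 - a)))%R.
have mL : measurable_fun setT L.
  apply: (mpair); first exact: measurable_fst.
  apply: (madd); first by apply: (mlin); exact: measurable_snd.
  apply: (madd); first exact: measurable_cst.
  apply: (mlin); apply: measurable_funB; [exact: measurable_fst|exact: measurable_cst].
have L0 w : 0 <= L w by exact: H0.
rewrite (fubini_tonelli2 K mK K0) (fubini_tonelli1 H mH H0).
transitivity (\int[mu]_y (`|p|^-1%:E * \int[mu]_u L (u, y))).
  apply: eq_integral => y _; rewrite /fubini_G.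
  have := @integral_affine p (a - q * y) (fun u => L (u, y)) p0.
  move=> <- //; last first.
    apply: (measurableT_comp mL).
    by apply: measurable_fun_pair; [exact: measurable_id|exact: measurable_cst].
  apply: eq_integral => x _; rewrite /K /L /=; congr (H (_, _)); first by ring.
  by rewrite /n; field.
rewrite (ge0_integralZl mu measurableT (measurable_fun_fubini_tonelli_G L mL L0)); last 2 first.
- by move=> y _; apply: integral_ge0 => x _; exact: L0.
- by rewrite lee_fin invr_ge0.
rewrite -(fubini_tonelli L mL L0).
have np0 : (n / p != 0)%R by rewrite mulf_neq0 ?invr_eq0.
transitivity (`|p|^-1%:E * \int[mu]_u (`|n / p|^-1%:E * fubini_F mu H u)).
  congr (_ * _); apply: eq_integral => u _.
  by have := @integral_affine (n / p) (b + q / p * (u - a)) (fun v => H (u, v)) np0 => <-.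
rewrite (ge0_integralZl mu measurableT mF); last 2 first.
- by move=> y _; exact: F0.
- by rewrite lee_fin invr_ge0.
rewrite muleA -EFinM -invfM -normrM; congr (_%:E * _).
by rewrite mulrCA divff// mulr1 ger0_norm// addr_ge0 ?sqr_ge0.
Qed.

(** The value [K] is chosen before the centre; the uniformity of [gaussian_bound] in the centre
    comes from this. *)
Lemma gaussian_integral (c : R) : (0 < c)%R -> exists2 K : R, (0 <= K)%R & forall x0 y0 : R,
  \int[mu \x mu]_w (expR (- c * ((w.1 - x0) ^+ 2 + (w.2 - y0) ^+ 2)))%:E = K%:E.
Proof.
move=> c0; pose s := Num.sqrt c; have s0 : (0 < s)%R by rewrite sqrtr_gt0.
pose A := (s^-1 * Num.sqrt pi)%R.
have A0 : (0 <= A)%R by rewrite mulr_ge0 ?invr_ge0 ?sqrtr_ge0// ltW.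
have E x0 : \int[mu]_x (expR (- c * (x - x0) ^+ 2))%:E = A%:E.
  have := @integral_affine s (- (s * x0))%R (fun x => (gauss_fun x)%:E).
  rewrite gt_eqF//= integralT_gauss gtr0_norm// -EFinM => <- //; last 2 first.
  - by apply/measurable_EFinP; exact: measurable_gauss_fun.
  - by move=> x; rewrite lee_fin gauss_fun_ge0.
  apply: eq_integral => x _; rewrite /gauss_fun; congr (expR _)%:E.
  by rewrite -[c in LHS](@sqr_sqrtr _ c) ?(ltW c0)// -/s; ring.
exists (A * A)%R; first exact: mulr_ge0.
move=> x0 y0.
pose g (w : RR) := (expR (- c * ((w.1 - x0) ^+ 2 + (w.2 - y0) ^+ 2)))%:E.
have mg : measurable_fun setT g.
  apply/measurable_EFinP; apply: measurableT_comp; first exact: measurable_expR.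
  apply: measurable_funM; first exact: measurable_cst.
  by apply: measurable_funD; apply: measurable_funX; apply: measurable_funB => //; exact: measurable_cst.
have g0 w : 0 <= g w by rewrite lee_fin expR_ge0.
rewrite (fubini_tonelli1 g mg g0) /fubini_F /g /=.
have me y1 : measurable_fun [set: measurableTypeR R]
    (fun y : measurableTypeR R => (expR (- c * (y - y1) ^+ 2))%:E).
  apply/measurable_EFinP; apply: measurableT_comp; first exact: measurable_expR.
  apply: measurable_funM; first exact: measurable_cst.
  by apply: measurable_funX; apply: measurable_funB => //; exact: measurable_cst.
transitivity (\int[mu]_x ((expR (- c * (x - x0) ^+ 2))%:E * A%:E)).
  apply: eq_integral => x _; rewrite -(E y0) -ge0_integralZl//.
  by apply: eq_integral => y _; rewrite mulrDr expRD EFinM.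
rewrite ge0_integralZr//.
by rewrite E.
Qed.

End Plane.

(** * Domination of point values by area integrals *)

Section AreaMean.
Variable R : realType.
Local Notation C := R[i].
Local Notation mu := (@lebesgue_measure R).
Local Notation RR := (measurableTypeR R * measurableTypeR R)%type.
Implicit Types (f : C -> C).

(** The singularity at [p] is removable, the derivative there being the second Taylor coefficient.
    Goursat's theorem thus applies to rectangles containing [p]. *)
Lemma entire_slope f (p : C) : entire f -> entire (slope f p (tcoef f p 1)).
Proof.
move=> ef w; have [->|wp] := eqVneq w p; last exact: derivable_slope.
have [M _ fM] := ball_bound p 2 ef.
suff : is_derive (p : C^o) 1 (slope f p (tcoef f p 1) : C^o -> C^o) (tcoef f p 2) by case.
apply: (@is_derive_quadratic _ _ _ _ 1 M) => // h /ltW h1.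
have H : cmod (f (p + h) - f p - tcoef f p 1 * h - tcoef f p 2 * h ^+ 2) <= M * cmod h ^+ 3.
  by apply: (taylor2 ef _ h1) => v v2; apply: fM; rewrite v2.
rewrite /slope eqxx; have [hp|hp] := eqVneq (p + h) p.
  have -> : h = 0 by apply: (addrI p); rewrite addr0.
  by rewrite subrr mulr0 subr0 cmod0 expr0n /= mulr0.
have h0 : h != 0 by apply: contra hp => /eqP ->; rewrite addr0.
have -> : p + h - p = h by ring.
have -> : (f (p + h) - f p) / h - tcoef f p 1 - tcoef f p 2 * h =
  (f (p + h) - f p - tcoef f p 1 * h - tcoef f p 2 * h ^+ 2) / h by field.
rewrite cmod_div ler_pdivrMr ?cmod_gt0// (le_trans H)//.
by rewrite exprSr mulrA.
Qed.

(* Cauchy's formula on the boundary of a rectangle around [x0 + i y0], with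
   [2 pi] replaced by a crude lower bound for the integral of [1 / (w - z)]. *)
Lemma rectangle_mean f (x0 y0 x1 x2 y1 y2 : R) : entire f ->
  x0 - 1 <= x1 <= x0 - 1/2 -> x0 + 1/2 <= x2 <= x0 + 1 ->
  y0 - 1 <= y1 <= y0 - 1/2 -> y0 + 1/2 <= y2 <= y0 + 1 ->
  cmod (f (x0 +i* y0)) <= 8 *
    (\int[mu]_(x in `[x0 - 1, x0 + 1]) cmod (f (x +i* y1)) +
     \int[mu]_(x in `[x0 - 1, x0 + 1]) cmod (f (x +i* y2)) +
     \int[mu]_(y in `[y0 - 1, y0 + 1]) cmod (f (x1 +i* y)) +
     \int[mu]_(y in `[y0 - 1, y0 + 1]) cmod (f (x2 +i* y))).
Proof.
move=> ef /andP[x1l x1u] /andP[x2l x2u] /andP[y1l y1u] /andP[y2l y2u].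
set z := x0 +i* y0; set d := tcoef f z 1.
have cf := entire_continuous ef.
have eS : entire (slope f z d) by exact: entire_slope.
have x12 : x1 <= x2 by lra.
have y12 : y1 <= y2 by lra.
have T0 : rectint (slope f z d) x1 x2 y1 y2 = 0.
  by apply: (goursat x12 y12 (entire_continuous eS)) => x y _ _; exact: eS.
have cinv (u v : R -> R) : continuous u -> continuous v ->
    (forall t, u t +i* v t - z != 0) -> continuous (fun t : R => (u t +i* v t - z)^-1).
  move=> cu cv uv; apply: (continuousV_complex uv).
  exact: (continuousB_complex (continuous_pair_complex cu cv) (@continuous_cst_complex R R z)).
have cid' : continuous (fun t : R => t) by move=> t; exact: cvg_id.
have ccst (c : R) : continuous (fun _ : R => c) by exact: cst_continuous.
have nzh y x : y != y0 -> x +i* y - z != 0.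
  by move=> yy; rewrite subr_eq0; apply: contra yy => /eqP[_ ->].
have nzv x y : x != x0 -> x +i* y - z != 0.
  by move=> xx; rewrite subr_eq0; apply: contra xx => /eqP[-> _].
pose Lh y := cint (fun x => (x +i* y - z)^-1) x1 x2.
pose Lv x := cint (fun y => (x +i* y - z)^-1) y1 y2.
pose Fh y := cint (fun x => (x +i* y - z)^-1 * f (x +i* y)) x1 x2.
pose Fv x := cint (fun y => (x +i* y - z)^-1 * f (x +i* y)) y1 y2.
have Eh y : y != y0 -> hline (slope f z d) y x1 x2 = Fh y - f z * Lh y.
  move=> yy; have ci := cinv _ _ cid' (ccst y) (fun x => nzh y x yy).
  rewrite /Fh /Lh -(cintZ _ _ _ ci) -cintB; last exact: continuousMcst ci.
    apply: cint_eq => x _; rewrite /slope ifF; first by ring.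
    by apply/negbTE; have := nzh y x yy; rewrite subr_eq0.
  exact: (continuousM_complex ci (continuous_hor cf)).
have Ev x : x != x0 -> vline (slope f z d) x y1 y2 = Fv x - f z * Lv x.
  move=> xx; have ci := cinv _ _ (ccst x) cid' (fun y => nzv x y xx).
  rewrite /Fv /Lv -(cintZ _ _ _ ci) -cintB; last exact: continuousMcst ci.
    apply: cint_eq => y _; rewrite /slope ifF; first by ring.
    by apply/negbTE; have := nzv x y xx; rewrite subr_eq0.
  exact: (continuousM_complex ci (continuous_ver cf)).
have x1n : x1 != x0 by rewrite lt_eqF//; lra.
have x2n : x2 != x0 by rewrite gt_eqF//; lra.
have y1n : y1 != y0 by rewrite lt_eqF//; lra.
have y2n : y2 != y0 by rewrite gt_eqF//; lra.
pose K := Lh y1 + 'i * Lv x2 - Lh y2 - 'i * Lv x1.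
pose B := Fh y1 + 'i * Fv x2 - Fh y2 - 'i * Fv x1.
have KB : f z * K = B.
  apply/eqP; rewrite eq_sym -subr_eq0 -[X in _ == X]T0; apply/eqP.
  by rewrite /rectint !Eh// !Ev// /K /B; ring.
have invE (x y : R) : (x +i* y - z)^-1 = ((x - x0) / ((x - x0) ^+ 2 + (y - y0) ^+ 2))
    -i* ((y - y0) / ((x - x0) ^+ 2 + (y - y0) ^+ 2)) by [].
(* All four sides contribute nonnegatively to the imaginary part. On the right side, of length at
   least 1, the real part of [1 / (w - z)] is at least [(1/2) / 2]. *)
have K14 : 1/4 <= complex.Im K.
  have -> : complex.Im K = complex.Im (Lh y1) + complex.Re (Lv x2) -
      complex.Im (Lh y2) - complex.Re (Lv x1).
    by rewrite /K !(Im_add, Im_opp, Im_mul) /=; ring.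
  have h1 : 0 <= complex.Im (Lh y1).
    apply: Rintegral_ge0 => x _; rewrite ?Im_opp ?Re_opp invE /= -mulNr divr_ge0//.
      by rewrite opprB subr_ge0; lra.
    by rewrite addr_ge0 ?sqr_ge0.
  have h2 : complex.Im (Lh y2) <= 0.
    rewrite -oppr_ge0; have := cint_eq.
    have ci := cinv _ _ cid' (ccst y2) (fun x => nzh y2 x y2n).
    move=> _; have -> : - complex.Im (Lh y2) = complex.Im (cint (fun x => - (x +i* y2 - z)^-1) x1 x2).
      by rewrite (cintN _ _ ci) Im_opp.
    apply: Rintegral_ge0 => x _; rewrite ?Im_opp ?Re_opp invE /= opprK divr_ge0//.
      by rewrite subr_ge0; lra.
    by rewrite addr_ge0 ?sqr_ge0.
  have h3 : complex.Re (Lv x1) <= 0.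
    rewrite -oppr_ge0.
    have ci := cinv _ _ (ccst x1) cid' (fun y => nzv x1 y x1n).
    have -> : - complex.Re (Lv x1) = complex.Re (cint (fun y => - (x1 +i* y - z)^-1) y1 y2).
      by rewrite (cintN _ _ ci) Re_opp.
    apply: Rintegral_ge0 => x _; rewrite ?Im_opp ?Re_opp invE /= -mulNr divr_ge0//.
      by rewrite opprB subr_ge0; lra.
    by rewrite addr_ge0 ?sqr_ge0.
  have h4 : 1/4 <= complex.Re (Lv x2).
    have ci := cinv _ _ (ccst x2) cid' (fun y => nzv x2 y x2n).
    apply: (@le_trans _ _ (\int[mu]_(y in `[y1, y2]) (1/4))).
      by rewrite Rintegral_itv_cst//; lra.
    apply: le_Rintegral => //.
    - exact: integrable_itv (ccst _).
    - exact: integrable_itv (continuousRe ci).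
    move=> y yy; have {yy} : y1 <= y <= y2 by move: yy; rewrite /= in_itv.
    move=> /andP[yl yu]; rewrite invE.
    rewrite [leRHS]/= ler_pdivlMr; last first.
      rewrite ltr_wpDr ?sqr_ge0// exprn_even_gt0//=; apply/eqP => h.
      by move: x2n; rewrite -subr_eq0 h eqxx.
    have s1 : (x2 - x0) ^+ 2 <= 1.
      by rewrite -(expr1n _ 2) ler_pXn2r ?nnegrE//; lra.
    have s2 : (y - y0) ^+ 2 <= 1.
      have t1 : 0 <= 1 - (y - y0) by lra.
      have t2 : 0 <= 1 + (y - y0) by lra.
      by have := mulr_ge0 t1 t2; rewrite -subr_sqr expr1n subr_ge0.
    lra.
  lra.
have KI : 1/4 <= cmod K by rewrite (le_trans K14)// (le_trans (ler_norm _))// normIm_le_cmod.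
(* The sides are at distance at least [1/2] from the centre; the resulting 2, divided by the lower
   bound [1/4], is the constant 8. *)
have inv2 w : 1/2 <= cmod w -> cmod w^-1 <= 2.
  move=> w2; rewrite cmodV -[leRHS]invrK lef_pV2 ?posrE ?invr_gt0//; last by lra.
  by rewrite (le_trans _ w2)//; lra.
have sub (g : R -> C) a b a' b' : continuous g -> a <= a' -> b' <= b ->
    \int[mu]_(t in `[a', b']) cmod (g t) <= \int[mu]_(t in `[a, b]) cmod (g t).
  move=> cg aa bb; rewrite /Rintegral fine_le//.
  - apply: integrable_fin_num => //; exact: integrable_itv (continuous_norm cg).
  - apply: integrable_fin_num => //; exact: integrable_itv (continuous_norm cg).
  apply: ge0_subset_integral => //.
  - have /integrableP[] := @integrable_itv R _ a b (continuous_norm cg).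
    by [].
  - by move=> t _; rewrite lee_fin cmod_ge0.
  - move=> t /=; rewrite !in_itv /= => /andP[t1 t2]; apply/andP; split.
      exact: le_trans t1.
    exact: le_trans bb.
have bnd (u v : R -> R) (g : R -> C) a b a' b' : continuous g ->
    continuous (fun t => (u t +i* v t - z)^-1) -> a' <= b' -> a <= a' -> b' <= b ->
    (forall t, 1/2 <= cmod (u t +i* v t - z)) ->
    cmod (cint (fun t => (u t +i* v t - z)^-1 * g t) a' b') <=
      2 * \int[mu]_(t in `[a, b]) cmod (g t).
  move=> cg ci ab' aa bb hz; apply: (le_trans (cint_norm _ _ (continuousM_complex ci cg))).
  apply: (@le_trans _ _ (2 * \int[mu]_(t in `[a', b']) cmod (g t))); last first.
    by rewrite ler_wpM2l// sub.
  rewrite -RintegralZl//; last exact: integrable_itv (continuous_norm cg).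
  apply: le_Rintegral => //.
  - exact: integrable_itv (continuous_norm (continuousM_complex ci cg)).
  - apply: integrable_itv => t; apply: cvgM; first exact: cvg_cst.
    exact: (continuous_norm cg).
  by move=> t _; rewrite cmodM ler_wpM2r ?cmod_ge0// inv2.
have dh y x : 1/2 <= `|y - y0| -> 1/2 <= cmod (x +i* y - z).
  by move=> h; rewrite (le_trans h)// (le_trans _ (normIm_le_cmod _)).
have dv x y : 1/2 <= `|x - x0| -> 1/2 <= cmod (x +i* y - z).
  by move=> h; rewrite (le_trans h)// (le_trans _ (normRe_le_cmod _)).
have d1 : 1/2 <= `|y1 - y0| by rewrite distrC ger0_norm; lra.
have d2 : 1/2 <= `|y2 - y0| by rewrite ger0_norm; lra.
have d3 : 1/2 <= `|x1 - x0| by rewrite distrC ger0_norm; lra.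
have d4 : 1/2 <= `|x2 - x0| by rewrite ger0_norm; lra.
have B1 := bnd _ _ _ _ _ _ _ (continuous_hor (y := y1) cf)
  (cinv _ _ cid' (ccst y1) (fun x => nzh y1 x y1n))
  x12 x1l x2u (fun x => dh y1 x d1).
have B2 := bnd _ _ _ _ _ _ _ (continuous_hor (y := y2) cf)
  (cinv _ _ cid' (ccst y2) (fun x => nzh y2 x y2n))
  x12 x1l x2u (fun x => dh y2 x d2).
have B3 := bnd _ _ _ _ _ _ _ (continuous_ver (x := x1) cf)
  (cinv _ _ (ccst x1) cid' (fun y => nzv x1 y x1n))
  y12 y1l y2u (fun y => dv x1 y d3).
have B4 := bnd _ _ _ _ _ _ _ (continuous_ver (x := x2) cf)
  (cinv _ _ (ccst x2) cid' (fun y => nzv x2 y x2n))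
  y12 y1l y2u (fun y => dv x2 y d4).
have iF x : cmod ('i * Fv x) = cmod (Fv x) by rewrite cmodM cmodi mul1r.
have BB : cmod B <= cmod (Fh y1) + cmod (Fv x2) + cmod (Fh y2) + cmod (Fv x1).
  rewrite /B (le_trans (cmodB _ _))// iF lerD2r (le_trans (cmodB _ _))// lerD2r.
  by rewrite (le_trans (cmodD _ _))// iF.
have fK : cmod (f z) * (1/4) <= cmod B.
  by rewrite -KB cmodM ler_wpM2l ?cmod_ge0.
rewrite -/(Fh y1) in B1; rewrite -/(Fh y2) in B2.
rewrite -/(Fv x1) in B3; rewrite -/(Fv x2) in B4.
lra.
Qed.

Local Open Scope ereal_scope.

Lemma slice_le (F : measurableTypeR R -> \bar R) (a b A : R) : (a <= b)%R -> (0 <= A)%R ->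
  measurable_fun setT F -> (forall x, 0 <= F x) ->
  (forall x, (a <= x <= b)%R -> A%:E <= F x) ->
  (A * (b - a))%:E <= \int[mu]_x F x.
Proof.
move=> ab A0 mF F0 AF.
apply: (@le_trans _ _ (\int[mu]_(x in `[a, b]) F x)); last first.
  by apply: ge0_subset_integral.
apply: (@le_trans _ _ (\int[mu]_(x in `[a, b]) (cst A%:E) x)); last first.
  apply: ge0_le_integral => //.
  - by apply: measurable_funTS.
rewrite integral_cst//= (lebesgue_measure_itv `[a, b]) /= lte_fin.
case: ltP => [_|ba]; first by rewrite -EFinB -EFinM.
have -> : a = b by apply/eqP; rewrite eq_le ab ba.
by rewrite subrr mulr0 mule0.
Qed.

(** An averaging argument over four strips of width [1/2] around the centre. If some strip has only
    lines with a large integral of [|f|], integrating across it gives the bound; otherwise each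
    strip has a line with a small integral, and these four lines contradict [rectangle_mean]. A mere
    majorant [H] of [|f|] on the square is enough. *)
Lemma area_mean f (x0 y0 : R) (H : RR -> \bar R) : entire f ->
  measurable_fun setT H -> (forall w, 0 <= H w) ->
  (forall x y : R, (x0 - 1 <= x <= x0 + 1)%R -> (y0 - 1 <= y <= y0 + 1)%R ->
    (cmod (f (x +i* y)%C))%:E <= H (x, y)) ->
  (cmod (f (x0 +i* y0)%C))%:E <= 64%:E * \int[mu \x mu]_w H w.
Proof.
move=> ef mH H0 fH; set m := cmod _; set I := (X in _ <= _ * X).
have m0 : (0 <= m)%R by exact: cmod_ge0.
have cf := entire_continuous ef.
have done_ A : A%:E <= I -> (m <= 64 * A)%R -> m%:E <= 64%:E * I.
  move=> AI mA; apply: (@le_trans _ _ (64%:E * A%:E)); first by rewrite -EFinM lee_fin.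
  by rewrite lee_wpmul2l// lee_fin.
(* The threshold is set so that four sides below it give [8 * 4 * A = m] in [rectangle_mean];
   dividing 32 by the width [1/2] gives 64. *)
pose A := (m / 32)%R; have A0 : (0 <= A)%R by rewrite divr_ge0.
have AE : (64 * (A * (1/2)) = m)%R by rewrite /A; field.
have mf2 : measurable_fun setT (fubini_F mu H) by exact: measurable_fun_fubini_tonelli_F.
have mg2 : measurable_fun setT (fubini_G mu H) by exact: measurable_fun_fubini_tonelli_G.
have F0 x : 0 <= fubini_F mu H x by apply: integral_ge0.
have G0 x : 0 <= fubini_G mu H x by apply: integral_ge0.
pose V (x : R) := (\int[mu]_(y in `[(y0 - 1)%R, (y0 + 1)%R]) cmod (f (x +i* y)%C))%R.
pose W (y : R) := (\int[mu]_(x in `[(x0 - 1)%R, (x0 + 1)%R]) cmod (f (x +i* y)%C))%R.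
have sl1 x : measurable_fun setT (fun y : measurableTypeR R => H (x, y)).
  by apply: (measurableT_comp mH); apply: measurable_fun_pair; [exact: measurable_cst|exact: measurable_id].
have sl2 y : measurable_fun setT (fun x : measurableTypeR R => H (x, y)).
  by apply: (measurableT_comp mH); apply: measurable_fun_pair; [exact: measurable_id|exact: measurable_cst].
have VF x : (x0 - 1 <= x <= x0 + 1)%R -> (V x)%:E <= fubini_F mu H x.
  move=> xx; have iv := @integrable_itv R _ (y0 - 1) (y0 + 1) (continuous_norm (continuous_ver (x := x) cf)).
  rewrite /V /Rintegral fineK; last exact: integrable_fin_num iv.
  apply: (@le_trans _ _ (\int[mu]_(y in `[(y0 - 1)%R, (y0 + 1)%R]) H (x, y))); last first.
    by apply: ge0_subset_integral.
  apply: ge0_le_integral => //.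
  - by move=> y _; rewrite lee_fin cmod_ge0.
  - by have /integrableP[] := iv.
  - by apply: measurable_funTS.
  - by move=> y /=; rewrite in_itv => yy; exact: fH.
have WG y : (y0 - 1 <= y <= y0 + 1)%R -> (W y)%:E <= fubini_G mu H y.
  move=> yy; have iv := @integrable_itv R _ (x0 - 1) (x0 + 1) (continuous_norm (continuous_hor (y := y) cf)).
  rewrite /W /Rintegral fineK; last exact: integrable_fin_num iv.
  apply: (@le_trans _ _ (\int[mu]_(x in `[(x0 - 1)%R, (x0 + 1)%R]) H (x, y))); last first.
    by apply: ge0_subset_integral.
  apply: ge0_le_integral => //.
  - by move=> x _; rewrite lee_fin cmod_ge0.
  - by have /integrableP[] := iv.
  - by apply: measurable_funTS.
  - by move=> x /=; rewrite in_itv => xx; exact: fH.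
have dV (a b : R) : (b = a + 1/2)%R -> (x0 - 1 <= a)%R -> (b <= x0 + 1)%R ->
    m%:E <= 64%:E * I \/ exists2 x, (a <= x <= b)%R & (V x < A)%R.
  move=> ba ax bx; have [[x xab Vx]|no] := pselect (exists2 x, (a <= x <= b)%R & (V x < A)%R).
    by right; exists x.
  left; apply: (@done_ (A * (1/2))%R); last by rewrite AE.
  have -> : (1/2 = b - a)%R by rewrite ba; ring.
  rewrite /I (fubini_tonelli1 H mH H0); apply: slice_le => //; first by rewrite ba; lra.
  move=> x xab; apply: (@le_trans _ _ (V x)%:E); last by apply: VF; lra.
  by rewrite lee_fin leNgt; apply/negP => Vx; apply: no; exists x.
have dW (a b : R) : (b = a + 1/2)%R -> (y0 - 1 <= a)%R -> (b <= y0 + 1)%R ->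
    m%:E <= 64%:E * I \/ exists2 y, (a <= y <= b)%R & (W y < A)%R.
  move=> ba ax bx; have [[x xab Vx]|no] := pselect (exists2 x, (a <= x <= b)%R & (W x < A)%R).
    by right; exists x.
  left; apply: (@done_ (A * (1/2))%R); last by rewrite AE.
  have -> : (1/2 = b - a)%R by rewrite ba; ring.
  rewrite /I (fubini_tonelli2 H mH H0); apply: slice_le => //; first by rewrite ba; lra.
  move=> x xab; apply: (@le_trans _ _ (W x)%:E); last by apply: WG; lra.
  by rewrite lee_fin leNgt; apply/negP => Vx; apply: no; exists x.
have [//|[x1 x1i Vx1]] := dV (x0 - 1)%R (x0 - 1/2)%R ltac:(lra) ltac:(lra) ltac:(lra).
have [//|[x2 x2i Vx2]] := dV (x0 + 1/2)%R (x0 + 1)%R ltac:(lra) ltac:(lra) ltac:(lra).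
have [//|[y1 y1i Wy1]] := dW (y0 - 1)%R (y0 - 1/2)%R ltac:(lra) ltac:(lra) ltac:(lra).
have [//|[y2 y2i Wy2]] := dW (y0 + 1/2)%R (y0 + 1)%R ltac:(lra) ltac:(lra) ltac:(lra).
have := rectangle_mean ef x1i x2i y1i y2i.
rewrite -/m -/(W y1) -/(W y2) -/(V x1) -/(V x2) => mm.
exfalso; move: mm; apply/negP; rewrite -ltNge.
by move: AE; lra.
Qed.

End AreaMean.

(** * The Fock norm *)

Section FockNorm.
Variable R : realType.
Local Notation C := R[i].
Local Notation mu := (@lebesgue_measure R).
Local Notation RR := (measurableTypeR R * measurableTypeR R)%type.
Implicit Types (f g F : C -> C) (alpha q : R).

Definition wmod alpha f (z : C) : R := cmod (f z) * expR (- (alpha / 2) * cmod z ^+ 2).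

Lemma wmod_ge0 alpha f z : 0 <= wmod alpha f z.
Proof. by rewrite mulr_ge0 ?cmod_ge0 ?expR_ge0. Qed.

Lemma continuous_wmod alpha f : continuous f -> continuous (wmod alpha f).
Proof.
move=> cf z.
have cg : continuous (fun x : R => expR (- (alpha / 2) * x ^+ 2)).
  move=> x; apply: continuous_comp; last exact: continuous_expR.
  by apply: cvgM; [exact: cvg_cst|exact: exprn_continuous].
have c2 : {for z, continuous (fun w : C => expR (- (alpha / 2) * cmod w ^+ 2))}.
  exact: (continuous_comp (@continuous_cmod R z) (cg (cmod z))).
have c3 : {for z, continuous (fun w : C => cmod (f w))}.
  by apply: continuous_comp; [exact: cf|exact: continuous_cmod].
exact: (cvgM c3 c2).
Qed.

Lemma wmod_powR alpha q f z :
  cmod (f z) `^ q * expR (- (alpha * q / 2) * cmod z ^+ 2) = wmod alpha f z `^ q.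
Proof.
rewrite powRM ?cmod_ge0 ?expR_ge0// -expRM; congr (_ * expR _); ring.
Qed.

Lemma measurable_wmod alpha q f : continuous f ->
  measurable_fun [set: RR] (fun w : RR => (wmod alpha f (w.1 +i* w.2) `^ q)%:E).
Proof.
move=> cf; apply/measurable_EFinP.
apply: (measurableT_comp (measurable_powR _)).
exact: (measurable_plane (continuous_wmod cf)).
Qed.

Local Open Scope ereal_scope.

Definition area_power alpha q f : \bar R :=
  \int[mu \x mu]_w (wmod alpha f (w.1 +i* w.2)%C `^ q)%:E.

Lemma area_power_ge0 alpha q f : 0 <= area_power alpha q f.
Proof. by apply: integral_ge0 => w _; rewrite lee_fin powR_ge0. Qed.

Lemma fock_normE alpha q f :
  fock_norm alpha q%:E f = ((alpha * q / (2 * pi))%:E * area_power alpha q f) `^ q^-1.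
Proof.
rewrite /fock_norm /area_integral /area_power; congr ((_ * _) `^ _).
by apply: eq_integral => w _; rewrite wmod_powR.
Qed.

Lemma fock_norm_ge0 alpha p f : 0 <= fock_norm alpha p f.
Proof.
case: p => [q| |] //=; first exact: poweR_ge0.
apply: (@le_trans _ _ (wmod alpha f 0)%:E); first by rewrite lee_fin wmod_ge0.
by apply: ereal_sup_ubound; exists 0%R.
Qed.

Lemma fock_norm_mono alpha q K f g : (0 < alpha)%R -> (0 < q)%R -> (0 <= K)%R ->
  area_power alpha q f <= (K `^ q)%:E * area_power alpha q g ->
  fock_norm alpha q%:E f <= K%:E * fock_norm alpha q%:E g.
Proof.
move=> a0 q0 K0 H; rewrite !fock_normE.
have c0 : (0 <= alpha * q / (2 * pi))%R.
  by rewrite divr_ge0 ?(ltW (two_pi_gt0 R))// mulr_ge0// ltW.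
have -> : K%:E = (K `^ q)%:E `^ q^-1.
  by rewrite poweR_EFin -powRrM divff ?powRr1// gt_eqF.
rewrite -poweRM ?lee_fin ?powR_ge0//; last first.
  by rewrite mule_ge0 ?lee_fin ?area_power_ge0.
apply: gt0_ler_poweR; first by rewrite invr_ge0 ltW.
- by rewrite in_itv /= leey andbT mule_ge0 ?lee_fin ?area_power_ge0.
- by rewrite in_itv /= leey andbT !mule_ge0 ?lee_fin ?powR_ge0 ?area_power_ge0.
by rewrite muleCA lee_wpmul2l ?lee_fin.
Qed.

Lemma fock_norm_fin alpha q K f : (0 < alpha)%R -> (0 < q)%R -> (0 <= K)%R ->
  area_power alpha q f <= (K `^ q)%:E ->
  fock_norm alpha q%:E f <= (K * (alpha * q / (2 * pi)) `^ q^-1)%:E.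
Proof.
move=> a0 q0 K0 H; rewrite !fock_normE.
have c0 : (0 <= alpha * q / (2 * pi))%R.
  by rewrite divr_ge0 ?(ltW (two_pi_gt0 R))// mulr_ge0// ltW.
have -> : (K * (alpha * q / (2 * pi)) `^ q^-1)%:E =
    ((alpha * q / (2 * pi))%:E * (K `^ q)%:E) `^ q^-1.
  rewrite -EFinM poweR_EFin (powRM _ c0 (powR_ge0 K q)).
  by rewrite -powRrM divff ?gt_eqF// powRr1// mulrC.
apply: gt0_ler_poweR; first by rewrite invr_ge0 ltW.
- by rewrite in_itv /= leey andbT mule_ge0 ?lee_fin ?area_power_ge0.
- by rewrite in_itv /= leey andbT mule_ge0 ?lee_fin ?powR_ge0.
by rewrite lee_wpmul2l ?lee_fin.
Qed.

(** If [s > d] then [s = s^(1 - q) * s^q], and the exponent [1 - q] is not positive. *)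
Lemma le_add_powR (s d q : R) : (0 <= s)%R -> (0 < d)%R -> (1 <= q)%R ->
  (s <= d + d `^ (1 - q) * s `^ q)%R.
Proof.
move=> s0 d0 q1; have [sd|ds] := leP s d.
  by rewrite (le_trans sd)// lerDl mulr_ge0 ?powR_ge0.
have {}s0 : (0 < s)%R by exact: lt_trans ds.
apply: (@le_trans _ _ (d `^ (1 - q) * s `^ q)%R); last by rewrite lerDr ltW.
have -> : (s `^ q = s `^ (q - 1) * s)%R.
  by rewrite mulrC mulr_powRB1 ?(ltW s0)// (lt_le_trans ltr01).
rewrite mulrA ler_peMl ?(ltW s0)//.
rewrite (@le_trans _ _ (d `^ (1 - q) * d `^ (q - 1))%R)//.
  rewrite -powRD; first by rewrite addrA subrK subrr powRr0.
  by rewrite (gt_eqF d0) implybT.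
rewrite ler_wpM2l ?powR_ge0// ge0_ler_powR ?nnegrE ?subr_ge0//; exact: ltW.
Qed.

(* The mean inequality is applied to [f] times an exponential whose modulus turns
   [|f|] into [wmod alpha f] up to a factor bounded on the square.  The bound
   [s <= d + d^(1 - q) s^q], with [d] a small multiple of the value at the centre,
   replaces Holder's inequality. *)
Lemma point_eval_area alpha q : (0 < alpha)%R -> (1 <= q)%R ->
  exists2 K : R, (0 < K)%R & forall f, entire f -> forall z,
    (wmod alpha f z `^ q)%:E <= K%:E * area_power alpha q f.
Proof.
move=> a0 q1; have q0 : (0 < q)%R by exact: lt_le_trans ltr01 q1.
pose E := expR alpha; have E0 : (0 < E)%R by exact: expR_gt0.
(* [E] bounds the exponential factor on the square, where [|v - z|^2 <= 2]. The square has area 4,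
   so with [d = m / c] the first term contributes [64 * 4 * E * d = m / 2], which is absorbed on the
   left. *)
pose c := (512 * E)%R; have c0 : (0 < c)%R by rewrite mulr_gt0 ?ltr0n.
exists (128 * E * c `^ (q - 1))%R; first by rewrite !mulr_gt0 ?ltr0n ?powR_gt0.
move=> f ef z.
set K := (128 * E * _)%R; have K0 : (0 < K)%R by rewrite !mulr_gt0 ?ltr0n ?powR_gt0.
have cf := entire_continuous ef.
set I := area_power alpha q f.
have [->|m0] := eqVneq (wmod alpha f z) 0%R.
  by rewrite powR0 ?gt_eqF// mule_ge0 ?area_power_ge0// lee_fin ltW.
have {}m0 : (0 < wmod alpha f z)%R by rewrite lt_neqAle eq_sym m0 wmod_ge0.
set m := wmod alpha f z in m0 *.
pose d := (m / c)%R; have d0 : (0 < d)%R by rewrite divr_gt0.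
have dm : (d = m / c)%R by [].
case: z @m m0 d d0 dm => x0 y0 m m0 d d0 dm; set z : C := (x0 +i* y0)%C.
(* The real part of the exponent is [alpha/2 |v - z|^2 - alpha/2 |v|^2], by completing the
   square. *)
pose F (v : C) : C := (f v * cexp (- (alpha%:C * z^* * (v - z)) - (alpha / 2 * cmod z ^+ 2)%:C)%C)%R.
have eF : entire F.
  apply: entireM; first exact: ef.
  apply: (entire_comp (@entire_cexp R)); apply: entireB; last exact: entire_cst.
  rewrite (_ : (fun _ => _) = fun v => (alpha%:C * z^* * z)%C + (- (alpha%:C * z^*)%C) * v)%R.
    exact: entire_affine.
  by apply/funext => v; ring.
have FE v : cmod (F v) = (wmod alpha f v * expR (alpha / 2 * cmod (v - z) ^+ 2))%R.
  rewrite /F cmodM cmod_cexp /wmod -[RHS]mulrA -expRD; congr (_ * expR _)%R.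
  rewrite !(Re_add, Re_opp, Re_mul, Im_mul) conjE !cmod_sqr /z.
  by case: v => v1 v2 /=; field.
have Fz : cmod (F z) = m by rewrite FE subrr cmod0 expr0n /= mulr0 expR0 mulr1.
pose Q : set RR := `[(x0 - 1)%R, (x0 + 1)%R] `*` `[(y0 - 1)%R, (y0 + 1)%R].
have mQ : measurable Q by apply: measurableX.
pose H1 (w : RR) : \bar R := (E * d * \1_Q w)%:E.
pose H2 (w : RR) : \bar R := ((E * d `^ (1 - q)) * wmod alpha f (w.1 +i* w.2)%C `^ q)%:E.
have H10 w : 0 <= H1 w by rewrite lee_fin !mulr_ge0// ?(ltW E0) ?(ltW d0).
have H20 w : 0 <= H2 w by rewrite lee_fin !mulr_ge0 ?powR_ge0// ?(ltW E0).
have mH1 : measurable_fun setT H1.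
  apply/measurable_EFinP; apply: measurable_funM; first exact: measurable_cst.
  exact: measurable_indic.
have mW := @measurable_wmod alpha q f cf.
have mH2 : measurable_fun setT H2.
  apply/measurable_EFinP; apply: measurable_funM; first exact: measurable_cst.
  exact/measurable_EFinP.
have := @area_mean R F x0 y0 (fun w => H1 w + H2 w) eF.
move=> /(_ (emeasurable_funD mH1 mH2) (fun w => adde_ge0 (H10 w) (H20 w))).
rewrite -/z Fz => AM.
have {}AM : m%:E <= 64%:E * \int[mu \x mu]_w (H1 w + H2 w).
  apply: AM => x y xx yy; rewrite -EFinD lee_fin.
  have -> : \1_Q (x, y) = 1%R :> R.
    by rewrite indicE mem_set//; split; rewrite /= in_itv.
  rewrite mulr1 -mulrA -mulrDr FE mulrC ler_pM ?expR_ge0 ?wmod_ge0//.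
    rewrite ler_expR -[leRHS]mulr1 -mulrA ler_wpM2l ?(ltW a0)//.
    rewrite cmod_sqr /=.
    have s1 : ((x - x0) ^+ 2 <= 1)%R.
      have t1 : (0 <= 1 - (x - x0))%R by lra.
      have t2 : (0 <= 1 + (x - x0))%R by lra.
      by have := mulr_ge0 t1 t2; rewrite -subr_sqr expr1n subr_ge0.
    have s2 : ((y - y0) ^+ 2 <= 1)%R.
      have t1 : (0 <= 1 - (y - y0))%R by lra.
      have t2 : (0 <= 1 + (y - y0))%R by lra.
      by have := mulr_ge0 t1 t2; rewrite -subr_sqr expr1n subr_ge0.
    lra.
  exact: le_add_powR (wmod_ge0 _ _ _) d0 q1.
rewrite (ge0_integralD (mu \x mu) measurableT (fun w _ => H10 w) mH1 (fun w _ => H20 w) mH2) in AM.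
have I1 : \int[mu \x mu]_w H1 w = (E * d * 4)%:E.
  rewrite /H1; under eq_integral do rewrite EFinM.
  rewrite ge0_integralZl//; last 2 first.
  - by apply/measurable_EFinP; exact: measurable_indic.
  - by rewrite lee_fin mulr_ge0 ?(ltW E0) ?(ltW d0).
  rewrite (integral_indic (mu \x mu) measurableT mQ) setIT.
  transitivity ((E * d)%:E * (mu `[(x0 - 1)%R, (x0 + 1)%R] * mu `[(y0 - 1)%R, (y0 + 1)%R])).
    congr (_ * _); exact: (product_measure1E mu mu (measurable_itv _) (measurable_itv _)).
  rewrite (lebesgue_measure_itv `[(x0 - 1)%R, (x0 + 1)%R]).
  rewrite (lebesgue_measure_itv `[(y0 - 1)%R, (y0 + 1)%R]) /= !lte_fin.
  rewrite !ifT; [|lra..].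
  by rewrite -!EFinB -!EFinM; congr _%:E; ring.
have I2 : \int[mu \x mu]_w H2 w = (E * d `^ (1 - q))%:E * I.
  rewrite /H2; under eq_integral do rewrite EFinM.
  rewrite (ge0_integralZl (mu \x mu) measurableT mW)//.
    by move=> w _; rewrite lee_fin powR_ge0.
  by rewrite lee_fin mulr_ge0 ?powR_ge0 ?(ltW E0).
rewrite I1 I2 in AM.
have I0 : 0 <= I by exact: area_power_ge0.
case: I I0 AM {I2} => [r r0 AM|_ _|//]; last by rewrite gt0_muley ?leey// lte_fin.
rewrite -!EFinM lee_fin in AM; rewrite -EFinM lee_fin.
have dE : (64 * (E * d * 4) = m / 2)%R by rewrite dm /c; field; rewrite gt_eqF.
rewrite mulrDr dE in AM.
have {}AM : (m <= 128 * E * d `^ (1 - q) * r)%R by lra.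
have dd : (d `^ (q - 1) * d `^ (1 - q) = 1)%R.
  rewrite -powRD; first by rewrite addrA subrK subrr powRr0.
  by rewrite (gt_eqF d0) implybT.
have dq : (0 <= d `^ (q - 1))%R by exact: powR_ge0.
have := ler_wpM2l dq AM.
have -> : (d `^ (q - 1) * (128 * E * d `^ (1 - q) * r) = 128 * E * r)%R.
  by transitivity (d `^ (q - 1) * d `^ (1 - q) * (128 * E * r))%R; [ring|rewrite dd mul1r].
have cq : (0 < c `^ (q - 1))%R by exact: powR_gt0.
rewrite dm powRM ?(ltW m0) ?invr_ge0 ?(ltW c0)// => AM2.
have -> : (m `^ q = m `^ (q - 1) * m)%R by rewrite mulrC mulr_powRB1 ?(ltW m0).
have ci : (c `^ (q - 1) * c^-1 `^ (q - 1) = 1)%R.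
  by rewrite -powRM ?invr_ge0 ?(ltW c0)// divff ?powR1// gt_eqF.
have := ler_wpM2l (ltW cq) AM2.
have -> : (c `^ (q - 1) * (m `^ (q - 1) * c^-1 `^ (q - 1) * m) = m `^ (q - 1) * m)%R.
  transitivity (c `^ (q - 1) * c^-1 `^ (q - 1) * (m `^ (q - 1) * m))%R; first by ring.
  by rewrite ci mul1r.
by move=> /le_trans; apply; rewrite /K le_eqVlt; apply/orP; left; apply/eqP; ring.
Qed.

Lemma point_eval alpha p : (0 < alpha)%R -> 1 <= p ->
  exists2 K : R, (0 < K)%R & forall f, entire f -> forall z,
    (wmod alpha f z)%:E <= K%:E * fock_norm alpha p f.
Proof.
move=> a0; case: p => [q| _ |//]; last first.
  exists 1%R => // f ef z; rewrite mul1e; apply: ereal_sup_ubound; by exists z.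
rewrite lee_fin => q1; have q0 : (0 < q)%R by exact: lt_le_trans ltr01 q1.
have [K K0 HK] := point_eval_area a0 q1.
set c := (alpha * q / (2 * pi))%R.
have c0 : (0 < c)%R by rewrite divr_gt0 ?two_pi_gt0// mulr_gt0.
exists ((K / c) `^ q^-1)%R; first by rewrite powR_gt0// divr_gt0.
move=> f ef z; rewrite fock_normE -/c -poweR_EFin -poweRM; first last.
- by rewrite mule_ge0 ?area_power_ge0// lee_fin ltW.
- by rewrite lee_fin divr_ge0 ?(ltW K0) ?(ltW c0).
have -> : (wmod alpha f z)%:E = (wmod alpha f z `^ q)%:E `^ q^-1.
  by rewrite poweR_EFin -powRrM divff ?powRr1 ?wmod_ge0// gt_eqF.
apply: gt0_ler_poweR; first by rewrite invr_ge0 ltW.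
- by rewrite in_itv /= leey andbT lee_fin powR_ge0.
- rewrite in_itv /= leey andbT muleA -EFinM divfK ?gt_eqF//.
  by rewrite mule_ge0 ?area_power_ge0// lee_fin ltW.
by rewrite muleA -EFinM divfK ?gt_eqF//; exact: HK.
Qed.

(** [K] depends on the width [eps] only, neither on the centre nor on [F]: this bounds all kernels
    at once, and makes the norm small together with the height [d]. *)
Lemma gaussian_bound alpha p (eps : R) : (0 < alpha)%R -> 1 <= p -> (0 < eps)%R ->
  exists2 K : R, (0 <= K)%R & forall F (d : R), entire F -> (0 <= d)%R ->
    (exists a : C, forall z, (wmod alpha F z <= d * expR (- eps * cmod (z - a) ^+ 2))%R) ->
    fock_norm alpha p F <= (K * d)%:E.
Proof.
move=> a0 + e0; case: p => [q| _ |//]; last first.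
  exists 1%R => // F d eF d0 [a H]; rewrite mul1r /=.
  apply: ge_ereal_sup => _ [z _ <-]; rewrite lee_fin (le_trans (H z))//.
  rewrite ler_piMr// -expR0 ler_expR mulNr oppr_le0.
  by rewrite mulr_ge0 ?sqr_ge0 ?(ltW e0).
rewrite lee_fin => q1; have q0 : (0 < q)%R by exact: lt_le_trans ltr01 q1.
have [G G0 HG] := @gaussian_integral R (eps * q) (mulr_gt0 e0 q0).
exists (G `^ q^-1 * (alpha * q / (2 * pi)) `^ q^-1)%R.
  by rewrite mulr_ge0 ?powR_ge0.
move=> F d eF d0 [a H].
have -> : (G `^ q^-1 * (alpha * q / (2 * pi)) `^ q^-1 * d =
  (G `^ q^-1 * d) * (alpha * q / (2 * pi)) `^ q^-1)%R by ring.
apply: fock_norm_fin => //; first by rewrite mulr_ge0 ?powR_ge0.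
rewrite powRM ?powR_ge0// -powRrM mulVf ?gt_eqF// powRr1//.
rewrite mulrC EFinM -(HG (complex.Re a) (complex.Im a)).
pose g (w : RR) := (expR (- (eps * q) * ((w.1 - complex.Re a) ^+ 2 + (w.2 - complex.Im a) ^+ 2)))%:E.
have mg : measurable_fun setT g.
  apply/measurable_EFinP; apply: measurableT_comp; first exact: measurable_expR.
  apply: measurable_funM; first exact: measurable_cst.
  by apply: measurable_funD; apply: measurable_funX; apply: measurable_funB => //; exact: measurable_cst.
rewrite -(ge0_integralZl (mu \x mu) measurableT mg); last 2 first.
- by move=> w _; rewrite lee_fin expR_ge0.
- by rewrite lee_fin powR_ge0.
have mW := @measurable_wmod alpha q F (entire_continuous eF).
have mB := emeasurable_funM (@measurable_cst _ _ RR _ setT (d `^ q)%:E) mg.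
apply: (ge0_le_integral (mu \x mu) measurableT _ mW mB).
  by move=> w _; rewrite lee_fin powR_ge0.
move=> w _; rewrite /g -EFinM lee_fin.
apply: (@le_trans _ _ ((d * expR (- eps * cmod ((w.1 +i* w.2)%C - a) ^+ 2)) `^ q)%R).
  by rewrite ge0_ler_powR ?nnegrE ?wmod_ge0 ?(ltW q0)// mulr_ge0 ?expR_ge0.
rewrite powRM ?expR_ge0// -expRM le_eqVlt; apply/orP; left; apply/eqP.
by congr (_ * expR _)%R; rewrite cmod_sqr Re_add Im_add Re_opp Im_opp /=; ring.
Qed.

(** The substitution has Jacobian [|l|^2], which enters the norm through its power [- 1 / q]; for
    the sup norm there is no such factor. *)
Lemma composition_bound alpha p (a l : C) (B : R) : (0 < alpha)%R -> 1 <= p ->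
  (l != 0)%R -> (0 <= B)%R ->
  exists2 K : R, (0 <= K)%R & forall f g, entire f -> entire g ->
    (forall z, (wmod alpha g z <= B * wmod alpha f (a + l * z))%R) ->
    fock_norm alpha p g <= K%:E * fock_norm alpha p f.
Proof.
move=> a0 + l0 B0; case: p => [q| _ |//]; last first.
  exists B => // f g ef eg H /=.
  apply: ge_ereal_sup => _ [z _ <-].
  apply: (@le_trans _ _ (B * wmod alpha f (a + l * z))%:E); first by rewrite lee_fin H.
  rewrite EFinM lee_wpmul2l ?lee_fin//; apply: ereal_sup_ubound.
  by exists (a + l * z)%R.
rewrite lee_fin => q1; have q0 : (0 < q)%R by exact: lt_le_trans ltr01 q1.
have l2 : (0 < cmod l ^+ 2)%R by rewrite exprn_gt0// cmod_gt0.
exists (B * (cmod l ^+ 2)^-1 `^ q^-1)%R; first by rewrite mulr_ge0 ?powR_ge0.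
move=> f g ef eg H; apply: fock_norm_mono => //; first by rewrite mulr_ge0 ?powR_ge0.
rewrite powRM ?powR_ge0// -powRrM mulVf ?gt_eqF// powRr1 ?invr_ge0 ?(ltW l2)//.
rewrite EFinM -muleA.
have cf := entire_continuous ef; have cg := entire_continuous eg.
pose h (w : RR) := (wmod alpha f (w.1 +i* w.2)%C `^ q)%:E.
have mh : measurable_fun setT h by exact: measurable_wmod.
have h0 w : 0 <= h w by rewrite lee_fin powR_ge0.
case: a l l0 l2 H => a1 a2 [l1 l2'] l0 l2 H.
have := @integral_plane_affine R l1 l2' a1 a2 h.
rewrite -[(l1 ^+ 2 + l2' ^+ 2)%R](cmod_sqr (l1 +i* l2')%C).
move=> /(_ (lt0r_neq0 l2) mh h0) <-.
have cfa : continuous (fun z : C => f ((a1 +i* a2)%C + (l1 +i* l2')%C * z)%R).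
  by apply: entire_continuous; apply: (entire_comp ef); exact: entire_affine.
pose h' (w : RR) := (wmod alpha f (((a1 +i* a2)%C + (l1 +i* l2')%C * (w.1 +i* w.2)%C)%R) `^ q)%:E.
have hE w : h (a1 + (l1 * w.1 - l2' * w.2), a2 + (l1 * w.2 + l2' * w.1))%R = h' w by [].
have mh' : measurable_fun setT h'.
  apply/measurable_EFinP; apply: (measurableT_comp (measurable_powR _)).
  apply: (@measurable_plane R (fun z => wmod alpha f ((a1 +i* a2)%C + (l1 +i* l2')%C * z)%R)).
  move=> z; apply: (@continuous_comp _ _ _ (fun z : C => (a1 +i* a2)%C + (l1 +i* l2')%C * z)%R (wmod alpha f)).
    apply: entire_continuous; exact: entire_affine.
  exact: continuous_wmod.
rewrite -(ge0_integralZl (mu \x mu) measurableT mh'); last 2 first.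
- by move=> w _; rewrite lee_fin powR_ge0.
- by rewrite lee_fin powR_ge0.
have mW := @measurable_wmod alpha q g cg.
have mB := emeasurable_funM (@measurable_cst _ _ RR _ setT (B `^ q)%:E) mh'.
apply: (ge0_le_integral (mu \x mu) measurableT _ mW mB).
  by move=> w _; rewrite lee_fin powR_ge0.
move=> w _; rewrite -EFinM lee_fin -powRM ?wmod_ge0//.
by rewrite ge0_ler_powR ?nnegrE ?wmod_ge0 ?(ltW q0)// ?H// mulr_ge0 ?wmod_ge0.
Qed.

End FockNorm.

(** * Montel's theorem *)

(** Tychonoff's theorem provides a cluster point [p] of the rows in a product of segments. The
    indices are then picked one after the other, the [n]-th row being within [1 / n] of [p] in its
    first [n] coordinates. *)
Lemma diagonal_subsequence (R : realType) (x : nat -> nat -> R) (b : nat -> R) :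
  (forall n k, `|x n k| <= b k) ->
  exists (h : nat -> nat) (p : nat -> R),
    (forall m n, (m < n)%N -> (h m < h n)%N) /\
    forall k (e : R), 0 < e -> exists N, forall n, (N <= n)%N -> `|x (h n) k - p k| <= e.
Proof.
move=> xb; pose T (k : nat) : topologicalType := R.
pose A (k : nat) : set (T k) := `[- b k, b k]%classic.
have cA : compact [set f : prod_topology T | forall k, A k (f k)].
  by apply: tychonoff => k; exact: segment_compact.
pose X (n : nat) : prod_topology T := x n.
have [] := cA (X @ \oo).
  by exists 0%N => // n _ k; rewrite /A /= in_itv /= -ler_norml.
move=> p [_ clp].
have near_p K (e : R) : 0 < e ->
    nbhs (p : prod_topology T) [set f | forall k, (k < K)%N -> `|f k - p k| < e].
  move=> e0; elim: K => [|K IH]; first by apply: filterS filterT => f _ k.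
  have pK : nbhs (p : prod_topology T) [set f | `|f K - p K| < e].
    have := @proj_continuous nat T K p.
    have nb : nbhs (p K : R) [set y : R | `|y - p K| < e].
      by apply/nbhs_ballP; exists e => // y /=; rewrite /ball /= distrC.
    by move=> /(_ _ nb).
  apply: filterS2 IH pK => f H1 H2 k; rewrite ltnS leq_eqVlt => /orP[/eqP-> //|].
  exact: H1.
have next K m : exists n, (m < n)%N /\ forall k, (k < K)%N -> `|x n k - p k| < K%:R^-1.
  have [K0|K0] := posnP K; first by exists m.+1; split=> // k; rewrite K0.
  have K0' : 0 < K%:R^-1 :> R by rewrite invr_gt0 ltr0n.
  have [] := clp [set f | exists2 n, (m < n)%N & f = X n] _ _ (near_p K _ K0').
    by exists m.+1 => // n mn /=; exists n.
  by move=> f [[n mn ->] H]; exists n.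
have /choice[s sP] : forall Km : nat * nat, exists n, (Km.2 < n)%N /\
    forall k, (k < Km.1)%N -> `|x n k - p k| < Km.1%:R^-1.
  by move=> [K m]; exact: next.
pose h := fix h n := if n is n'.+1 then s (n, h n') else s (0, 0)%N.
have hS n : (h n < h n.+1)%N by have [] := sP (n.+1, h n).
exists h, p; split.
  move=> m n; elim: n => // n IH; rewrite ltnS leq_eqVlt => /orP[/eqP->//|mn].
  exact: ltn_trans (IH mn) (hS n).
(* The row [h 0] carries no information; a threshold above [k] excludes it and places [k] among the
   controlled coordinates. *)
move=> k e e0; exists (maxn (Num.bound e^-1) k.+1) => -[|n].
  by rewrite geq_max ltn0 andbF.
rewrite geq_max => /andP[en kn]; apply: (@le_trans _ _ n.+1%:R^-1).
  by have [_ /(_ k kn)/ltW] := sP (n.+1, h n).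
rewrite -[leRHS]invrK lef_pV2 ?posrE ?invr_gt0 ?ltr0n//.
apply: (@le_trans _ _ (Num.bound e^-1)%:R); last by rewrite ler_nat.
by rewrite ltW// archi_boundP// invr_ge0 ltW.
Qed.

Section Montel.
Variable R : realType.
Local Notation C := R[i].
Implicit Types (v : nat -> C) (u : nat -> C -> C).

Definition cconv v (l : C) : Prop :=
  forall e : R, 0 < e -> exists N, forall n, (N <= n)%N -> cmod (v n - l) <= e.

Lemma real_cauchy (y : nat -> R) :
  (forall e, 0 < e -> exists N, forall m n, (N <= m)%N -> (N <= n)%N -> `|y m - y n| <= e) ->
  exists l, forall e, 0 < e -> exists N, forall n, (N <= n)%N -> `|y n - l| <= e.
Proof.
move=> H; have : cvg (y @ \oo).
  apply/cauchy_cvgP; apply: cauchy_exP => e e0.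
  have [N HN] := H (e / 2) (divr_gt0 e0 (ltr0n _ 2)).
  exists (y N); exists N => // n Nn /=; rewrite /ball /=.
  by apply: le_lt_trans (HN N n (leqnn _) Nn) _; lra.
move=> /cvgrPdist_le cy; exists (lim (y @ \oo)) => e /cy [N _ HN].
by exists N => n Nn; rewrite distrC; exact: HN.
Qed.

Lemma cconv_cauchy v :
  (forall e, 0 < e -> exists N, forall m n, (N <= m)%N -> (N <= n)%N -> cmod (v m - v n) <= e) ->
  exists l, cconv v l.
Proof.
move=> H.
have [a Ha] : exists a, forall e, 0 < e -> exists N, forall n, (N <= n)%N -> `|complex.Re (v n) - a| <= e.
  apply: real_cauchy => e /H [N HN]; exists N => m n Nm Nn.
  by rewrite -Re_opp -Re_add (le_trans (normRe_le_cmod _))// HN.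
have [b Hb] : exists b, forall e, 0 < e -> exists N, forall n, (N <= n)%N -> `|complex.Im (v n) - b| <= e.
  apply: real_cauchy => e /H [N HN]; exists N => m n Nm Nn.
  by rewrite -Im_opp -Im_add (le_trans (normIm_le_cmod _))// HN.
exists (a +i* b) => e e0; have e2 : 0 < e / 2 by rewrite divr_gt0.
have [N HN] := Ha _ e2; have [N' HN'] := Hb _ e2.
exists (maxn N N') => n; rewrite geq_max => /andP[/HN h1 /HN' h2].
apply: le_trans (cmod_le_ReIm _) _; rewrite Re_add Im_add Re_opp Im_opp /=.
by rewrite (splitr e) lerD.
Qed.

Lemma cconvB v w l l' : cconv v l -> cconv w l' -> cconv (fun n => v n - w n) (l - l').
Proof.
move=> H H' e e0; have e2 : 0 < e / 2 by rewrite divr_gt0.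
have [N HN] := H _ e2; have [N' HN'] := H' _ e2.
exists (maxn N N') => n; rewrite geq_max => /andP[/HN h1 /HN' h2].
have -> : v n - w n - (l - l') = (v n - l) - (w n - l') by ring.
apply: le_trans (cmodD _ _) _; rewrite cmodN (splitr e); exact: lerD.
Qed.

Lemma cconvMr v l c : cconv v l -> cconv (fun n => v n * c) (l * c).
Proof.
move=> H e e0; have c0 : 0 < cmod c + 1 by rewrite ltr_wpDl ?cmod_ge0.
have [N HN] := H _ (divr_gt0 e0 c0); exists N => n /HN h.
rewrite -mulrBl cmodM.
apply: (@le_trans _ _ (e / (cmod c + 1) * (cmod c + 1))); last by rewrite divfK ?gt_eqF.
by rewrite ler_pM ?cmod_ge0// lerDl.
Qed.

Lemma cconv_le v l (B : R) : cconv v l -> (forall n, cmod (v n) <= B) -> cmod l <= B.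
Proof.
move=> H vB; apply/ler_addgt0Pr => e /H[N /(_ N (leqnn _)) HN].
have -> : l = v N - (v N - l) by ring.
apply: le_trans (cmodD _ _) _; rewrite cmodN; exact: lerD.
Qed.

(** On the circle of radius [2 * (r + 1)] the bound depends on [f] only through [M], so it is
    uniform over a locally bounded family. *)
Lemma taylor_half f (r M : R) n (z : C) : entire f -> 0 <= r ->
  (forall w, cmod w <= 2 * (r + 1) -> cmod (f w) <= M) -> cmod z <= r ->
  cmod (f z - \sum_(k < n) tcoef f 0 k * z ^+ k) <= 2 * M * 2^-1 ^+ n.
Proof.
move=> ef r0 fM zr; have rho0 : 0 < 2 * (r + 1) by rewrite mulr_gt0// ltr_wpDl.
have zr2 : cmod z < 2 * (r + 1) by lra.
have M0 : 0 <= M.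
  by apply: le_trans (cmod_ge0 (f 0)) (fM _ _); rewrite cmod0 ltW.
have := @taylor_remainder R f 0 z (2 * (r + 1)) M n ef zr2.
rewrite add0r => H; apply: le_trans (H _) _.
  by move=> w hw; rewrite add0r fM// hw.
have -> : 2 * M * 2^-1 ^+ n = M * 2^-1 ^+ n * 2 by ring.
have z0 := cmod_ge0 z.
apply: ler_pM.
- by rewrite mulr_ge0// exprn_ge0// divr_ge0// ltW.
- by rewrite divr_ge0 ?(ltW rho0)//; lra.
- rewrite ler_wpM2l// lerXn2r ?nnegrE ?invr_ge0 ?divr_ge0 ?(ltW rho0)//.
  by rewrite ler_pdivrMr//; lra.
- by rewrite ler_pdivrMr; lra.
Qed.

Lemma uniform_poly (c : nat -> nat -> C) (l : nat -> C) (r : R) K :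
  (forall k, cconv (fun n => c n k) (l k)) -> 0 <= r ->
  forall e, 0 < e -> exists N, forall n, (N <= n)%N -> forall z, cmod z <= r ->
    cmod (\sum_(k < K) c n k * z ^+ k - \sum_(k < K) l k * z ^+ k) <= e.
Proof.
move=> cl r0; elim: K => [|K IH] e e0.
  by exists 0%N => n _ z _; rewrite !big_ord0 subr0 cmod0 ltW.
have e2 : 0 < e / 2 by rewrite divr_gt0.
have Q0 : 0 < (r + 1) ^+ K by rewrite exprn_gt0// ltr_wpDl.
have [N HN] := IH _ e2; have [N' HN'] := cl K _ (divr_gt0 e2 Q0).
exists (maxn N N') => n; rewrite geq_max => /andP[/HN h1 /HN' h2] z zr.
rewrite !big_ord_recr /= opprD addrACA -mulrBl.
apply: le_trans (cmodD _ _) _; rewrite (splitr e) lerD ?h1//.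
rewrite cmodM; apply: (@le_trans _ _ (e / 2 / (r + 1) ^+ K * (r + 1) ^+ K)).
  rewrite ler_pM ?cmod_ge0// cmodX lerXn2r ?nnegrE ?cmod_ge0 ?addr_ge0//; lra.
by rewrite divfK ?gt_eqF.
Qed.

Definition locally_uniformly_bounded u :=
  forall r, exists M, forall n z, cmod z <= r -> cmod (u n z) <= M.

Definition locally_uniform_cvg u (g : C -> C) :=
  forall r e, 0 < e -> exists N, forall n, (N <= n)%N ->
    forall z, cmod z <= r -> cmod (u n z - g z) <= e.

(** Local boundedness makes the Taylor tails uniformly small; only finitely many coefficients are
    left, and they converge. *)
Lemma coefficients_uniform_cauchy u (l : nat -> C) : (forall n, entire (u n)) ->
  locally_uniformly_bounded u -> (forall k, cconv (fun n => tcoef (u n) 0 k) (l k)) ->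
  forall r e, 0 < e -> exists N, forall m n, (N <= m)%N -> (N <= n)%N ->
    forall z, cmod z <= r -> cmod (u m z - u n z) <= e.
Proof.
move=> eu bu cl r e e0; have [r0|r0] := ltP r 0.
  by exists 0%N => m n _ _ z /le_lt_trans/(_ r0); rewrite ltNge cmod_ge0.
have [M HM] := bu (2 * (r + 1)).
have M0 : 0 <= M by apply: le_trans (cmod_ge0 (u 0%N 0)) (HM _ _ _); rewrite cmod0; lra.
have M1 : 0 < 8 * (M + 1) by rewrite mulr_gt0 ?ltr0n// ltr_wpDl.
(* The tail is at most [2 M 2^-K], so this choice makes it at most [e / 4]. *)
have [||K HK] := @geometric_small R 2^-1 (e / (8 * (M + 1))); [by lra|exact: divr_gt0|].
have tail n z : cmod z <= r -> cmod (u n z - \sum_(k < K) tcoef (u n) 0 k * z ^+ k) <= e / 4.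
  move=> zr; apply: le_trans (taylor_half K (eu n) r0 (HM n) zr) _.
  apply: (@le_trans _ _ (2 * (M + 1) * (e / (8 * (M + 1))))); last first.
    by rewrite le_eqVlt; apply/orP; left; apply/eqP; field; rewrite gt_eqF// ltr_wpDl.
  by rewrite ler_pM ?mulr_ge0 ?exprn_ge0 ?invr_ge0// ler_wpM2l// lerDl.
have e4 : 0 < e / 4 by rewrite divr_gt0 ?ltr0n.
have [N HN] := uniform_poly K cl r0 e4.
exists N => m n Nm Nn z zr.
set P := \sum_(k < K) l k * z ^+ k.
have T k : (N <= k)%N -> cmod (u k z - P) <= e / 2.
  move=> Nk; set S := \sum_(j < K) tcoef (u k) 0 j * z ^+ j.
  have -> : u k z - P = (u k z - S) + (S - P) by ring.
  apply: le_trans (cmodD _ _) _.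
  by have := lerD (tail k z zr) (HN k Nk z zr); rewrite -/S -/P; lra.
have -> : u m z - u n z = (u m z - P) - (u n z - P) by ring.
apply: le_trans (cmodD _ _) _; rewrite cmodN (splitr e).
exact: lerD (T m Nm) (T n Nn).
Qed.

Lemma uniform_cauchy_cvg u :
  (forall r e, 0 < e -> exists N, forall m n, (N <= m)%N -> (N <= n)%N ->
    forall z, cmod z <= r -> cmod (u m z - u n z) <= e) ->
  exists g, locally_uniform_cvg u g.
Proof.
move=> H; have /choice[g gP] : forall z, exists l, cconv (fun n => u n z) l.
  move=> z; apply: cconv_cauchy => e /(H (cmod z))[N HN].
  by exists N => m n Nm Nn; exact: HN.
exists g => r e /(H r)[N HN]; exists N => n Nn z zr.
apply/ler_addgt0Pr => e' e'0; have [N' HN'] := gP z _ e'0.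
have -> : u n z - g z = (u n z - u (maxn N N') z) + (u (maxn N N') z - g z) by ring.
apply: le_trans (cmodD _ _) _; apply: lerD.
  by apply: HN => //; exact: leq_maxl.
by apply: HN'; exact: leq_maxr.
Qed.

Lemma tcoef1B f g (z : C) : entire f -> entire g ->
  tcoef (fun w => f w - g w) z 1 = tcoef f z 1 - tcoef g z 1.
Proof.
move=> ef eg.
have Df := is_derive_tcoef1 z ef; have Dg := is_derive_tcoef1 z eg.
have D := is_derive_tcoef1 z (entireB ef eg).
have D' := @is_deriveB _ C^o C^o (f : C^o -> C^o) (g : C^o -> C^o) z 1 _ _ Df Dg.
by rewrite -(@derive_val _ _ _ _ _ _ _ D) -(@derive_val _ _ _ _ _ _ _ D').
Qed.

(** The first-order Taylor inequality holds for all [u n] with one constant [M], hence passes to the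
    limit. The first coefficients converge, Cauchy's estimate being applied to the differences
    [u m - u n]. *)
Lemma locally_uniform_limit_entire u g : (forall n, entire (u n)) ->
  locally_uniformly_bounded u -> locally_uniform_cvg u g -> entire g.
Proof.
move=> eu bu ug z.
have [M HM] := bu (cmod z + 2).
have [d dP] : exists d, cconv (fun n => tcoef (u n) z 1) d.
  apply: cconv_cauchy => e e0; have e2 : 0 < e / 2 by rewrite divr_gt0.
  have [N HN] := ug (cmod z + 1) _ e2; exists N => m n Nm Nn.
  rewrite -tcoef1B; [|exact: eu..].
  have := @tcoef_bound R (fun w => u m w - u n w) z 1 e 1 (entireB (eu m) (eu n)) ltr01.
  rewrite expr1 divr1; apply => w w1.
  have zw : cmod (z + w) <= cmod z + 1 by rewrite -w1 cmodD.
  have -> : u m (z + w) - u n (z + w) = (u m (z + w) - g (z + w)) - (u n (z + w) - g (z + w)) by ring.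
  apply: le_trans (cmodD _ _) _; rewrite cmodN (splitr e).
  exact: lerD (HN m Nm _ zw) (HN n Nn _ zw).
have pt w : cconv (fun n => u n w) (g w).
  move=> e /(ug (cmod w))[N HN]; exists N => n /HN; exact.
apply: (@is_derive_derivable R g z d).
apply: (@is_derive_quadratic R g z d 1 M ltr01) => h /ltW h1.
apply: (@cconv_le (fun n => u n (z + h) - u n z - tcoef (u n) z 1 * h)).
  by apply: cconvB; [exact: cconvB|exact: cconvMr].
move=> n; apply: (taylor1 (eu n) _ h1).
by move=> w w2; apply: HM; rewrite -w2; exact: cmodD.
Qed.

(** Cauchy's estimates bound every Taylor coefficient at 0 along the sequence; a subsequence along
    which all of them converge is uniformly Cauchy on discs. *)
Lemma montel u : (forall n, entire (u n)) -> locally_uniformly_bounded u ->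
  exists (h : nat -> nat) (g : C -> C),
    [/\ forall m n, (m < n)%N -> (h m < h n)%N, entire g &
        locally_uniform_cvg (fun n => u (h n)) g].
Proof.
move=> eu bu; have [M HM] := bu 1.
have cb n k : cmod (tcoef (u n) 0 k) <= M.
  have := @tcoef_bound R (u n) 0 1 M k (eu n) ltr01.
  by rewrite expr1n divr1; apply => w w1; rewrite add0r HM// w1.
(* Real parts sit at even indices and imaginary parts at odd ones, so that a single real extraction
   handles both. *)
pose x n k := if odd k then complex.Im (tcoef (u n) 0 k./2) else complex.Re (tcoef (u n) 0 k./2).
have [|h [p [hS hp]]] := @diagonal_subsequence R x (fun=> M).
  move=> n k; rewrite /x; case: ifP => _; apply: le_trans (cb n k./2).
    exact: normIm_le_cmod.
  exact: normRe_le_cmod.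
have bh : locally_uniformly_bounded (fun n => u (h n)).
  by move=> r; have [M' HM'] := bu r; exists M' => n; exact: HM'.
have cl k : cconv (fun n => tcoef (u (h n)) 0 k) (p k.*2 +i* p k.*2.+1).
  move=> e e0; have e2 : 0 < e / 2 by rewrite divr_gt0.
  have [N HN] := hp k.*2 _ e2; have [N' HN'] := hp k.*2.+1 _ e2.
  exists (maxn N N') => n; rewrite geq_max => /andP[/HN + /HN'].
  rewrite /x /= odd_double /= doubleK uphalf_double => h1 h2.
  apply: le_trans (cmod_le_ReIm _) _; rewrite Re_add Im_add Re_opp Im_opp /=.
  by rewrite (splitr e) lerD.
have [g gP] := uniform_cauchy_cvg (coefficients_uniform_cauchy (fun n => eu (h n)) bh cl).
exists h, g; split=> //.
exact: locally_uniform_limit_entire (fun n => eu (h n)) bh gP.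
Qed.

End Montel.

(** * Weighted composition operators *)

Section WeightedComposition.
Variable R : realType.
Local Notation C := R[i].
Variables (alpha : R) (a l : C) (psi : C -> C) (p : \bar R) (X : set (C -> C)).
Variables (alpha_gt0 : 0 < alpha) (l_gt0 : 0 < cmod l).
Variables (entire_psi : entire psi) (p_ge1 : (1 <= p)%E).
Variable XE : X = fock alpha p \/ (p = +oo%E /\ X = fock0 alpha).

Let phi (z : C) : C := a + l * z.
Let N := fock_norm alpha p.
Let W := wcomp psi phi.

Definition weight (z : C) : R :=
  cmod (psi z) * expR (alpha / 2 * (cmod (phi z) ^+ 2 - cmod z ^+ 2)).

Definition kernel (w z : C) : C :=
  cexp (alpha%:C * w^* * z - (alpha / 2 * cmod w ^+ 2)%:C).

Lemma weight_ge0 z : 0 <= weight z.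
Proof. by rewrite mulr_ge0 ?cmod_ge0 ?expR_ge0. Qed.

Lemma wmod_wcomp f z : wmod alpha (W f) z = weight z * wmod alpha f (phi z).
Proof.
rewrite /wmod /W /wcomp /weight cmodM.
set e1 := expR _; set e2 := expR _; set e3 := expR _.
have -> : e1 = e2 * e3 by rewrite /e1 /e2 /e3 -expRD; congr expR; ring.
ring.
Qed.

Lemma wmod_sub f g z : wmod alpha f z <= wmod alpha (fun w => f w - g w) z + wmod alpha g z.
Proof.
rewrite /wmod -mulrDl ler_wpM2r ?expR_ge0//.
by rewrite -[in leLHS](subrK (g z) (f z)) cmodD.
Qed.

Lemma entire_phi : entire phi.
Proof. exact: entire_affine. Qed.

Lemma entire_wcomp f : entire f -> entire (W f).
Proof.
by move=> ef; apply: (entireM entire_psi); exact: (entire_comp ef entire_phi).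
Qed.

Lemma entire_kernel w : entire (kernel w).
Proof.
apply: (entire_comp (@entire_cexp R)).
rewrite (_ : (fun _ => _) = fun z : C => - (alpha / 2 * cmod w ^+ 2)%:C + (alpha%:C * w^*) * z).
  exact: entire_affine.
by apply/funext => z; rewrite addrC.
Qed.

Lemma wmod_kernel w z : wmod alpha (kernel w) z = expR (- (alpha / 2) * cmod (z - w) ^+ 2).
Proof.
rewrite /wmod /kernel cmod_cexp -expRD; congr expR.
rewrite conjE !cmod_sqr !(Re_add, Re_opp, Re_mul, Im_mul, Im_add, Im_opp) /=.
by field.
Qed.

Lemma gaussian_small (d eps e : R) : 0 <= d -> 0 < eps -> 0 < e ->
  exists2 r : R, 0 <= r & forall t, r < t -> d * expR (- eps * t ^+ 2) < e.
Proof.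
move=> d0 eps0 e0; have q0 : 0 <= d / (e * eps) by rewrite divr_ge0// ltW// mulr_gt0.
(* Beyond 1, [t <= t^2], and [exp x >= 1 + x] gives [e * exp (eps t^2) > d]. *)
exists (1 + d / (e * eps)); first by rewrite addr_ge0.
move=> t rt; have t1 : 1 < t by lra.
have t0 : 0 < t by lra.
rewrite mulNr expRN ltr_pdivrMr ?expR_gt0//.
apply: (@lt_le_trans _ _ (e * (1 + eps * t ^+ 2))); last first.
  by rewrite ler_wpM2l ?(ltW e0)// expR_ge1Dx.
have tt : t <= t ^+ 2 by rewrite expr2 ler_peMl// ltW.
have h1 : d / (e * eps) * (e * eps) = d by rewrite divfK// mulf_neq0// gt_eqF.
have h2 : d / (e * eps) < t ^+ 2 by lra.
have := ltr_pM2r (mulr_gt0 e0 eps0) (d / (e * eps)) (t ^+ 2).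
rewrite h2 h1 => h3; apply: (lt_trans h3); lra.
Qed.

(** Gaussian decay also yields the limit condition of the vanishing subspace, so that one statement
    covers every choice of [X]. *)
Lemma X_gaussian : exists2 K : R -> R, (forall eps, 0 <= K eps) &
  forall eps (F : C -> C) (d : R) c, 0 < eps -> entire F -> 0 <= d ->
    (forall z, wmod alpha F z <= d * expR (- eps * cmod (z - c) ^+ 2)) ->
    X F /\ (N F <= (K eps * d)%:E)%E.
Proof.
have /choice[K KP] : forall eps : R, exists K, 0 <= K /\ (0 < eps ->
    forall (F : C -> C) (d : R), entire F -> 0 <= d ->
    (exists c, forall z, wmod alpha F z <= d * expR (- eps * cmod (z - c) ^+ 2)) ->
    (N F <= (K * d)%:E)%E).
  (* Nothing is claimed for [eps <= 0], where 0 is a default value. *)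
  move=> eps; have [e0|e0] := ltP 0 eps; last by exists 0; split.
  by have [K K0 KP] := gaussian_bound alpha_gt0 p_ge1 e0; exists K.
exists K => [eps|eps F d c e0 eF d0 H]; first by have [] := KP eps.
have NF : (N F <= (K eps * d)%:E)%E.
  by have [_ /(_ e0 F d eF d0)] := KP eps; apply; exists c.
split=> //.
have fF : fock alpha p F by split=> //; apply: le_lt_trans NF _; exact: ltry.
case: XE => [->//|[pE ->]]; split; first by rewrite -pE.
move=> e /(gaussian_small d0 e0)[r r0 Hr]; exists (cmod c + r) => z cz.
rewrite cmodM cmod_real ger0_norm ?expR_ge0//.
apply: le_lt_trans (H z) (Hr _ _).
have := cmodD (z - c) c; rewrite subrK; lra.
Qed.

Lemma X_entire f : X f -> entire f.
Proof. by case: XE => [->|[_ ->]]; [case|case=> -[]]. Qed.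

Lemma X_finite f : X f -> (N f < +oo)%E.
Proof. by case: XE => [->|[pE ->]]; [case|case=> -[_]; rewrite /N pE]. Qed.

Lemma bounded_of_weight B : (forall z, weight z <= B) -> bounded_operator X N W.
Proof.
move=> WB; have B0 : 0 <= B := le_trans (weight_ge0 0) (WB 0).
have l0 : l != 0 by rewrite -cmod_gt0.
have [K K0 KP] := composition_bound a alpha_gt0 p_ge1 l0 B0.
have NW f : entire f -> (N (W f) <= K%:E * N f)%E.
  move=> ef; apply: (KP f (W f) ef (entire_wcomp ef)).
  by move=> z; rewrite wmod_wcomp ler_wpM2r ?wmod_ge0.
have XW f : X f -> X (W f).
  move=> Xf; have ef := X_entire Xf.
  have fW : fock alpha p (W f).
    split; first exact: (entire_wcomp ef).
    apply: le_lt_trans (NW f ef) _.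
    by rewrite lte_mul_pinfty ?lee_fin// X_finite.
  case: XE => [->//|[pE X0]]; rewrite X0; split; first by rewrite -pE.
  move: Xf; rewrite X0 => -[_ f0] e e0.
  have B1 : 0 < B + 1 by rewrite ltr_wpDl.
  have [r Hr] := f0 _ (divr_gt0 e0 B1).
  (* Beyond this radius [|phi z| >= |l| |z| - |a| > r]: decay of [f] at infinity passes to its
     composition with [phi]. *)
  exists ((`|r| + cmod a) / cmod l) => z.
  rewrite ltr_pdivrMr// => rz.
  have rphi : r < cmod (phi z).
    have := cmodD (phi z) (- a); rewrite cmodN {1}/phi addrAC subrr add0r cmodM.
    have := ler_norm r; lra.
  have := Hr _ rphi; rewrite !cmodM !cmod_real !(ger0_norm (expR_ge0 _)) => hr.
  rewrite -/(wmod alpha (W f) z) -cmodM -/(wmod alpha (W f) z) wmod_wcomp.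
  apply: le_lt_trans (_ : _ <= (B + 1) * wmod alpha f (phi z)) _.
    by rewrite ler_wpM2r ?wmod_ge0// (le_trans (WB z))// lerDl.
  by rewrite -ltr_pdivlMl// mulrC.
split; last by exists K; split; [exact: K0|move=> f /X_entire; exact: NW].
split; [exact: XW|move=> c d f g _ _; apply/funext => z; rewrite /W /wcomp; ring].
Qed.

Lemma weight_of_bounded : bounded_operator X N W -> exists B, forall z, weight z <= B.
Proof.
move=> [_ [K1 [K10 HK1]]].
have [K2 K20 HK2] := point_eval alpha_gt0 p_ge1.
have [K3 K30 HK3] := X_gaussian.
have a2 : 0 < alpha / 2 by rewrite divr_gt0.
exists (K2 * (K1 * K3 (alpha / 2))) => z.
have [||Xk Nk] := HK3 (alpha / 2) (kernel (phi z)) 1 (phi z) a2 (@entire_kernel _).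
- exact: ler01.
- by move=> w; rewrite wmod_kernel mul1r.
rewrite mulr1 in Nk.
have := HK2 _ (entire_wcomp (X_entire Xk)) z.
rewrite wmod_wcomp wmod_kernel subrr cmod0 expr0n /= mulr0 expR0 mulr1 => H.
rewrite -lee_fin (le_trans H)// !EFinM lee_wpmul2l ?lee_fin ?(ltW K20)//.
apply: le_trans (HK1 _ Xk) _; by rewrite lee_wpmul2l ?lee_fin.
Qed.

Lemma ereal_cvg0_small (x : nat -> \bar R) (e : R) : x @ \oo --> 0%E -> 0 < e ->
  exists n0, forall n, (n0 <= n)%N -> (x n < e%:E)%E.
Proof.
move=> x0 e0; have : nbhs (0 : \bar R)%E [set y | (y < e%:E)%E].
  by apply: open_nbhs_nbhs; split; [exact: open_ereal_lt_ereal|rewrite /= lte_fin].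
by move=> /x0[n0 _ H]; exists n0 => n /H.
Qed.

(** Otherwise the weight is at least [e] at points [zs n] tending to infinity. The images of the
    kernels centred at [phi (zs n)] have [wmod] at least [e] at [zs n], while they tend to 0
    pointwise because [|phi z - phi (zs n)|] tends to infinity. *)
Lemma weight_of_compact : compact_operator X N W ->
  forall e, 0 < e -> exists r, forall z, r < cmod z -> weight z < e.
Proof.
move=> [[XW _] cW] e e0; apply: contrapT => /forallNP nW.
have /choice[zs zsP] : forall n : nat, exists z, n%:R < cmod z /\ e <= weight z.
  move=> n; have /existsNP[z /not_implyP[nz /negP]] := nW n%:R.
  by rewrite -leNgt => ez; exists z.
have [K2 K20 HK2] := point_eval alpha_gt0 p_ge1.
have [K3 K30 HK3] := X_gaussian.
have a2 : 0 < alpha / 2 by rewrite divr_gt0.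
have kP w : X (kernel w) /\ (N (kernel w) <= (K3 (alpha / 2) * 1)%:E)%E.
  apply: (HK3 (alpha / 2) (kernel w) 1 w a2 (@entire_kernel w) ler01).
  by move=> z; rewrite wmod_kernel mul1r.
have [||h [g [hS Xg cv]]] := cW (fun n => kernel (phi (zs n))).
- by move=> n; have [] := kP (phi (zs n)).
- by exists (K3 (alpha / 2) * 1) => n; have [] := kP (phi (zs n)).
have hn n : (n <= h n)%N by elim: n => // n IH; exact: leq_ltn_trans IH (hS _ _ (leqnn _)).
have diff e' : 0 < e' -> exists n0, forall n, (n0 <= n)%N -> forall z,
    wmod alpha (fun w => W (kernel (phi (zs (h n)))) w - g w) z < e'.
  move=> e'0; have [n0 Hn0] := ereal_cvg0_small cv (divr_gt0 e'0 K20).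
  exists n0 => n /Hn0 Hn z; rewrite -lte_fin.
  have eD : entire (fun w => W (kernel (phi (zs (h n)))) w - g w).
    exact: (entireB (entire_wcomp (@entire_kernel _)) (X_entire Xg)).
  apply: le_lt_trans (HK2 _ eD z) _.
  by rewrite muleC -lte_pdivlMr.
have g0 z : g z = 0.
  apply/eqP; rewrite -cmod_eq0 eq_le cmod_ge0 andbT.
  suff : wmod alpha g z <= 0 by rewrite /wmod pmulr_lle0// expR_gt0.
  apply/ler_addgt0Pr => e' e'0; rewrite add0r.
  have e2 : 0 < e' / 2 by rewrite divr_gt0.
  have eps0 : 0 < alpha / 2 * cmod l ^+ 2 by rewrite mulr_gt0 ?exprn_gt0.
  have [r r0 Hr] := gaussian_small (weight_ge0 z) eps0 e2.
  have [n0 Hn0] := diff _ e2.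
  (* As [h n >= n] and [|zs k| > k], this puts [zs (h n)] at distance more than [r] from [z]. *)
  pose n := maxn n0 (Num.bound (r + cmod z)).
  have rz : r < cmod (zs (h n) - z).
    have [nz _] := zsP (h n).
    have := cmodD (zs (h n) - z) z; rewrite subrK => h1.
    have h2 : r + cmod z < (h n)%:R.
      have := archi_boundP (addr_ge0 r0 (cmod_ge0 z)).
      move=> /lt_le_trans; apply; rewrite ler_nat.
      by apply: leq_trans (hn n); exact: leq_maxr.
    lra.
  have h1 := Hn0 n (leq_maxl _ _) z.
  have h2 := Hr _ rz.
  set u := W (kernel (phi (zs (h n)))) in h1.
  have h3 : wmod alpha u z < e' / 2.
    rewrite /u wmod_wcomp wmod_kernel.
    have -> : phi z - phi (zs (h n)) = - (l * (zs (h n) - z)) by rewrite /phi; ring.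
    apply: le_lt_trans h2; rewrite cmodN cmodM exprMn.
    by rewrite le_eqVlt; apply/orP; left; apply/eqP; congr (_ * expR _); ring.
  have -> : wmod alpha g z = wmod alpha (fun w => u w - (u w - g w)) z.
    by rewrite /wmod subKr.
  rewrite (splitr e'); apply: (@le_trans _ _ (wmod alpha (fun w => u w - g w) z + wmod alpha u z)); last by rewrite ltW// ltrD.
  rewrite /wmod -mulrDl ler_wpM2r ?expR_ge0// addrC.
  by apply: le_trans (cmodD _ _) _; rewrite cmodN.
(* At the point [zs (h n0)] the kernel contributes 1, so [wmod] of its image is the weight there. *)
have [n0 /(_ n0 (leqnn _) (zs (h n0)))] := diff _ e0.
have -> : (fun w => W (kernel (phi (zs (h n0)))) w - g w) = W (kernel (phi (zs (h n0)))).
  by apply/funext => w; rewrite g0 subr0.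
rewrite wmod_wcomp wmod_kernel subrr cmod0 expr0n /= mulr0 expR0 mulr1.
by have [_] := zsP (h n0); rewrite leNgt => /negbTE ->.
Qed.

Lemma weight_bounded_of_vanishing r : (forall z, r < cmod z -> weight z < 1) ->
  exists B, forall z, weight z <= B.
Proof.
move=> H; have [M M0 HM] := @local_bound R psi r (entire_continuous entire_psi).
exists (Num.max 1 (M * expR (alpha / 2 * (cmod a + cmod l * r) ^+ 2))) => z.
rewrite le_max; have [rz|zr] := ltP r (cmod z); first by rewrite ltW ?H.
apply/orP; right; rewrite ler_pM ?cmod_ge0 ?expR_ge0 ?HM// ler_expR.
rewrite ler_wpM2l ?divr_ge0 ?(ltW alpha_gt0)//.
apply: (@le_trans _ _ (cmod (phi z) ^+ 2)); first by rewrite gerBl sqr_ge0.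
have r0 : 0 <= r := le_trans (cmod_ge0 z) zr.
rewrite lerXn2r ?nnegrE ?cmod_ge0//; first by rewrite addr_ge0 ?mulr_ge0 ?cmod_ge0.
by apply: le_trans (cmodD _ _) _; rewrite lerD2l cmodM ler_wpM2l ?cmod_ge0.
Qed.

(** Dropping the nonnegative term in [|phi z|^2] from the logarithm of the weight leaves a quadratic
    upper bound on the real part of [L]. *)
Lemma quadratic_of_weight B : (forall z, psi z != 0) -> (forall z, weight z <= B) ->
  exists a0 a1 a2, forall z, psi z = cexp (a0 + a1 * z + a2 * z ^+ 2).
Proof.
move=> psi0 WB; have [L eL psiL] := entire_log entire_psi psi0.
have LB z : complex.Re (L z) <= ln B + alpha / 2 * cmod z ^+ 2.
  have := WB z; rewrite /weight psiL cmod_cexp -expRD => H.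
  have B0 : 0 < B := lt_le_trans (expR_gt0 _) H.
  move: H; rewrite -[B in X in X -> _](lnK B0) ler_expR => H.
  have : 0 <= alpha / 2 * cmod (phi z) ^+ 2.
    by rewrite mulr_ge0 ?sqr_ge0// divr_ge0// ltW.
  lra.
exists (tcoef L 0 0), (tcoef L 0 1), (tcoef L 0 2) => z.
by rewrite psiL -(quadratic_of_Re_bound eL LB).
Qed.

(** The exponent [2 * eps] splits the Gaussian into two equal factors. One beats the bound [2 * D]
    outside a large disc, while inside it locally uniform convergence takes over; the other keeps
    the difference under a Gaussian of small height, which [X_gaussian] turns into a small norm. *)
Lemma compact_of_weight B eps : 0 < eps ->
  (forall z, weight z <= B * expR (- (2 * eps) * cmod z ^+ 2)) -> compact_operator X N W.
Proof.
move=> eps0 WB.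
have B0 : 0 <= B.
  by have := le_trans (weight_ge0 0) (WB 0); rewrite cmod0 expr0n /= mulr0 expR0 mulr1.
have WB' z : weight z <= B.
  apply: le_trans (WB z) _; rewrite ler_piMr// -expR0 ler_expR mulNr oppr_le0.
  by rewrite mulr_ge0 ?sqr_ge0// mulr_ge0 ?(ltW eps0).
have [lW _] := bounded_of_weight WB'.
split; first exact: lW.
move=> u Xu [M0 HM0].
have eu n : entire (u n) := X_entire (Xu n).
have [K2 K20 HK2] := point_eval alpha_gt0 p_ge1.
have [K3 K30 HK3] := X_gaussian.
have M00 : 0 <= M0 by rewrite -lee_fin (le_trans _ (HM0 0%N))// fock_norm_ge0.
pose D := K2 * M0; have D0 : 0 <= D by rewrite mulr_ge0// ltW.
have uD n z : wmod alpha (u n) z <= D.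
  rewrite -lee_fin (le_trans (HK2 _ (eu n) z))// EFinM lee_wpmul2l// lee_fin ltW//.
have wmodK f z : cmod (f z) = wmod alpha f z * expR (alpha / 2 * cmod z ^+ 2).
  by rewrite /wmod -mulrA -expRD mulNr addNr expR0 mulr1.
have bu : locally_uniformly_bounded u.
  move=> r; exists (D * expR (alpha / 2 * r ^+ 2)) => n z zr.
  rewrite wmodK ler_pM ?wmod_ge0 ?expR_ge0// ler_expR ler_wpM2l ?divr_ge0 ?(ltW alpha_gt0)//.
  by rewrite lerXn2r ?nnegrE ?cmod_ge0// (le_trans (cmod_ge0 z)).
have [h [g [hS eg ug]]] := montel eu bu.
have wmod_le f z : wmod alpha f z <= cmod (f z).
  rewrite ler_piMr ?cmod_ge0// -expR0 ler_expR mulNr oppr_le0.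
  by rewrite mulr_ge0 ?sqr_ge0// divr_ge0// ltW.
have gD z : wmod alpha g z <= D.
  apply/ler_addgt0Pr => e /(ug (cmod z))[n /(_ n (leqnn _) z (lexx _)) Hn].
  apply: le_trans (wmod_sub g (u (h n)) z) _; rewrite addrC lerD//.
  by apply: le_trans (wmod_le _ _) _; rewrite -cmodN opprB.
exists h, (W g).
(* Only [wmod alpha g <= D] is known of the Montel limit [g], not [X g]; the decay of the weight is
   what brings [W g] into [X]. *)
have [|||XWg _] := HK3 (2 * eps) (W g) (B * D) 0 _ (entire_wcomp eg).
- by rewrite mulr_gt0.
- exact: mulr_ge0.
- move=> z; rewrite subr0 wmod_wcomp [leRHS]mulrAC.
  by apply: ler_pM; [exact: weight_ge0|exact: wmod_ge0|exact: WB|exact: gD].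
split; [exact: hS|exact: XWg|].
pose K4 := K3 eps * B + 1.
have K40 : 0 < K4 by rewrite ltr_wpDl// mulr_ge0.
have small e : 0 < e -> exists n0, forall n, (n0 <= n)%N ->
    (N (fun z => (W (u (h n)) z - W g z)%R) <= e%:E)%E.
  move=> e0; pose e1 := e / K4; have e10 : 0 < e1 by rewrite divr_gt0.
  have [|r r0 Hr] := @gaussian_small (2 * D) eps e1 _ eps0 e10; first by rewrite mulr_ge0.
  (* The radius is chosen so that [phi] maps the disc of radius [r] into the disc of uniform
     convergence. *)
  have [n0 Hn0] := ug (cmod a + cmod l * r) _ e10.
  exists n0 => n nn0.
  have [|||_] := HK3 eps (fun z => W (u (h n)) z - W g z) (B * e1) 0 eps0.
  - exact: (entireB (entire_wcomp (eu _)) (entire_wcomp eg)).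
  - by rewrite mulr_ge0// ltW.
  - move=> z; rewrite subr0.
    have -> : wmod alpha (fun w => W (u (h n)) w - W g w) z =
        weight z * wmod alpha (fun w => u (h n) w - g w) (phi z).
      rewrite -wmod_wcomp; congr (wmod alpha _ z).
      by apply/funext => w; rewrite /W /wcomp mulrBr.
    have E2 : expR (- (2 * eps) * cmod z ^+ 2) =
        expR (- eps * cmod z ^+ 2) * expR (- eps * cmod z ^+ 2).
      by rewrite -expRD; congr expR; ring.
    apply: (@le_trans _ _ (B * expR (- (2 * eps) * cmod z ^+ 2) * wmod alpha (fun w => u (h n) w - g w) (phi z))).
      by rewrite ler_wpM2r ?wmod_ge0.
    rewrite E2; set G := expR _; set w := wmod _ _ _.
    have -> : B * (G * G) * w = B * G * (G * w) by ring.
    rewrite [leRHS]mulrAC ler_wpM2l ?mulr_ge0 ?expR_ge0// /G /w.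
    have [rz|zr] := ltP r (cmod z).
      rewrite mulrC; apply: le_trans (ltW (Hr _ rz)).
      rewrite ler_wpM2r ?expR_ge0//.
      rewrite mulr_natl mulr2n; apply: le_trans (lerD (uD (h n) (phi z)) (gD (phi z))).
      rewrite /wmod -mulrDl ler_wpM2r ?expR_ge0//.
      by apply: le_trans (cmodD _ _) _; rewrite cmodN.
    apply: (@le_trans _ _ (wmod alpha (fun w => u (h n) w - g w) (phi z))).
      rewrite ler_piMl ?wmod_ge0// -expR0 ler_expR mulNr oppr_le0.
      by rewrite mulr_ge0 ?sqr_ge0// ltW.
    apply: le_trans (wmod_le _ _) _; apply: Hn0 => //.
    apply: le_trans (cmodD _ _) _; rewrite cmodM lerD2l ler_wpM2l// ltW//.
  move=> /le_trans; apply; rewrite lee_fin.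
  have -> : K3 eps * (B * e1) = e * (K3 eps * B / K4) by rewrite /e1; ring.
  rewrite ler_piMr ?(ltW e0)//.
  by rewrite ler_pdivrMr// mul1r lerDl.
move=> A A0; have /nbhs_ballP[e /= e0 eA] : nbhs (0 : R) (fun r => A r%:E) := A0.
have [n0 Hn0] := small (e / 2) (divr_gt0 e0 (ltr0n _ 2)).
exists n0 => // n /Hn0; rewrite /preimage /=; set y := N _ => ye.
have : (0 <= y)%E by exact: fock_norm_ge0.
case: y ye => [y|//|//]; rewrite !lee_fin => ye y0.
apply: eA; rewrite /ball /= sub0r normrN ger0_norm//.
by apply: le_lt_trans ye _; lra.
Qed.

End WeightedComposition.

(** * Quadratic exponents *)

Section QuadraticWeight.
Variable R : realType.
Local Notation C := R[i].
Implicit Types (a t u z : C) (k : R).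

Lemma cmod_conj z : cmod z^* = cmod z.
Proof.
apply/eqP; rewrite -(@eqrXn2 _ 2) ?cmod_ge0//.
by rewrite conjE !cmod_sqr /= sqrrN.
Qed.

Lemma real_quadratic_bounded (A b B : R) :
  (forall s, s ^+ 2 * A + s * b <= B) ->
  A <= 0 /\ (A = 0 -> b = 0).
Proof.
move=> H; split.
  rewrite leNgt; apply/negP => A0.
  (* Averaging the values at [s] and [- s] removes the linear term, and [s >= 1] gives
     [s^2 A >= s A = A + |B| > B]. *)
  pose s := 1 + `|B| / A.
  have s1 : 1 <= s by rewrite lerDl divr_ge0// ltW.
  have h1 : s ^+ 2 * A <= B.
    by have := H s; have := H (- s); rewrite sqrrN mulNr; lra.
  have h2 : s * A = A + `|B| by rewrite /s mulrDl mul1r divfK ?gt_eqF.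
  have h3 : s * A <= s ^+ 2 * A by rewrite expr2 -mulrA ler_peMl// mulr_ge0 ?ltW//; lra.
  have := ler_norm B; lra.
move=> A0; apply/eqP; apply: contraT => b0.
by have := H ((B + 1) / b); rewrite A0 mulr0 add0r divfK//; lra.
Qed.

(** Halving a logarithm of the conjugate of [a2] over its modulus gives a unimodular square root. *)
Lemma quadratic_direction a2 : exists2 u, cmod u = 1 & a2 * u ^+ 2 = (cmod a2)%:C.
Proof.
have [->|a20] := eqVneq a2 0; first by exists 1; rewrite ?cmod1// cmod0 mul0r.
have c0 : (cmod a2)%:C != 0 :> C.
  by rewrite -cmod_eq0 cmod_real normr_eq0 cmod_eq0.
have [|c cE] := @cexp_surj R (a2^* / (cmod a2)%:C).
  by rewrite mulf_neq0 ?invr_eq0// -cmod_eq0 cmod_conj cmod_eq0.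
have uE : cexp (c / 2) ^+ 2 = a2^* / (cmod a2)%:C.
  by rewrite cE expr2 -cexpD; congr cexp; field.
exists (cexp (c / 2)).
  apply/eqP; rewrite -(@eqrXn2 _ 2) ?cmod_ge0// -cmodX uE cmod_div cmod_conj cmod_real.
  by rewrite ger0_norm ?cmod_ge0// divff ?expr1n// cmod_eq0.
rewrite uE mulrA; apply: (canLR (mulfK c0)).
apply/complex_ext; rewrite conjE !(Re_mul, Im_mul) /= ?cmod_sqr.
  have := cmod_sqr a2; rewrite !expr2; lra.
by ring.
Qed.

Lemma quadratic_bounded_coefficient a2 t k (B : R) :
  (forall z, complex.Re (a2 * z ^+ 2 + t * z) - k * cmod z ^+ 2 <= B) ->
  cmod a2 <= k /\ (cmod a2 = k -> exists u (y : R),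
    [/\ cmod u = 1, a2 * u ^+ 2 = k%:C & t * u = 0 +i* y]).
Proof.
move=> H; have [u u1 au] := quadratic_direction a2.
have [|A0 Ab] := @real_quadratic_bounded (cmod a2 - k) (complex.Re (t * u)) B.
  move=> s; apply: le_trans (H (s%:C * u)).
  have -> : a2 * (s%:C * u) ^+ 2 + t * (s%:C * u) = (s ^+ 2)%:C * (a2 * u ^+ 2) + s%:C * (t * u).
    by rewrite rmorphXn /=; ring.
  rewrite au cmodM cmod_real u1 mulr1 real_normK ?num_real//.
  rewrite Re_add !Re_mul /=; lra.
split=> [|ak]; first by rewrite -subr_le0.
exists u, (complex.Im (t * u)); split=> //; first by rewrite au ak.
by rewrite -Ab ?ak ?subrr//; case: (t * u).
Qed.

(** As [t u] is imaginary and [u] unimodular, [t^2 u^2 = - |t|^2]; dividing [a2 u^2 = k] by [u^2]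
    gives the formula for [a2]. *)
Lemma direction_condition a2 t u k (y : R) : cmod u = 1 -> a2 * u ^+ 2 = k%:C ->
  t * u = 0 +i* y -> t = 0 \/ (t != 0 /\ a2 = - k%:C * (t ^+ 2 / `|t| ^+ 2)).
Proof.
move=> u1 au tu; have [->|t0] := eqVneq t 0; [by left|right; split=> //].
have u0 : u != 0 by rewrite -cmod_eq0 u1 oner_neq0.
have ty : cmod t ^+ 2 = y ^+ 2.
  have : cmod (t * u) = cmod t by rewrite cmodM u1 mulr1.
  by rewrite tu => <-; rewrite cmod_sqr /= expr0n add0r.
have tt0 : (`|t| ^+ 2 : C) != 0 by rewrite expf_neq0// normr_eq0.
have E : (t * u) ^+ 2 = - `|t| ^+ 2.
  rewrite tu cmodE -rmorphXn /= ty; apply/complex_ext; rewrite /= ?expr2; ring.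
apply: (mulIf (expf_neq0 2 u0)); rewrite au.
rewrite (_ : _ * u ^+ 2 = - k%:C * ((t * u) ^+ 2 / `|t| ^+ 2)); last by ring.
by rewrite E [X in _ * X]mulNr divff// mulrN1 opprK.
Qed.

(** For [t != 0] the direction is [i] times the conjugate of [t / |t|], which sends [t] to [i |t|];
    for [t = 0] the direction given by [a2] alone serves, with [y = 0]. *)
Lemma direction_of_condition a2 t k : cmod a2 = k ->
  t = 0 \/ (t != 0 /\ a2 = - k%:C * (t ^+ 2 / `|t| ^+ 2)) ->
  exists u (y : R), [/\ cmod u = 1, a2 * u ^+ 2 = k%:C & t * u = 0 +i* y].
Proof.
move=> ak [->|[t0 aE]].
  by have [u u1 au] := quadratic_direction a2; exists u, 0; rewrite au ak mul0r.
have c0 : (cmod t)%:C != 0 :> C by rewrite -cmod_eq0 cmod_real normr_eq0 cmod_eq0.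
have tt : t * t^* = (cmod t)%:C ^+ 2.
  rewrite -rmorphXn /= cmod_sqr conjE; apply/complex_ext; rewrite !(Re_mul, Im_mul) /=; ring.
exists ('i * (t^* / (cmod t)%:C)), (cmod t); split.
- rewrite cmodM cmodi mul1r cmod_div cmod_conj cmod_real ger0_norm ?cmod_ge0//.
  by rewrite divff// cmod_eq0.
- rewrite aE cmodE exprMn sqr_i.
  have -> : - k%:C * (t ^+ 2 / (cmod t)%:C ^+ 2) * (-1 * (t^* / (cmod t)%:C) ^+ 2)
    = k%:C * ((t * t^*) ^+ 2 / (cmod t)%:C ^+ 4) by field.
  by rewrite tt -exprM divff ?mulr1// expf_neq0.
- have -> : t * ('i * (t^* / (cmod t)%:C)) = 'i * (t * t^* / (cmod t)%:C) by ring.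
  rewrite tt expr2 mulfK//; apply/complex_ext; rewrite ?Re_mul ?Im_mul /=; ring.
Qed.

(** The linear term is absorbed by [T r <= T^2 / (2 d) + d r^2 / 2], which spends half of the margin
    [d]. *)
Lemma quadratic_upper_strict a2 t k (d : R) : 0 < d -> d = k - cmod a2 ->
  forall z, complex.Re (a2 * z ^+ 2 + t * z) - k * cmod z ^+ 2 <=
    cmod t ^+ 2 / (2 * d) - d / 2 * cmod z ^+ 2.
Proof.
move=> d0 dE z.
have h1 : complex.Re (a2 * z ^+ 2 + t * z) <= cmod a2 * cmod z ^+ 2 + cmod t * cmod z.
  rewrite -cmodX -!cmodM; apply: le_trans (ler_norm _) _.
  by apply: le_trans (normRe_le_cmod _) _; exact: cmodD.
set T := cmod t in h1 *; set r := cmod z in h1 *.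
have h2 : T ^+ 2 / (2 * d) + d / 2 * r ^+ 2 - T * r = (T - d * r) ^+ 2 / (2 * d).
  by field; rewrite gt_eqF.
have h3 : 0 <= (T - d * r) ^+ 2 / (2 * d) by rewrite divr_ge0 ?sqr_ge0// mulr_ge0// ltW.
have h4 : k = d + cmod a2 by rewrite dE subrK.
rewrite h4; lra.
Qed.

(** In the coordinate [v = z / u], with imaginary part [w], the real direction cancels altogether
    and [- 2 k w^2 - y w] remains, with maximum [y^2 / (8 k)]. *)
Lemma quadratic_upper_equality a2 t u k (y : R) : 0 < k -> cmod u = 1 ->
  a2 * u ^+ 2 = k%:C -> t * u = 0 +i* y ->
  forall z, complex.Re (a2 * z ^+ 2 + t * z) - k * cmod z ^+ 2 <= y ^+ 2 / (8 * k).
Proof.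
move=> k0 u1 au tu z; have u0 : u != 0 by rewrite -cmod_eq0 u1 oner_neq0.
have [v zE] : exists v, z = u * v by exists (z / u); rewrite mulrCA divff// mulr1.
have -> : a2 * z ^+ 2 + t * z = a2 * u ^+ 2 * v ^+ 2 + t * u * v by rewrite zE; ring.
rewrite au tu zE cmodM u1 mul1r cmod_sqr [v ^+ 2]expr2 Re_add !Re_mul Im_mul /=.
set x := complex.Re v; set w := complex.Im v.
have h : y ^+ 2 / (8 * k) + y * w + 2 * k * w ^+ 2 = (y + 4 * k * w) ^+ 2 / (8 * k).
  by field; rewrite gt_eqF.
have : 0 <= (y + 4 * k * w) ^+ 2 / (8 * k).
  by rewrite divr_ge0 ?sqr_ge0// mulr_ge0// ltW.
rewrite -h; lra.
Qed.

Lemma quadratic_on_direction a2 t u k (y s : R) : cmod u = 1 ->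
  a2 * u ^+ 2 = k%:C -> t * u = 0 +i* y ->
  complex.Re (a2 * (s%:C * u) ^+ 2 + t * (s%:C * u)) - k * cmod (s%:C * u) ^+ 2 = 0.
Proof.
move=> u1 au tu.
have -> : a2 * (s%:C * u) ^+ 2 + t * (s%:C * u) = (s ^+ 2)%:C * (a2 * u ^+ 2) + s%:C * (t * u).
  by rewrite rmorphXn /=; ring.
rewrite au tu cmodM cmod_real u1 mulr1 real_normK ?num_real//.
rewrite Re_add !Re_mul /=; ring.
Qed.

Lemma weight_exponent (alpha : R) (a l a0 a1 a2 z : C) :
  complex.Re (a0 + a1 * z + a2 * z ^+ 2) + alpha / 2 * (cmod (a + l * z) ^+ 2 - cmod z ^+ 2) =
  complex.Re a0 + alpha / 2 * cmod a ^+ 2 +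
    (complex.Re (a2 * z ^+ 2 + (a1 + alpha%:C * a^* * l) * z)
     - alpha / 2 * (1 - cmod l ^+ 2) * cmod z ^+ 2).
Proof.
rewrite conjE !cmod_sqr !(Re_add, Im_add, Re_mul, Im_mul, expr2) /=.
by field.
Qed.

End QuadraticWeight.

Theorem theorem3p2 (R : realType) (alpha : R) (a lambda : R[i])
    (psi : R[i] -> R[i]) (p : \bar R) (X : set (R[i] -> R[i])) :
  0 < alpha ->
  0 < cmod lambda < 1 ->
  entire psi ->
  (forall z, psi z != 0) ->
  (1 <= p)%E ->
  X = fock alpha p \/ (p = +oo%E /\ X = fock0 alpha) ->
  let phi : R[i] -> R[i] := fun z => a + lambda * z in
  let beta : R := 1 - cmod lambda ^+ 2 in
  let N := fock_norm alpha p in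
  let W := wcomp psi phi in
  (compact_operator X N W <->
     exists a0 a1 a2 : R[i],
       (forall z, psi z = cexp (a0 + a1 * z + a2 * z ^+ 2)) /\
       cmod a2 < alpha / 2 * beta)
  /\
  (bounded_operator X N W /\ ~ compact_operator X N W <->
     exists a0 a1 a2 : R[i],
       [/\ forall z, psi z = cexp (a0 + a1 * z + a2 * z ^+ 2),
           cmod a2 = alpha / 2 * beta &
           let t : R[i] := a1 + alpha%:C * a^* * lambda in
           t = 0 \/
           (t != 0 /\ a2 = - (alpha / 2 * beta)%:C * (t ^+ 2 / `|t| ^+ 2))]).
Proof.
move=> alpha0 /andP[l0 l1] epsi psi0 p1 XE phi beta N W.
set k := alpha / 2 * beta.
have k0 : 0 < k by rewrite mulr_gt0 ?divr_gt0// subr_gt0 expr_lt1// ltW.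
pose M := weight alpha a lambda psi.
have ME a0 a1 a2 z : (forall z, psi z = cexp (a0 + a1 * z + a2 * z ^+ 2)) ->
    M z = expR (complex.Re a0 + alpha / 2 * cmod a ^+ 2 +
      (complex.Re (a2 * z ^+ 2 + (a1 + alpha%:C * a^* * lambda) * z) - k * cmod z ^+ 2)).
  by move=> H; rewrite /M /weight H cmod_cexp -expRD weight_exponent.
have compact_strict a0 a1 a2 : (forall z, psi z = cexp (a0 + a1 * z + a2 * z ^+ 2)) ->
    cmod a2 < k -> compact_operator X N W.
  move=> H a2k; set t := a1 + alpha%:C * a^* * lambda.
  have d0 : 0 < k - cmod a2 by rewrite subr_gt0.
  pose B := expR (complex.Re a0 + alpha / 2 * cmod a ^+ 2 + cmod t ^+ 2 / (2 * (k - cmod a2))).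
  (* A quarter of the margin, so that [2 * eps] is the half left by [quadratic_upper_strict]. *)
  apply: (@compact_of_weight R alpha a lambda psi p X alpha0 l0 epsi p1 XE B ((k - cmod a2) / 4)).
    by rewrite divr_gt0 ?ltr0n.
  move=> z; rewrite -/(M z) (ME _ _ _ z H) -expRD ler_expR -/t.
  have := quadratic_upper_strict t d0 erefl z; lra.
have noncompact a0 a1 a2 u (y : R) : (forall z, psi z = cexp (a0 + a1 * z + a2 * z ^+ 2)) ->
    cmod u = 1 -> a2 * u ^+ 2 = k%:C -> (a1 + alpha%:C * a^* * lambda) * u = 0 +i* y ->
    ~ compact_operator X N W.
  move=> H u1 au tu cW; pose c := complex.Re a0 + alpha / 2 * cmod a ^+ 2.
  (* The threshold [expR c] is exactly the constant value of the weight along the line spanned by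
     [u]. *)
  have [r Hr] := @weight_of_compact R alpha a lambda psi p X alpha0 l0 epsi p1 XE cW (expR c) (expR_gt0 c).
  have rs : r < cmod ((`|r| + 1)%:C * u).
    rewrite cmodM cmod_real u1 mulr1 ger0_norm ?addr_ge0//.
    have := ler_norm r; lra.
  have := Hr _ rs; rewrite -/(M _) (ME _ _ _ _ H) (quadratic_on_direction _ u1 au tu).
  by rewrite addr0 ltxx.
have bounded_quadratic : (exists B, forall z, M z <= B) -> exists a0 a1 a2,
    [/\ forall z, psi z = cexp (a0 + a1 * z + a2 * z ^+ 2), cmod a2 <= k &
      cmod a2 = k -> exists u (y : R), [/\ cmod u = 1, a2 * u ^+ 2 = k%:C &
        (a1 + alpha%:C * a^* * lambda) * u = 0 +i* y]].
  move=> [B MB].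
  have [a0 [a1 [a2 H]]] := @quadratic_of_weight R alpha a lambda psi alpha0 epsi B psi0 MB.
  exists a0, a1, a2.
  have [z|h1 h2] := @quadratic_bounded_coefficient R a2 (a1 + alpha%:C * a^* * lambda) k
    (ln B - (complex.Re a0 + alpha / 2 * cmod a ^+ 2)); last by split.
  have := MB z; rewrite (ME _ _ _ z H) => hB.
  have B0 : 0 < B := lt_le_trans (expR_gt0 _) hB.
  by move: hB; rewrite -[B in X in X -> _](lnK B0) ler_expR; lra.
have compact_bounded : compact_operator X N W -> exists B, forall z, M z <= B.
  move=> cW.
  have [r Hr] := @weight_of_compact R alpha a lambda psi p X alpha0 l0 epsi p1 XE cW 1 ltr01.
  exact: (@weight_bounded_of_vanishing R alpha a lambda psi alpha0 epsi r Hr).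
split; split.
- move=> cW; have [a0 [a1 [a2 [H a2k eqk]]]] := bounded_quadratic (compact_bounded cW).
  exists a0, a1, a2; split=> //; rewrite lt_neqAle a2k andbT; apply/eqP => /eqk [u [y [u1 au tu]]].
  exact: (noncompact a0 a1 a2 u y).
- by move=> [a0 [a1 [a2 [H a2k]]]]; exact: (compact_strict a0 a1 a2).
- move=> [bW ncW].
  have [a0 [a1 [a2 [H a2k eqk]]]] := bounded_quadratic
    (@weight_of_bounded R alpha a lambda psi p X alpha0 epsi p1 XE bW).
  have a2E : cmod a2 = k.
    apply/eqP; rewrite eq_le a2k leNgt; apply/negP => /(compact_strict _ _ _ H); exact: ncW.
  have [u [y [u1 au tu]]] := eqk a2E.
  exists a0, a1, a2; split=> //; exact: (direction_condition u1 au tu).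
- move=> [a0 [a1 [a2 [H a2E cond]]]].
  have [u [y [u1 au tu]]] := direction_of_condition a2E cond.
  split; last exact: (noncompact a0 a1 a2 u y).
  pose B := expR (complex.Re a0 + alpha / 2 * cmod a ^+ 2 + y ^+ 2 / (8 * k)).
  apply: (@bounded_of_weight R alpha a lambda psi p X alpha0 l0 epsi p1 XE B) => z.
  rewrite -/(M z) (ME _ _ _ z H) ler_expR lerD2l.
  exact: (quadratic_upper_equality k0 u1 au tu z).
Qed.
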